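(* There exists a witness set of $\mathrm{SO}(4)$ consisting of $40$ real points.
   Context: Here $\mathrm{SO}(4)$ is viewed as the irreducible complex affine variety $\{M\in\mathbb{C}^{4\times 4}\mid M^TM=I,\ \det M=1\}\subseteq\mathbb{C}^{16}$, which has dimension $6$ and degree $40$. For a variety $X\subseteq\mathbb{C}^n$, the section of $X$ by a hyperplane $\mathcal{H}$ is called degree-generic if $\deg(X\cap\mathcal{H})=\deg(X)$, and dimension-generic if $\dim(X\cap\mathcal{H})=\dim(X)-1$. (The degree of a possibly reducible equidimensional variety is the sum of the degrees of its irreducible components; for a finite set it is the number of points.) A witness set of $X$ is a zero-dimensional intersection $X\cap\mathcal{L}$ with a linear (affine) space $\mathcal{L}$ of codimension $\dim X$, where $X\cap \mathcal{L}$ is required to be obtained through a sequence of $\dim X$ hyperplane sections each of which is both degree-generic and dimension-generic. In particular a witness set of $\mathrm{SO}(4)$ consists of $\deg(\mathrm{SO}(4))=40$ points; a point is real if it lies in $\mathbb{R}^{16}$. *)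

(* Defs.v *)
From HB Require Import structures.
From mathcomp Require Import all_boot all_order all_algebra.
From mathcomp Require Import mpoly.
From mathcomp Require Import boolp classical_sets functions cardinality reals.
From mathcomp Require Import complex.

Set Implicit Arguments.
Unset Strict Implicit.
Unset Printing Implicit Defensive.

Import Order.TTheory GRing.Theory Num.Theory.
Local Open Scope classical_set_scope.
Local Open Scope ring_scope.

Section AffineVarieties.
Variables (K : closedFieldType) (n : nat).
Implicit Types X Y Z H L : set 'rV[K]_n.

Definition zero_locus (S : set {mpoly K[n]}) : set 'rV[K]_n :=
  [set x | forall p, S p -> p.@[x 0] = 0].

Definition zariski_closed X := exists S, X = zero_locus S.

Definition zariski_irreducible X :=
  [/\ zariski_closed X, X !=set0 &
    forall Y Z, zariski_closed Y -> zariski_closed Z ->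
      X `<=` Y `|` Z -> X `<=` Y \/ X `<=` Z].

Definition irreducible_component X Z :=
  [/\ zariski_irreducible Z, Z `<=` X &
    forall Y, zariski_irreducible Y -> Y `<=` X -> Z `<=` Y -> Y = Z].

Definition irreducible_chain X (d : nat) :=
  exists Z : nat -> set 'rV[K]_n,
    (forall i, (i <= d)%N -> zariski_irreducible (Z i) /\ Z i `<=` X) /\
    (forall i, (i < d)%N -> Z i `<` Z i.+1).

(* Krull dimension; a relation, so that the empty set has no dimension. *)
Definition has_dim X (d : nat) :=
  irreducible_chain X d /\ ~ irreducible_chain X d.+1.

(* The solution set of the d equations given by the columns of A. *)
Definition affine_space d (A : 'M[K]_(n, d)) (b : 'rV[K]_d) : set 'rV[K]_n :=
  [set x | x *m A = b].

Definition has_codim L (d : nat) :=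
  exists (A : 'M[K]_(n, d)) (b : 'rV[K]_d), \rank A = d /\ L = affine_space A b.

Definition is_hyperplane H := has_codim H 1.

(* "Generic" means off the zero set of a nonzero polynomial p in the entries of
   the stacked matrix (A, b). *)
Definition irreducible_degree Z (D : nat) :=
  exists d, has_dim Z d /\
    exists2 p : {mpoly K[(n + 1) * d]}, p != 0 &
      forall (A : 'M[K]_(n, d)) (b : 'rV[K]_d),
        p.@[mxvec (col_mx A b) 0] != 0 -> (Z `&` affine_space A b #= `I_D)%card.

(* Only equidimensional X have a degree. *)
Definition has_degree X (D : nat) :=
  exists (d r : nat) (Z : 'I_r -> set 'rV[K]_n) (deg : 'I_r -> nat),
    [/\ injective Z,
        forall Y, irreducible_component X Y <-> exists i, Y = Z i,
        forall i, has_dim (Z i) d,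
        forall i, irreducible_degree (Z i) (deg i) &
        D = (\sum_(i < r) deg i)%N].

Definition degree_generic X H :=
  exists D, has_degree X D /\ has_degree (X `&` H) D.

Definition dimension_generic X H :=
  exists d, has_dim X d.+1 /\ has_dim (X `&` H) d.

Definition is_witness_set X (W : set 'rV[K]_n) :=
  exists (d : nat) (L : set 'rV[K]_n) (H : 'I_d -> set 'rV[K]_n),
    [/\ has_dim X d, has_codim L d, W = X `&` L & has_dim W 0] /\
    [/\ L = \bigcap_i H i,
        forall i, is_hyperplane (H i) &
        forall k : 'I_d,
          let Xk := X `&` \bigcap_(i in [set i : 'I_d | (i < k)%N]) H i in
          degree_generic Xk (H k) /\ dimension_generic Xk (H k)].

End AffineVarieties.

(* K^(n x n) is identified with K^(n * n) by mxvec / vec_mx. *)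
Definition SO (K : fieldType) (n : nat) : set 'rV[K]_(n * n) :=
  [set v | (vec_mx v)^T *m vec_mx v = 1%:M /\ \det (vec_mx v) = 1].
Arguments SO : clear implicits.

Definition real_point (R : realType) (n : nat) (x : 'rV[R[i]]_n) :=
  exists y : 'rV[R]_n, x = map_mx (real_complex R) y.

(* Main.v *)
(** Over the quaternions, SO(4) is the set of maps x |-> p x q with N(p) = N(q) = 1: in the
    cone of the products p_a q_b over a Segre variety, it is cut out by N(p) N(q) = 1.
    Reading p and q as polynomials of degree at most 3, the linear form p(i) q(i) defines a
    hyperplane for each node i = 0, ..., 5.  Cutting by the first k of them splits SO(4)
    into cells: for a set S of nodes below k, p vanishes on S and q at the other nodes below k.
    After six cuts p and q are determined up to sign by a triple of nodes, which leaves
    2 * C(6,3) = 40 points, all real.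

    A cell with a = 3 - |S| and b = 3 - (k - |S|) is irreducible, as it is joined by rational
    curves, of dimension a + b, and of degree D = 2 C(a + b, a).  For the degree, the Hilbert
    function is at most 2 C(M + a, a) C(M + b, b); counting then gives, for a linear form u
    separating points, an equation of degree at most D for u over the parameters (A, b) of
    the section x A = b.  One special section contains D distinct points of the cell at
    which it is transversal, so no such equation has degree below D.  The minimal
    equation is therefore separable, and its D roots are the D points of a generic section.
    The degrees of the cells of each section add up to 40. *)
Require Import Defs.
From HB Require Import structures.
From mathcomp Require Import all_boot all_order all_algebra.
From mathcomp Require Import separable.
From mathcomp Require Import mpoly.
From mathcomp Require Import boolp classical_sets cardinality reals.
From mathcomp Require Import complex.
From mathcomp Require Import ring lra zify.

Set Implicit Arguments.
Unset Strict Implicit.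
Unset Printing Implicit Defensive.

Import Order.TTheory GRing.Theory Num.Theory.
Local Open Scope classical_set_scope.
Local Open Scope ring_scope.

(** * Polynomials in several variables *)

(** A quaternion has four coordinates and the evaluations at four distinct nodes are independent, so
    a nonzero p vanishes at no more than three nodes and three nodes fix it up to a scalar. At the
    point of a triple exactly one of p and q vanishes at each node; moving that factor alone changes
    the form of that node, and this makes the special sections transversal. Integer nodes serve
    reality: the norm N is bilinear, not Hermitian, and has isotropic vectors, but a nonzero real
    vector is never isotropic and can be normalised. In D, C(a + b, a) is the degree of the Segre
    variety of P^a x P^b, and the equation N(p) N(q) = 1, quadratic in the products p_a q_b, doubles
    it. The degree asks for a nonzero polynomial in (A, b) off which a section has exactly D points.
    Equations are therefore kept over the ring of polynomials in the parameters, and the polynomial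
    is built from a leading coefficient, a resultant and a denominator. *)

(** Elimination without division, so that the kernel vector has entries in the domain itself. It is
    applied over the field and over the polynomials in the entries of [A]. *)
Lemma kernel_idomain (S : idomainType) (q p : nat) (B : 'M[S]_(p, q)) :
  (q < p)%N -> exists2 v : 'rV[S]_p, v != 0 & v *m B = 0.
Proof.
elim: q p B => [|q IHq] [|p] B //.
  exists (const_mx 1); last by apply/matrixP => i [].
  by apply/eqP => /matrixP/(_ 0 0); rewrite !mxE => /eqP; rewrite oner_eq0.
rewrite ltnS => ltqp.
have [/forallP B0|] := boolP [forall i, B i 0 == 0].
  have [v v0 vB] := IHq _ (col' 0 B) (ltnW ltqp).
  exists v => //; apply/rowP => j; rewrite !mxE.
  case: (unliftP 0 j) => [j' ->|->]; last first.
    by rewrite big1 // => i _; rewrite (eqP (B0 i)) mulr0.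
  by move/rowP/(_ j'): vB; rewrite !mxE; apply: etrans; apply: eq_bigr => i _; rewrite mxE.
rewrite negb_forall => /existsP [i0 Bi0].
(* Column 0 is eliminated with the pivot [B i0 0] by cross-multiplication; [u] turns a kernel vector
   of [C] into one of [B]. *)
pose C : 'M[S]_(p, q) := \matrix_(i, j)
  (B i0 0 * B (lift i0 i) (lift 0 j) - B (lift i0 i) 0 * B i0 (lift 0 j)).
have [v v0 vC] := IHq _ C ltqp.
pose u := \row_i (if unlift i0 i is Some j then B i0 0 * v 0 j
                  else - \sum_j v 0 j * B (lift i0 j) 0).
have usum (F : 'I_p.+1 -> S) : \sum_i u 0 i * F i =
    \sum_i v 0 i * (B i0 0 * F (lift i0 i) - B (lift i0 i) 0 * F i0).
  rewrite (bigD1_ord i0) //= mxE unlift_none mulNr big_distrl /= -sumrN -big_split.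
  apply: eq_bigr => i _ /=; rewrite mxE liftK mulrBr addrC; congr (_ - _).
    by rewrite mulrA [v _ _ * _]mulrC.
  by rewrite mulrA.
exists u.
  apply: contra v0 => /eqP/rowP u0; apply/eqP/rowP => i.
  have := u0 (lift i0 i); rewrite !mxE liftK => /eqP.
  by rewrite mulf_eq0 (negPf Bi0) => /eqP.
apply/rowP => j; rewrite mxE (usum (B^~ j)) mxE.
case: (unliftP 0 j) => [j' ->|->].
  by move/rowP/(_ j'): vC; rewrite !mxE; apply: etrans; apply: eq_bigr => i _; rewrite mxE.
by rewrite big1 // => i _; rewrite mulrC [_ * B i0 0]mulrC subrr mul0r.
Qed.

Lemma poly_vanish (K : numDomainType) (p : {poly K}) :
  (forall x, p.[x] = 0) -> p = 0.
Proof.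
move=> p0; apply/eqP/negPn/negP => pn0.
have := @max_poly_roots K p [seq i%:R | i <- iota 0 (size p)] pn0.
rewrite size_map size_iota ltnn => H; suff: false by []; apply: H.
  by apply/allP => x _; apply/rootP.
by rewrite map_inj_uniq ?iota_uniq // => i j /eqP; rewrite eqr_nat => /eqP.
Qed.

Lemma meval_muni (K : numDomainType) n (p : {mpoly K[n.+1]}) (v : 'I_n.+1 -> K) :
  p.@[v] = (map_poly (meval (v \o widen_ord (leqnSn n))) (muni p)).[v ord_max].
Proof.
rewrite muniE {1}[p]mpolyE !rmorph_sum horner_sum /=; apply: eq_bigr => m _.
rewrite mevalZ map_polyZ mevalX /= map_polyXn hornerZ hornerXn mevalZ mevalX.
rewrite big_ord_recr /= mulrA; congr (_ * _ * _).
by apply: eq_bigr => i _ /=; rewrite mnmE.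
Qed.

Lemma mpoly_vanish (K : numDomainType) n (p : {mpoly K[n]}) :
  (forall v, p.@[v] = 0) -> p = 0.
Proof.
elim: n p => [|n IHn] p p0.
  apply/mpolyP => m; rewrite mcoeff0.
  have := p0 (fun=> 0); rewrite [p]mpolyE raddf_sum /=.
  rewrite (eq_bigr (fun m => p@_m)) => [|m' _]; last first.
    by rewrite mevalZ mevalX big_ord0 mulr1.
  have mm (m' : 'X_{1..0}) : m' = m by apply/mnmP => -[].
  have [ms|/memN_msupp_eq0] := boolP (m \in msupp p); last by rewrite -mpolyE.
  rewrite -mpolyE; rewrite (eq_bigr (fun _ => p@_m)) => [|i _]; last by rewrite (mm i).
  by rewrite (bigD1_seq m) //= big1 ?addr0 // => i; rewrite (mm i) eqxx.
suff: muni p = 0.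
  move=> mp0; apply/mpolyP => m; rewrite mcoeff0.
  have := congr1 (fun q : {poly _} => (q`_(m ord_max))@_[multinom m (widen_ord (leqnSn n) i) | i < n]) mp0.
  rewrite coef0 mcoeff0 muniE coef_sum raddf_sum /=.
  have [ms|/memN_msupp_eq0-> //] := boolP (m \in msupp p).
  rewrite (bigD1_seq m) //= big1 ?addr0; last first.
    move=> m' m'm; rewrite coefZ coefXn.
    have [mm|_] := eqVneq (m ord_max) (m' ord_max); last by rewrite mulr0 mcoeff0.
    rewrite mulr1 mcoeffZ mcoeffX; case: eqP => [e|]; last by rewrite mulr0.
    case/eqP: m'm; apply/mnmP => i.
    case: (unliftP ord_max i) => [j ->|-> //].
    have -> : lift ord_max j = widen_ord (leqnSn n) j.
      by apply: val_inj; rewrite /= /bump leqNgt ltn_ord.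
    by move/mnmP/(_ j): e; rewrite !mnmE.
  by rewrite coefZ coefXn eqxx mulr1 mcoeffZ mcoeffX eqxx mulr1.
apply/polyP => i; rewrite coef0; apply: IHn => v.
have : map_poly (meval v) (muni p) = 0.
  apply: poly_vanish => x.
  have := p0 (fun i => if unlift ord_max i is Some j then v j else x).
  rewrite meval_muni /= unlift_none => <-; congr (_.[_]).
  apply: eq_map_poly => c; apply: meval_eq => j /=.
  have -> : widen_ord (leqnSn n) j = lift ord_max j.
    by apply: val_inj; rewrite /= /bump leqNgt ltn_ord.
  by rewrite liftK.
by move/polyP/(_ i); rewrite coef_map coef0.
Qed.

Lemma mpoly_neq0P (K : numDomainType) n (p : {mpoly K[n]}) :
  p != 0 -> exists v : 'rV[K]_n, p.@[v 0] != 0.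
Proof.
move=> p0; apply: contrapT => H; case/eqP: p0; apply: mpoly_vanish => v.
apply/eqP/negPn/negP => pv; case: H; exists (\row_i v i).
by rewrite (_ : p.@[_] = p.@[v]) //; apply: meval_eq => i; rewrite mxE.
Qed.

Lemma msizeM_leq (R : idomainType) n (p q : {mpoly R[n]}) :
  (msize (p * q) <= (msize p + msize q).-1)%N.
Proof.
have [->|p0] := eqVneq p 0; first by rewrite mul0r msize0.
have [->|q0] := eqVneq q 0; first by rewrite mulr0 msize0.
by rewrite msizeM.
Qed.

(** [msize p <= a.+1] encodes degree at most [a], the zero polynomial included. *)
Lemma msizeM_bound (R : idomainType) n (p q : {mpoly R[n]}) a b :
  (msize p <= a.+1)%N -> (msize q <= b.+1)%N -> (msize (p * q) <= (a + b).+1)%N.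
Proof.
move=> pa qb; apply: leq_trans (msizeM_leq _ _) _.
move: (mmeasure _ p) (mmeasure _ q) pa qb => u v; lia.
Qed.

Lemma msize_exp_bound (R : idomainType) n (p : {mpoly R[n]}) a k :
  (msize p <= a.+1)%N -> (msize (p ^+ k) <= (a * k).+1)%N.
Proof.
move=> pa; elim: k => [|k IH]; first by rewrite expr0 msize1.
by rewrite exprS mulnS msizeM_bound.
Qed.

Lemma msize_prod_bound (R : idomainType) n (I : Type) (r : seq I)
    (p : I -> {mpoly R[n]}) (a : I -> nat) :
  (forall i, (msize (p i) <= (a i).+1)%N) ->
  (msize (\prod_(i <- r) p i) <= (\sum_(i <- r) a i).+1)%N.
Proof.
move=> pa; elim: r => [|i r IH]; first by rewrite !big_nil msize1.
by rewrite !big_cons msizeM_bound.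
Qed.

Lemma msize_map_mpoly_leq (R S : nzRingType) (f : {additive R -> S}) n (p : {mpoly R[n]}) :
  (msize (map_mpoly f p) <= msize p)%N.
Proof.
rewrite [X in (X <= _)%N]msizeE; apply/bigmax_leqP_seq => m.
rewrite mcoeff_msupp mcoeff_map_mpoly => fm _; apply: msize_mdeg_lt.
by rewrite mcoeff_msupp; apply: contra fm => /eqP ->; rewrite raddf0.
Qed.

(** * Zariski topology *)

Section Zariski.
Variables (K : numClosedFieldType) (n : nat).
Implicit Types (f g : 'rV[K]_n -> K) (X Y Z : set 'rV[K]_n) (p q : {mpoly K[n]}).

(** Stated for functions, so that a determinant or a matrix product of coordinates is recognised as
    polynomial without naming the polynomial. *)
Definition polyfun f := exists p, forall x : 'rV[K]_n, p.@[x 0] = f x.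

Lemma polyfun_const c : polyfun (fun=> c).
Proof. by exists c%:MP => x; rewrite mevalC. Qed.

Lemma polyfun_coord i j : polyfun (fun x => x i j).
Proof. by exists 'X_j => x; rewrite mevalXU ord1. Qed.

Lemma polyfunD f g : polyfun f -> polyfun g -> polyfun (fun x => f x + g x).
Proof. by move=> [p hp] [q hq]; exists (p + q) => x; rewrite mevalD hp hq. Qed.

Lemma polyfunM f g : polyfun f -> polyfun g -> polyfun (fun x => f x * g x).
Proof. by move=> [p hp] [q hq]; exists (p * q) => x; rewrite mevalM hp hq. Qed.

Lemma polyfunB f g : polyfun f -> polyfun g -> polyfun (fun x => f x - g x).
Proof. by move=> [p hp] [q hq]; exists (p - q) => x; rewrite mevalB hp hq. Qed.

Lemma polyfun_sum (I : Type) (r : seq I) (P : pred I) (F : I -> 'rV[K]_n -> K) :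
  (forall i, polyfun (F i)) -> polyfun (fun x => \sum_(i <- r | P i) F i x).
Proof.
move=> h; elim: r => [|i r IH].
  by exists 0 => x; rewrite big_nil meval0.
have [Pi|nPi] := boolP (P i); last first.
  by have [p hp] := IH; exists p => x; rewrite big_cons (negPf nPi).
have [p hp] := polyfunD (h i) IH; by exists p => x; rewrite big_cons Pi.
Qed.

Lemma polyfun_prod (I : Type) (r : seq I) (P : pred I) (F : I -> 'rV[K]_n -> K) :
  (forall i, polyfun (F i)) -> polyfun (fun x => \prod_(i <- r | P i) F i x).
Proof.
move=> h; elim: r => [|i r IH].
  by exists 1 => x; rewrite big_nil meval1.
have [Pi|nPi] := boolP (P i); last first.
  by have [p hp] := IH; exists p => x; rewrite big_cons (negPf nPi).
have [p hp] := polyfunM (h i) IH; by exists p => x; rewrite big_cons Pi.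
Qed.

Lemma closed_zeros (I : Type) (f : I -> 'rV[K]_n -> K) :
  (forall i, polyfun (f i)) -> zariski_closed [set x | forall i, f i x = 0].
Proof.
move=> fP; exists [set p | exists i, forall x : 'rV[K]_n, p.@[x 0] = f i x].
apply/seteqP; split=> x /= xP.
  by move=> p [i ->].
by move=> i; have [p pE] := fP i; rewrite -pE; apply: xP; exists i.
Qed.

Lemma closedI X Y : zariski_closed X -> zariski_closed Y ->
  zariski_closed (X `&` Y).
Proof.
move=> [S ->] [T ->]; exists (S `|` T); apply/seteqP; split=> x /=.
  by move=> [xS xT] p [/xS|/xT].
by move=> xST; split => p pS; apply: xST; [left|right].
Qed.

Lemma closed_sep X x : zariski_closed X -> ~ X x ->
  exists2 p, (forall y : 'rV[K]_n, X y -> p.@[y 0] = 0) & p.@[x 0] != 0.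
Proof.
move=> [S ->] nXx; apply: contrapT => H; apply: nXx => p Sp.
apply/eqP/negPn/negP => px; apply: H; exists p => // y; exact.
Qed.

(** Primality of the vanishing ideal, without properness; for a nonempty closed [Z] it amounts to
    irreducibility. *)
Definition prime_on Z := forall p q, (forall x : 'rV[K]_n, Z x -> p.@[x 0] * q.@[x 0] = 0) ->
  (forall x : 'rV[K]_n, Z x -> p.@[x 0] = 0) \/ (forall x : 'rV[K]_n, Z x -> q.@[x 0] = 0).

Lemma prime_irreducible Z : zariski_closed Z -> Z !=set0 -> prime_on Z ->
  zariski_irreducible Z.
Proof.
move=> Zc Z0 Zp; split => // Y Y' Yc Y'c ZYY'.
apply: contrapT => /not_orP [/existsNP[x /not_implyP[Zx nYx]]
   /existsNP[x' /not_implyP[Zx' nYx']]].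
have [p pY px] := closed_sep Yc nYx; have [q qY qx] := closed_sep Y'c nYx'.
have [|p0|q0] := Zp p q.
- by move=> y /ZYY' [/pY->|/qY->]; rewrite ?mul0r ?mulr0.
- by rewrite p0 ?eqxx in px.
- by rewrite q0 ?eqxx in qx.
Qed.

Lemma irreducible_prime Z : zariski_irreducible Z -> prime_on Z.
Proof.
move=> [Zc _ Zi] p q pq0.
have Vc r : zariski_closed [set x : 'rV[K]_n | r.@[x 0] = 0].
  exists [set r]; apply/seteqP; split => x /=; first by move=> ? ? ->.
  exact.
have [x Zx|h|h] := Zi _ _ (Vc p) (Vc q); [|by left|by right].
by have /eqP := pq0 x Zx; rewrite mulf_eq0 => /orP[/eqP|/eqP]; [left|right].
Qed.

Lemma irreducible_prod Z (I : eqType) (r : seq I) (F : I -> {mpoly K[n]}) :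
  zariski_irreducible Z -> (forall x : 'rV[K]_n, Z x -> \prod_(i <- r) (F i).@[x 0] = 0) ->
  exists2 i, i \in r & forall x : 'rV[K]_n, Z x -> (F i).@[x 0] = 0.
Proof.
move=> Zi; elim: r => [|i r IH] h.
  by have [_ [x Zx] _] := Zi; have /eqP := h x Zx; rewrite big_nil oner_eq0.
have := irreducible_prime Zi (p := F i) (q := \prod_(i <- r) F i).
case=> [x Zx|h1|h1].
- by have := h x Zx; rewrite big_cons rmorph_prod.
- by exists i => //; rewrite mem_head.
- have [|j jr hj] := IH; first by move=> x /h1; rewrite rmorph_prod.
  by exists j => //; rewrite in_cons jr orbT.
Qed.

Section FiniteUnion.
Variables (I : finType) (Z : I -> set 'rV[K]_n) (X : set 'rV[K]_n).
Hypothesis XE : forall x, X x <-> exists i, Z i x.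

(** Otherwise each closed [Z i] has an equation that is not identically zero on [Y]; the product of
    these vanishes on [Y], against primality. *)
Lemma irreducible_sub_bigcup Y : (forall i, zariski_closed (Z i)) ->
  zariski_irreducible Y -> Y `<=` X -> exists i, Y `<=` Z i.
Proof.
move=> Zc Yi YX; apply: contrapT => /forallNP H.
have P i : exists p, (forall y : 'rV[K]_n, Z i y -> p.@[y 0] = 0) /\
    ~ (forall y : 'rV[K]_n, Y y -> p.@[y 0] = 0).
  have /existsNP[x /not_implyP[Yx nZx]] := H i.
  have [p p0 px] := closed_sep (Zc i) nZx.
  by exists p; split => // /(_ _ Yx) px0; rewrite px0 eqxx in px.
have [F FP] := choice P.
have [|i _ hi] := irreducible_prod (r := enum I) (F := F) Yi.
  move=> x /YX /XE [i Zix].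
  by rewrite (bigD1_seq i) ?mem_enum ?enum_uniq //= (FP i).1 // mul0r.
by have [_] := FP i.
Qed.

Hypothesis Zirr : forall i, zariski_irreducible (Z i).
Hypothesis Zsub : forall i j, Z i `<=` Z j -> i = j.

Let Zclosed i : zariski_closed (Z i). Proof. by case: (Zirr i). Qed.

Lemma components_bigcup Y : irreducible_component X Y <-> exists i, Y = Z i.
Proof.
have ZX i : Z i `<=` X by move=> x Zx; apply/XE; exists i.
split=> [[Yi YX Ymax]|[i ->]].
  have [i Yi'] := irreducible_sub_bigcup Zclosed Yi YX.
  by exists i; rewrite (Ymax (Z i)).
split => // T Ti TX ZT.
have [j Tj] := irreducible_sub_bigcup Zclosed Ti TX.
have ij : i = j by apply: Zsub; apply: subset_trans Tj.
by apply/seteqP; split => //; rewrite ij.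
Qed.

(** The top of a chain lies in a single [Z i], and the lower members are contained in the top. *)
Lemma has_dim_bigcup (i0 : I) d : (forall i, has_dim (Z i) d) -> has_dim X d.
Proof.
move=> Zd; split.
  have [[C [C1 C2]] _] := Zd i0; exists C; split => // i /C1 [? Ci]; split => //.
  by move=> x /Ci ?; apply/XE; exists i0.
move=> [C [C1 C2]].
have [Ci CX] := C1 d.+1 (leqnn _).
have [i CZ] := irreducible_sub_bigcup Zclosed Ci CX.
case: (Zd i) => _; apply; exists C; split => // k kd; have [? _] := C1 k kd.
split => //; apply: subset_trans CZ.
have Cmono j : (j <= d.+1 - k)%N -> C k `<=` C (k + j)%N.
  elim: j => [|j IH] jd; first by rewrite addn0.
  apply: (subset_trans (IH (ltnW jd))); rewrite addnS.
  by case: (C2 (k + j)%N) => //; lia.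
by have := Cmono (d.+1 - k)%N (leqnn _); rewrite subnKC.
Qed.

Lemma has_degree_bigcup d (deg : I -> nat) :
  (forall i, has_dim (Z i) d) -> (forall i, irreducible_degree (Z i) (deg i)) ->
  has_degree X (\sum_i deg i).
Proof.
move=> Zd Zdeg; exists d, #|I|, (Z \o enum_val), (deg \o enum_val); split => //=.
- by move=> i j /= e; apply: enum_val_inj; apply: Zsub; rewrite e.
- move=> Y; rewrite components_bigcup; split=> -[i ->]; last by exists (enum_val i).
  by exists (enum_rank i); rewrite /= enum_rankK.
- by rewrite -big_enum_val /=; apply: eq_bigl.
Qed.

End FiniteUnion.

Lemma closed_set1 (x : 'rV[K]_n) : zariski_closed [set x].
Proof.
rewrite (_ : [set x] = [set y | forall j, y 0 j - x 0 j = 0]).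
  apply: closed_zeros => j; apply: polyfunB; first exact: polyfun_coord.
  exact: polyfun_const.
apply/seteqP; split=> y /= => [-> j|h]; first by rewrite subrr.
by apply/rowP => j; apply/eqP; rewrite -subr_eq0 h.
Qed.

Lemma irreducible_set1 (x : 'rV[K]_n) : zariski_irreducible [set x].
Proof.
apply: prime_irreducible; first exact: closed_set1.
  by exists x.
move=> p q /(_ x erefl) /eqP; rewrite mulf_eq0 => /orP[/eqP|/eqP] h.
  by left=> _ ->.
by right=> _ ->.
Qed.

Lemma has_dim_set1 (x : 'rV[K]_n) : has_dim [set x] 0.
Proof.
split.
  by exists (fun=> [set x]); split => // i _; split => //; apply: irreducible_set1.
move=> [C [C1 C2]]; have [_] := C2 0%N isT; apply.
have [[_ [y C0y] _] C0x] := C1 0%N isT; have [_ C1x] := C1 1%N isT.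
by move=> z /C1x ->; rewrite -(C0x y).
Qed.

Lemma irreducible_degree_set1 (x : 'rV[K]_n) : irreducible_degree [set x] 1.
Proof.
exists 0%N; split; first exact: has_dim_set1.
exists 1 => [|A b _]; first by rewrite oner_eq0.
rewrite (_ : _ `&` _ = [set x]); first exact: card_set1.
apply/seteqP; split => y; first by case.
by move=> yx; split => //; apply/rowP => -[].
Qed.

End Zariski.

(** * Hilbert functions and chains *)

Section DimensionBound.
Variables (K : numClosedFieldType) (n : nat).
Implicit Types (X Z : set 'rV[K]_n) (p q : {mpoly K[n]}).

Definition spanned Z m (e : 'I_m -> 'rV[K]_n -> K) (f : 'rV[K]_n -> K) :=
  exists c : 'I_m -> K, forall x, Z x -> f x = \sum_i c i * e i x.

(* The functions on Z of degree at most M form a space of dimension at most h M. *)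
Definition hilbert_bound Z (h : nat -> nat) :=
  forall M, exists e : 'I_(h M) -> 'rV[K]_n -> K,
    forall m : 'X_{1..n}, (mdeg m <= M)%N ->
      spanned Z e (fun x => \prod_j x 0 j ^+ m j).

Lemma spanned_poly Z h M (e : 'I_(h M) -> 'rV[K]_n -> K) p :
  (forall m : 'X_{1..n}, (mdeg m <= M)%N ->
      spanned Z e (fun x => \prod_j x 0 j ^+ m j)) ->
  (msize p <= M.+1)%N -> spanned Z e (fun x => p.@[x 0]).
Proof.
move=> eP pM.
have P (m : 'X_{1..n}) : exists c : 'I_(h M) -> K, (mdeg m <= M)%N ->
    forall x : 'rV[K]_n, Z x -> \prod_j x 0 j ^+ m j = \sum_i c i * e i x.
  have [mM|_] := boolP (mdeg m <= M)%N; last by exists (fun=> 0).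
  by have [c cP] := eP m mM; exists c.
have [c cP] := choice P.
exists (fun i => \sum_(m <- msupp p) p@_m * c m i) => x Zx.
rewrite mevalE [LHS]big_seq.
under [RHS]eq_bigr => i _ do rewrite mulr_suml big_seq.
rewrite exchange_big /=; apply: eq_bigr => m mp.
rewrite cP //; last by have := leq_trans (msize_mdeg_lt mp) pM.
by rewrite mulr_sumr; apply: eq_bigr => i _; rewrite mulrA.
Qed.

Definition indep_on Z (I : finType) (g : I -> {mpoly K[n]}) :=
  forall c : I -> K, (forall x : 'rV[K]_n, Z x -> \sum_a c a * (g a).@[x 0] = 0) ->
    forall a, c a = 0.

(** In a relation on [Z] the lowest power of [f] that occurs can be cancelled, since [Z] is
    irreducible and [f] is not identically zero on it. On [X] only the terms free of [f] then
    survive, and they form a relation among the [g a]. *)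
Lemma indep_on_step X Z (I : finType) (g : I -> {mpoly K[n]}) (f : {mpoly K[n]}) k :
  zariski_irreducible Z -> X `<=` Z ->
  (forall x : 'rV[K]_n, X x -> f.@[x 0] = 0) ->
  ~ (forall x : 'rV[K]_n, Z x -> f.@[x 0] = 0) ->
  indep_on X g ->
  indep_on Z (fun a : I * 'I_k => g a.1 * f ^+ a.2).
Proof.
move=> Zi XZ fX fZ gX c c0.
pose P j := [exists a, c (a, j) != 0].
suff nP j : ~~ P j.
  by move=> [a j]; have := nP j; rewrite negb_exists => /forallP/(_ a)/negPn/eqP.
apply/negP => Pj; have [j0 Pj0 j0min] := @arg_minnP _ j P val Pj.
(* The relation divided by [f ^+ j0], with [j0] the least exponent that has a nonzero
   coefficient. *)
pose G := \sum_a \sum_(j < k | (j0 <= j)%N) c (a, j) *: (g a * f ^+ (j - j0)).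
have fG x : Z x -> (f ^+ j0).@[x 0] * G.@[x 0] = 0.
  move=> Zx; rewrite -[RHS](c0 x Zx).
  transitivity (\sum_a \sum_(j < k) c (a, j) * (g a * f ^+ j).@[x 0]); last first.
    by rewrite pair_bigA; apply: eq_bigr => -[].
  rewrite raddf_sum mulr_sumr; apply: eq_bigr => a _.
  rewrite [RHS](bigID (fun j : 'I_k => (j0 <= j)%N)) /= [X in _ + X]big1 => [|i ij0].
    rewrite addr0 raddf_sum mulr_sumr; apply: eq_bigr => i ij0 /=.
    rewrite mevalZ !mevalM !rmorphXn /= -{2}(subnKC ij0) exprD; ring.
  have : ~~ P i by apply: contra ij0 => /j0min.
  rewrite negb_exists => /forallP/(_ a)/negPn/eqP ->; exact: mul0r.
have GX x : X x -> G.@[x 0] = 0.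
  have [h|h] := irreducible_prime Zi fG; last by move/XZ/h.
  case: fZ => y /h; rewrite rmorphXn => /eqP; rewrite expf_eq0 => /andP[_ /eqP].
  by [].
have c00 := gX (fun a => c (a, j0)).
have /existsP[a] := Pj0; rewrite c00 ?eqxx // => x Xx.
rewrite -[RHS](GX x Xx) raddf_sum; apply: eq_bigr => b _.
rewrite raddf_sum (bigD1 j0) //= subnn expr0 mulr1 mevalZ big1 ?addr0 // => i.
move=> /andP[ij0 ni]; rewrite mevalZ mevalM rmorphXn /= fX // expr0n.
rewrite subn_eq0 leqNgt ltn_neqAle ij0 eq_sym.
by have -> : (val i != val j0) by []; rewrite !mulr0.
Qed.

(** Each strict inclusion supplies an equation of the smaller set that is nonzero on the larger one;
    its powers below [k] multiply the number of independent functions by [k]. *)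
Lemma indep_on_chain r (C : nat -> set 'rV[K]_n) :
  (forall i, (i <= r)%N -> zariski_irreducible (C i)) ->
  (forall i, (i < r)%N -> C i `<` C i.+1) ->
  exists e, forall k, exists (I : finType) (g : I -> {mpoly K[n]}),
    [/\ #|I| = (k ^ r)%N, forall a, (msize (g a) <= (e * k).+1)%N & indep_on (C r) g].
Proof.
elim: r => [|r IH] Ci Cp.
  exists 0%N => k; exists unit, (fun=> 1); split.
  - by rewrite card_unit.
  - by move=> _; rewrite msize1.
  - move=> c c0 [].
    have [_ [x Cx] _] := Ci 0%N isT; have := c0 x Cx.
    by rewrite (big_pred1 tt) ?meval1 ?mulr1 // => -[].
have [|i ir|e eP] := IH; [|exact/Cp/ltnW|].
  by move=> i ir; apply: Ci; rewrite ltnW.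
have [Cr nC] := Cp r (leqnn _).
have /existsNP[x /not_implyP[Cx nCx]] := nC.
have [Crc _ _] := Ci r (leqnSn _).
have [f fC fx] := closed_sep Crc nCx.
exists (e + msize f)%N => k; have [I [g [cI gs gi]]] := eP k.
exists (I * 'I_k)%type, (fun a : I * 'I_k => g a.1 * f ^+ a.2); split.
- by rewrite card_prod cI card_ord expnSr.
- move=> [a j] /=.
  rewrite mulnDl msizeM_bound //.
  have fs : (msize f <= (msize f).+1)%N by [].
  by apply: leq_trans (msize_exp_bound j fs) _; rewrite ltnS leq_mul2l (ltnW (ltn_ord j)) orbT.
- apply: indep_on_step gi => //; first exact: Ci.
  by move=> h; move: fx; rewrite h ?eqxx.
Qed.

(** The upper bound on dimension: a chain of length [r] yields [k ^ r] independent functions of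
    degree at most [e * k], more than fit into [h (e * k)]. *)
Lemma hilbert_no_chain Z h r : hilbert_bound Z h ->
  (forall e, exists k, (h (e * k) < k ^ r)%N) -> ~ irreducible_chain Z r.
Proof.
move=> Zh hr [C [C1 C2]].
have [e eP] := indep_on_chain (fun i ir => (C1 i ir).1) C2.
have [k hk] := hr e; have [I [g [cI gs gi]]] := eP k.
have [E EP] := Zh (e * k)%N.
have /choice[c cP] a := spanned_poly EP (gs a).
pose B := \matrix_(a < #|I|, i < h (e * k)%N) c (enum_val a) i.
have [|v v0 vB] := kernel_idomain B; first by rewrite cI.
case/eqP: v0; apply/rowP => a; rewrite mxE.
suff : v 0 (enum_rank (enum_val a)) = 0 by rewrite enum_valK.
apply: (gi (fun a => v 0 (enum_rank a))) => x Cx.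
under eq_bigr => b _ do rewrite (cP b x ((C1 r (leqnn _)).2 x Cx)) mulr_sumr.
rewrite exchange_big big1 //= => i _.
have /rowP/(_ i) := vB; rewrite !mxE => vB0.
rewrite (reindex _ (onW_bij _ (enum_val_bij I))) /=.
transitivity ((\sum_b v 0 b * B b i) * E i x); last by rewrite vB0 mul0r.
rewrite mulr_suml; apply: eq_bigr => b _.
by rewrite mxE enum_valK mulrA.
Qed.

End DimensionBound.

(** * Rational functions of one variable and tangent directions *)

Section RationalFunctions.
Variable K : numClosedFieldType.
Implicit Types (D P : {poly K}) (f g : K -> K).

(** The denominator [D] is fixed and the values at its roots are left free, so that curves need to
    make sense only off the roots of [D]. *)
Definition ratfun D f :=
  exists N P, forall e, D.[e] != 0 -> f e = P.[e] / D.[e] ^+ N.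

Lemma ratfun_const D c : ratfun D (fun=> c).
Proof. by exists 0%N, c%:P => e _; rewrite hornerC expr0 divr1. Qed.

Lemma ratfun_id D : ratfun D id.
Proof. by exists 0%N, 'X => e _; rewrite hornerX expr0 divr1. Qed.

Lemma ratfun_inv D : ratfun D (fun e => D.[e]^-1).
Proof. by exists 1%N, 1 => e _; rewrite hornerC expr1 mul1r. Qed.

Lemma ratfun_ext D f g : f =1 g -> ratfun D f -> ratfun D g.
Proof. by move=> fg [N [P h]]; exists N, P => e /h <-. Qed.

Lemma ratfunD D f g : ratfun D f -> ratfun D g -> ratfun D (fun e => f e + g e).
Proof.
move=> [N [P fP]] [M [Q gQ]]; exists (N + M)%N, (P * D ^+ M + Q * D ^+ N) => e De.
rewrite fP // gQ // hornerD !hornerM !horner_exp exprD.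
by field; rewrite !expf_neq0.
Qed.

Lemma ratfunM D f g : ratfun D f -> ratfun D g -> ratfun D (fun e => f e * g e).
Proof.
move=> [N [P fP]] [M [Q gQ]]; exists (N + M)%N, (P * Q) => e De.
by rewrite fP // gQ // hornerM exprD; field; rewrite !expf_neq0.
Qed.

Lemma ratfun_exp D f k : ratfun D f -> ratfun D (fun e => f e ^+ k).
Proof.
move=> fD; elim: k => [|k IH].
  by apply: ratfun_ext (ratfun_const D 1) => e; rewrite expr0.
by apply: ratfun_ext (ratfunM fD IH) => e; rewrite exprS.
Qed.

Lemma ratfun_sum D (I : Type) (r : seq I) (P : pred I) (F : I -> K -> K) :
  (forall i, ratfun D (F i)) -> ratfun D (fun e => \sum_(i <- r | P i) F i e).
Proof.
move=> h; elim: r => [|i r IH].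
  by apply: ratfun_ext (ratfun_const D 0) => e; rewrite big_nil.
have [Pi|nPi] := boolP (P i); last first.
  by apply: ratfun_ext IH => e; rewrite big_cons (negPf nPi).
by apply: ratfun_ext (ratfunD (h i) IH) => e; rewrite big_cons Pi.
Qed.

Lemma ratfun_prod D (I : Type) (r : seq I) (P : pred I) (F : I -> K -> K) :
  (forall i, ratfun D (F i)) -> ratfun D (fun e => \prod_(i <- r | P i) F i e).
Proof.
move=> h; elim: r => [|i r IH].
  by apply: ratfun_ext (ratfun_const D 1) => e; rewrite big_nil.
have [Pi|nPi] := boolP (P i); last first.
  by apply: ratfun_ext IH => e; rewrite big_cons (negPf nPi).
by apply: ratfun_ext (ratfunM (h i) IH) => e; rewrite big_cons Pi.
Qed.

Lemma ratfun_meval D n (p : {mpoly K[n]}) (x : K -> 'rV[K]_n) :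
  (forall j, ratfun D (fun e => x e 0 j)) -> ratfun D (fun e => p.@[x e 0]).
Proof.
move=> h; apply: (@ratfun_ext _ (fun e => \sum_(m <- msupp p)
    p@_m * \prod_j x e 0 j ^+ m j)) => [e|]; first by rewrite mevalE.
apply: ratfun_sum => m; apply: ratfunM; first exact: ratfun_const.
by apply: ratfun_prod => j; apply: ratfun_exp.
Qed.

(** Polynomials in one variable form a domain; this is what makes a set irreducible when rational
    curves join its points. *)
Lemma ratfun_mul_eq0 D f g : D != 0 -> ratfun D f -> ratfun D g ->
  (forall e, D.[e] != 0 -> f e * g e = 0) ->
  (forall e, D.[e] != 0 -> f e = 0) \/ (forall e, D.[e] != 0 -> g e = 0).
Proof.
move=> D0 [N [P fP]] [M [Q gQ]] fg0.
suff /eqP : P * Q * D = 0.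
  rewrite !mulf_eq0 (negPf D0) orbF => /orP[]/eqP E; [left|right] => e De.
    by rewrite fP // E horner0 mul0r.
  by rewrite gQ // E horner0 mul0r.
apply: poly_vanish => e; rewrite !hornerM.
have [->|De] := eqVneq D.[e] 0; first by rewrite mulr0.
have /eqP := fg0 e De; rewrite fP // gQ // !mulf_eq0 !invr_eq0 !expf_eq0.
by rewrite (negPf De) !andbF !orbF => /orP[]/eqP ->; rewrite ?mul0r ?mulr0 ?mul0r.
Qed.

(** An algebraic substitute for continuity at 0. *)
Lemma ratfun_eq0_at0 D f : D.[0] != 0 -> ratfun D f ->
  (forall e, D.[e] != 0 -> e != 0 -> f e = 0) -> f 0 = 0.
Proof.
move=> D0 fD f0.
have Dn0 : D != 0 by apply: contra D0 => /eqP ->; rewrite horner0.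
have [e De|h|h] := ratfun_mul_eq0 Dn0 (ratfun_id D) fD.
- have [->|e0] := eqVneq e 0; first by rewrite mul0r.
  by rewrite f0 ?mulr0.
- suff /eqP : D * 'X = 0 by rewrite mulf_eq0 (negPf Dn0) polyX_eq0.
  apply: poly_vanish => e; rewrite hornerM hornerX.
  by have [->|/h ->] := eqVneq D.[e] 0; rewrite ?mul0r ?mulr0.
- exact: h.
Qed.

End RationalFunctions.

(** * Polynomials in one unknown over the parameters of a section *)

Section EvalPoly.
Variables (K : numClosedFieldType) (N : nat).
Implicit Types (v w : 'rV[K]_N) (T : K) (m : {poly {mpoly K[N]}}).

Definition evm v T m := (map_poly (meval (v 0)) m).[T].

HB.instance Definition _ v T := GRing.RMorphism.copy (evm v T)
  (horner_eval T \o map_poly (meval (v 0))).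

Lemma evmC v T (c : {mpoly K[N]}) : evm v T c%:P = c.@[v 0].
Proof. by rewrite /evm map_polyC hornerC. Qed.

Lemma evmX v T : evm v T 'X = T.
Proof. by rewrite /evm map_polyX hornerX. Qed.

Lemma evmD v T m1 m2 : evm v T (m1 + m2) = evm v T m1 + evm v T m2.
Proof. exact: rmorphD. Qed.

Lemma evmN v T m : evm v T (- m) = - evm v T m.
Proof. exact: rmorphN. Qed.

Lemma evmM v T m1 m2 : evm v T (m1 * m2) = evm v T m1 * evm v T m2.
Proof. exact: rmorphM. Qed.

Lemma evm_sum v T (I : Type) (r : seq I) (P : pred I) (F : I -> {poly {mpoly K[N]}}) :
  evm v T (\sum_(i <- r | P i) F i) = \sum_(i <- r | P i) evm v T (F i).
Proof. exact: raddf_sum. Qed.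

Lemma evm_prod v T (I : Type) (r : seq I) (P : pred I) (F : I -> {poly {mpoly K[N]}}) :
  evm v T (\prod_(i <- r | P i) F i) = \prod_(i <- r | P i) evm v T (F i).
Proof. exact: rmorph_prod. Qed.

Lemma evmXn v T m k : evm v T (m ^+ k) = evm v T m ^+ k.
Proof. exact: rmorphXn. Qed.

Lemma evmZ v T (c : {mpoly K[N]}) m : evm v T (c *: m) = c.@[v 0] * evm v T m.
Proof. by rewrite -mul_polyC evmM evmC. Qed.

Lemma evmE v T m k : (size m <= k)%N -> evm v T m = \sum_(i < k) (m`_i).@[v 0] * T ^+ i.
Proof.
move=> mk; rewrite /evm (@horner_coef_wide _ k); last exact: leq_trans (size_poly _ _) mk.
by apply: eq_bigr => i _; rewrite coef_map.
Qed.

(* [P0] is the lowest order homogeneous part of [m] at [v0], in a direction [w] in which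
   it does not vanish; along a curve leaving [v0] in direction [w] it is the leading term. *)
Lemma lowest_part v0 m : m != 0 -> exists w (P0 : {poly K}),
  [/\ P0 != 0, (size P0 <= size m)%N &
    forall (D : {poly K}) (T : K -> K) (W : K -> 'rV[K]_N),
      D.[0] != 0 -> ratfun D T -> (forall j, ratfun D (fun e => W e 0 j)) -> W 0 = w ->
      (forall e, D.[e] != 0 -> evm (v0 + e *: W e) (T e) m = 0) -> P0.[T 0] = 0].
Proof.
move=> m0.
(* Taylor expansion at [v0]. *)
pose t (c : {mpoly K[N]}) := c \mPo [tuple 'X_j + (v0 0 j)%:MP | j < N].
have tE c (u : 'rV[K]_N) : (t c).@[u 0] = c.@[(v0 + u) 0].
  rewrite comp_mpoly_meval; apply: meval_eq => j.
  by rewrite tnth_mktuple mevalD mevalXU mevalC mxE addrC.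
pose Q k := [exists i : 'I_(size m), has (fun g : 'X_{1..N} => mdeg g == k) (msupp (t m`_i))].
have exQ : exists k, Q k.
  have sm : ((size m).-1 < size m)%N by rewrite ltn_predL size_poly_gt0.
  have lc : t m`_(size m).-1 != 0.
    have [|v hv] := @mpoly_neq0P K N (lead_coef m); first by rewrite lead_coef_eq0.
    apply: contra hv => /eqP t0.
    by rewrite -[v](subrK v0) addrC -tE t0 meval0.
  case E : (msupp (t m`_(size m).-1)) => [|g s].
    by move/eqP: E; rewrite msupp_eq0 (negPf lc).
  by exists (mdeg g); apply/existsP; exists (Ordinal sm); rewrite E /= eqxx.
case: (ex_minnP exQ) => k Qk kmin {exQ}.
have kle i g : (i < size m)%N -> g \in msupp (t m`_i) -> (k <= mdeg g)%N.
  move=> im gm; apply: kmin; apply/existsP; exists (Ordinal im).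
  by apply/hasP; exists g.
(* The expansion along [e *: u] divided by [e ^+ k], where [k] is the lowest order in the parameters
   among all coefficients of [m]; the unknown [T] has weight 0. *)
pose F (e : K) (T : K) (u : 'rV[K]_N) := \sum_(i < size m)
  (\sum_(g <- msupp (t m`_i)) (t m`_i)@_g * e ^+ (mdeg g - k) *
    \prod_j u 0 j ^+ g j) * T ^+ i.
have FE e T u : e ^+ k * F e T u = evm (v0 + e *: u) T m.
  rewrite (evmE _ _ (leqnn _)) mulr_sumr; apply: eq_bigr => i _.
  rewrite mulrA -tE mevalE; congr (_ * _).
  rewrite mulr_sumr [LHS]big_seq [RHS]big_seq; apply: eq_bigr => g gm.
  rewrite [X in _ = _ * X](eq_bigr (fun j => e ^+ g j * u 0 j ^+ g j)) => [|j _]; last first.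
    by rewrite mxE exprMn.
  rewrite big_split /= prodrXr -mdegE -{2}(subnKC (kle _ _ (ltn_ord i) gm)) exprD.
  ring.
pose c0 (i : nat) := \sum_(g <- msupp (t m`_i) | mdeg g == k) (t m`_i)@_g *: 'X_[g].
have /existsP[i /hasP[g gm gk]] := Qk.
have ci0 : c0 i != 0.
  apply/eqP => /(congr1 (mcoeff g)); rewrite mcoeff0 raddf_sum /= -big_filter.
  rewrite (bigD1_seq g) ?filter_uniq ?msupp_uniq ?mem_filter ?gk //= mcoeffZ mcoeffX eqxx.
  rewrite mulr1 big1 ?addr0; last by move=> g' g'g; rewrite mcoeffZ mcoeffX (negPf g'g) mulr0.
  by apply/eqP; rewrite -mcoeff_msupp.
have [w hw] := mpoly_neq0P ci0.
exists w, (\poly_(i < size m) (c0 i).@[w 0]); split.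
- apply/eqP => /polyP/(_ i); rewrite coef_poly ltn_ord coef0; exact/eqP.
- exact: size_poly.
- move=> D T W D0 TD WD Ww h.
  (* [F] vanishes along the curve for [e != 0], hence at [e = 0], where only the terms of order [k]
     remain. *)
  have F0 : F 0 (T 0) (W 0) = 0.
    apply: (@ratfun_eq0_at0 _ D (fun e => F e (T e) (W e))) => //.
      apply: ratfun_sum => i'; apply: ratfunM; last exact: ratfun_exp.
      apply: ratfun_sum => g'; apply: ratfunM.
        apply: ratfunM; first exact: ratfun_const.
        by apply: ratfun_exp; apply: ratfun_id.
      by apply: ratfun_prod => j; apply: ratfun_exp.
    move=> e De e0; have /eqP := h e De; rewrite -FE mulf_eq0 expf_eq0 (negPf e0) andbF.
    by move/eqP.
  rewrite -[RHS]F0 horner_poly; apply: eq_bigr => i' _; congr (_ * _).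
  rewrite raddf_sum /= big_mkcond [LHS]big_seq [RHS]big_seq; apply: eq_bigr => g' g'm.
  rewrite mevalZ mevalX Ww; case: eqP => [->|/eqP gk'].
    by rewrite subnn expr0 mulr1.
  rewrite expr0n subn_eq0 leqNgt ltn_neqAle eq_sym gk' (kle _ _ (ltn_ord i') g'm).
  by rewrite mulr0 mul0r.
Qed.

End EvalPoly.

(** * Generic linear sections *)

Section Incidence.
Variables (K : numClosedFieldType) (n d : nat).
Local Notation N := ((n + 1) * d)%N.
Local Notation S := {mpoly K[N]}.

Definition param (A : 'M[K]_(n, d)) (b : 'rV[K]_d) : 'rV[K]_N := mxvec (col_mx A b).

(** Monomials of degree exactly [M] in one more variable, dehomogenised: [f] drops the last
    exponent, which the total degree recovers. *)
Lemma monomials_upto M : exists L : seq 'X_{1..d},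
  [/\ uniq L, size L = 'C(M + d, d) & forall g, g \in L -> (mdeg g <= M)%N].
Proof.
pose f (g : 'X_{1..d.+1}) : 'X_{1..d} := [multinom g (widen_ord (leqnSn d) i) | i < d].
pose B := [seq s2m t | t : M.-tuple 'I_d.+1 <- enum (basis d.+1 M)].
have degf (g : 'X_{1..d.+1}) : mdeg g = (mdeg (f g) + g ord_max)%N.
  by rewrite !mdegE big_ord_recr /=; congr (_ + _)%N; apply: eq_bigr => i _; rewrite mnmE.
exists (map f B); split.
- rewrite map_inj_in_uniq ?uniq_basis // => g g'; rewrite -!basis_cover => /eqP gM /eqP g'M e.
  apply/mnmP => i; case: (unliftP ord_max i) => [j|] ->.
    have -> : lift ord_max j = widen_ord (leqnSn d) j.
      by apply: val_inj; rewrite /= /bump leqNgt ltn_ord.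
    by move/mnmP/(_ j): e; rewrite !mnmE.
  by move: gM g'M; rewrite !degf e => <- /addnI.
- by rewrite size_map size_basis -[RHS]bin_sub ?leq_addl // addnK.
- by move=> g /mapP[g']; rewrite -basis_cover => /eqP <- ->; rewrite degf leq_addr.
Qed.

Definition pullA (c : {mpoly K[n * d]}) : S :=
  c \mPo [tuple mxvec (\matrix_(j < n, k < d) ('X_(mxvec_index (lshift 1 j) k) : S)) 0 i | i < n * d].

Lemma pullAE c A b : (pullA c).@[param A b 0] = c.@[mxvec A 0].
Proof.
rewrite comp_mpoly_meval; apply: meval_eq => i; rewrite tnth_mktuple.
set v := param A b 0; set M := \matrix_(_, _) _.
have -> : (mxvec M 0 i).@[v] = map_mx (meval v) (mxvec M) 0 i by rewrite [RHS]mxE.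
rewrite map_mxvec; congr (mxvec _ _ _); apply/matrixP => j k.
by rewrite !mxE mevalXU /v /param mxvecE col_mxEu.
Qed.

Variable Z : set 'rV[K]_n.

(** Extension of scalars in the Hilbert bound, for functions whose coefficients depend on the
    section. *)
Lemma spanned_pullA h M (e : 'I_(h M) -> 'rV[K]_n -> K) (G : {mpoly {mpoly K[n * d]}[n]}) :
  (forall m : 'X_{1..n}, (mdeg m <= M)%N ->
      spanned Z e (fun x => \prod_j x 0 j ^+ m j)) ->
  (msize G <= M.+1)%N -> exists B : 'I_(h M) -> {mpoly K[n * d]},
    forall x A, Z x -> mmap (meval (mxvec A 0)) (x 0) G = \sum_i (B i).@[mxvec A 0] * e i x.
Proof.
move=> eP GM.
have P (m : 'X_{1..n}) : exists c : 'I_(h M) -> K, (mdeg m <= M)%N ->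
    forall x : 'rV[K]_n, Z x -> \prod_j x 0 j ^+ m j = \sum_i c i * e i x.
  have [mM|_] := boolP (mdeg m <= M)%N; last by exists (fun=> 0).
  by have [c cP] := eP m mM; exists c.
have [c cP] := choice P.
exists (fun i => \sum_(m <- msupp G) G@_m * (c m i)%:MP) => x A Zx.
rewrite /mmap [LHS]big_seq.
under [RHS]eq_bigr => i _ do rewrite raddf_sum mulr_suml big_seq.
rewrite exchange_big /=; apply: eq_bigr => m mG.
rewrite /mmap1 cP //; last by have := leq_trans (msize_mdeg_lt mG) GM.
by rewrite mulr_sumr; apply: eq_bigr => i _; rewrite mevalM mevalC mulrA.
Qed.

(* Counting: if D.+1 functions, of degree at most D, times the monomials of degree
   at most M in the d linear forms exceed the space of functions of degree D + M. *)
Lemma incidence_relation h D M (g : 'I_D.+1 -> {mpoly K[n]}) :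
  hilbert_bound Z h -> (h (D + M) < D.+1 * 'C(M + d, d))%N ->
  (forall i, (msize (g i) <= D.+1)%N) ->
  exists r : 'I_D.+1 -> S, (exists i, r i != 0) /\
    forall x A, Z x -> \sum_i (r i).@[param A (x *m A) 0] * (g i).@[x 0] = 0.
Proof.
move=> Zh hM gD; have [L [uL sL LM]] := monomials_upto M.
have [e eP] := Zh (D + M)%N.
pose R := {mpoly K[n * d]}.
(* The linear form [(x *m A) 0 k], with the entries of [A] as indeterminates. *)
pose y k : {mpoly R[n]} := \sum_j 'X_(mxvec_index j k) *: 'X_j.
pose G (a : 'I_D.+1 * 'I_(size L)) : {mpoly R[n]} :=
  map_mpoly (@mpolyC (n * d) K) (g a.1) * \prod_k y k ^+ (nth 0%MM L a.2) k.
have GE a (x : 'rV[K]_n) A : mmap (meval (mxvec A 0)) (x 0) (G a) =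
    (g a.1).@[x 0] * \prod_k (x *m A) 0 k ^+ (nth 0%MM L a.2) k.
  rewrite rmorphM rmorph_prod /=; congr (_ * _).
    rewrite [RHS]/meval !(mmapE (msize (g a.1))) ?msize_map_mpoly_leq //.
    by apply: eq_bigr => m _ /=; rewrite mcoeff_map_mpoly mevalC.
  apply: eq_bigr => k _; rewrite rmorphXn /= raddf_sum mxE; congr (_ ^+ _).
  by apply: eq_bigr => j _; rewrite /= mmapZ mmapX mmap1U /= mevalXU mxvecE mulrC.
have GS a : (msize (G a) <= (D + M).+1)%N.
  apply: msizeM_bound; first exact: leq_trans (msize_map_mpoly_leq _ _) (gD _).
  have yk k : (msize (y k) <= 2)%N.
    apply: leq_trans (msize_sum _ _ _) _; apply/bigmax_leqP_seq => j _ _.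
    by apply: leq_trans (msizeZ_le _ _) _; rewrite msizeX mdeg1.
  have yk' k : (msize (y k ^+ (nth 0%MM L a.2) k) <= ((nth 0%MM L a.2) k).+1)%N.
    by have := msize_exp_bound ((nth 0%MM L a.2) k) (yk k); rewrite mul1n.
  apply: leq_trans (msize_prod_bound _ yk') _.
  by rewrite ltnS -mdegE; apply: LM; apply: mem_nth.
have /choice[B BP] a := spanned_pullA eP (GS a).
pose I : finType := ('I_D.+1 * 'I_(size L))%type.
have [|v v0 vB] := kernel_idomain (\matrix_(a < #|I|, c < h (D + M)%N) B (enum_val a) c).
  by rewrite card_prod !card_ord sL.
pose w (a : I) := v 0 (enum_rank a).
have wB c : \sum_a w a * B a c = 0.
  rewrite (reindex _ (onW_bij _ (enum_val_bij I))) /=.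
  have /rowP/(_ c) := vB; rewrite !mxE => vBc; apply: etrans vBc.
  by apply: eq_bigr => a _; rewrite mxE /w enum_valK.
pose xb k : S := 'X_(mxvec_index (rshift n 0) k).
(* The monomials in the forms [x *m A] become the same monomials in the independent variables [b];
   where [b = x *m A] nothing changes. *)
pose r i := \sum_b pullA (w (i, b)) * \prod_k xb k ^+ (nth 0%MM L b) k.
have rE i A b : (r i).@[param A b 0] =
    \sum_j (w (i, j)).@[mxvec A 0] * \prod_k b 0 k ^+ (nth 0%MM L j) k.
  rewrite raddf_sum; apply: eq_bigr => j _ /=; rewrite mevalM pullAE rmorph_prod.
  congr (_ * _); apply: eq_bigr => k _.
  by rewrite rmorphXn /= mevalXU /param mxvecE col_mxEd.
exists r; split.
  have [i [j wij]] : exists i j, w (i, j) != 0.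
    apply: contrapT => H; case/eqP: v0; apply/rowP => a; rewrite mxE.
    apply/eqP/negPn/negP => va; apply: H.
    exists (enum_val a).1, (enum_val a).2.
    by rewrite -surjective_pairing /w enum_valK.
  exists i; have [V hV] := mpoly_neq0P wij.
  (* At a matrix where some coefficient is nonzero, [r i] becomes a combination of distinct
     monomials in [b], so nothing cancels. *)
  pose q : {mpoly K[d]} := \sum_j (w (i, j)).@[V 0] *: 'X_[nth 0%MM L j].
  have [|b hb] := @mpoly_neq0P _ _ q.
    apply/eqP => /(congr1 (mcoeff (nth 0%MM L j))); rewrite mcoeff0 raddf_sum /=.
    rewrite (bigD1 j) //= mcoeffZ mcoeffX eqxx mulr1 big1 ?addr0; first exact/eqP.
    move=> j' j'j; rewrite mcoeffZ mcoeffX nth_uniq //.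
    by rewrite (_ : (_ == _ :> nat) = false) ?mulr0 //; apply/negbTE.
  apply: contra hb => /eqP ri0.
  have := rE i (vec_mx V) b; rewrite ri0 meval0 vec_mxK => h0; apply/eqP.
  rewrite raddf_sum [RHS]h0; apply: eq_bigr => j' _.
  by rewrite /= mevalZ mevalX.
move=> x A Zx.
transitivity (\sum_a (w a).@[mxvec A 0] * mmap (meval (mxvec A 0)) (x 0) (G a)).
  under eq_bigr => i _ do rewrite rE mulr_suml.
  rewrite pair_bigA; apply: eq_bigr => -[i j] _; rewrite GE /=; ring.
under eq_bigr => a _ do rewrite (BP a x A Zx) mulr_sumr.
rewrite exchange_big big1 //= => c _.
transitivity ((\sum_a w a * B a c).@[mxvec A 0] * e c x).
  rewrite raddf_sum mulr_suml; apply: eq_bigr => a _.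
  by rewrite /= mevalM mulrA.
by rewrite wB meval0 mul0r.
Qed.
End Incidence.

Lemma card_eq_range (T : Type) m (f : 'I_m -> T) : injective f ->
  ([set x | exists i, x = f i] #= `I_m)%card.
Proof.
move=> fI; rewrite (_ : [set x | _] = f @` setT).
  apply: (card_eq_trans (inj_card_eq _)); first by move=> i j _ _; apply: fI.
  by rewrite card_eq_sym; apply: card_II.
by apply/seteqP; split=> x /= => [[i ->]|[i _ <-]]; exists i.
Qed.

Lemma card_eq_seq (T : eqType) (s : seq T) (X : set T) : uniq s ->
  (forall x, X x <-> x \in s) -> (X #= `I_(size s))%card.
Proof.
move=> us Xs.
rewrite (_ : X = [set x | exists i : 'I_(size s), x = tnth (in_tuple s) i]).
  by apply: card_eq_range => i j; apply/tuple_uniqP.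
apply/seteqP; split=> x.
  by move=> /Xs xs; have /tnthP[i ->] : x \in in_tuple s by []; exists i.
by move=> [i ->]; apply/Xs; apply: mem_tnth.
Qed.

Section PolynomialMaps.
Variables (K : numClosedFieldType) (k : nat).

Lemma polyfun_ext (f g : 'rV[K]_k -> K) : f =1 g -> polyfun f -> polyfun g.
Proof. by move=> fg [p fp]; exists p => x; rewrite fp. Qed.

Lemma polyfun_exp (f : 'rV[K]_k -> K) i : polyfun f -> polyfun (fun y => f y ^+ i).
Proof. by move=> [p fp]; exists (p ^+ i) => x; rewrite rmorphXn /= fp. Qed.

Lemma polyfun_meval N (c : {mpoly K[N]}) (v : 'rV[K]_k -> 'rV[K]_N) :
  (forall j, polyfun (fun y => v y 0 j)) -> polyfun (fun y => c.@[v y 0]).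
Proof.
move=> vP; apply: (@polyfun_ext (fun y => \sum_(m <- msupp c)
    c@_m * \prod_j v y 0 j ^+ m j)) => [y|]; first by rewrite mevalE.
apply: polyfun_sum => m; apply: polyfunM; first exact: polyfun_const.
by apply: polyfun_prod => j; apply: polyfun_exp.
Qed.

Lemma polyfun_evm N m (v : 'rV[K]_k -> 'rV[K]_N) (T : 'rV[K]_k -> K) :
  (forall j, polyfun (fun y => v y 0 j)) -> polyfun T ->
  polyfun (fun y => evm (v y) (T y) m).
Proof.
move=> vP TP; apply: (@polyfun_ext (fun y => \sum_(i < size m)
    (m`_i).@[v y 0] * T y ^+ i)) => [y|]; first by rewrite (evmE _ _ (leqnn _)).
by apply: polyfun_sum => i; apply: polyfunM; [apply: polyfun_meval | apply: polyfun_exp].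
Qed.

Lemma polyfun_mulmx p q r (X : 'rV[K]_k -> 'M[K]_(p, q)) (Y : 'rV[K]_k -> 'M[K]_(q, r)) i j :
  (forall i j, polyfun (fun y => X y i j)) -> (forall i j, polyfun (fun y => Y y i j)) ->
  polyfun (fun y => (X y *m Y y) i j).
Proof.
move=> XP YP; apply: (@polyfun_ext (fun y => \sum_a X y i a * Y y a j)) => [y|].
  by rewrite mxE.
by apply: polyfun_sum => a; apply: polyfunM.
Qed.

Lemma polyfun_param n d (A : 'rV[K]_k -> 'M[K]_(n, d)) (b : 'rV[K]_k -> 'rV[K]_d) i :
  (forall i j, polyfun (fun y => A y i j)) -> (forall i j, polyfun (fun y => b y i j)) ->
  polyfun (fun y => param (A y) (b y) 0 i).
Proof.
move=> AP bP; case/mxvec_indexP: i => i j; case: (split_ordP i) => i' ->.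
  by apply: polyfun_ext (AP i' j) => y; rewrite /param mxvecE col_mxEu.
by apply: polyfun_ext (bP i' j) => y; rewrite /param mxvecE col_mxEd.
Qed.

End PolynomialMaps.

Lemma size_deriv_mpoly (K : numClosedFieldType) N (m : {poly {mpoly K[N]}}) D :
  size m = D.+1 -> size m^`() = D.
Proof.
move=> sm; have m0 : m != 0 by rewrite -size_poly_gt0 sm.
have mD : m`_D != 0 by move: m0; rewrite -lead_coef_eq0 lead_coefE sm.
apply/eqP; rewrite eqn_leq; apply/andP; split.
  by have := lt_size_deriv m0; rewrite sm.
case: D mD {sm} => // D' mD; rewrite ltnNge; apply/negP => /leq_sizeP/(_ D' (leqnn _)).
rewrite coef_deriv -mulr_natr => /eqP; rewrite mulf_eq0 (negPf mD) /=.
by rewrite -mpolyC_nat mpolyC_eq0 pnatr_eq0.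
Qed.

(** * The degree of a generic section, from one transversal section *)

Section GenericDegree.
Variables (K : numClosedFieldType) (n d : nat).
Local Notation N := ((n + 1) * d)%N.
Local Notation S := {mpoly K[N]}.
Variables (Z : set 'rV[K]_n) (h : nat -> nat) (D M : nat).
Hypothesis Zirr : zariski_irreducible Z.
Hypothesis Zh : hilbert_bound Z h.
Hypothesis hDM : (h (D + M) < D.+1 * 'C(M + d, d))%N.
Hypothesis D1 : (1 < D)%N.
Variables (A0 : 'M[K]_(n, d)) (b0 : 'rV[K]_d) (pts : 'I_D -> 'rV[K]_n).
Hypothesis pts_inj : injective pts.
Hypothesis pts0 : forall i, pts i *m A0 = b0.
(** Transversality at [pts i]: the tangent vectors of rational arcs in [Z] are mapped by [A0] onto
    the whole space of right-hand sides. *)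
Hypothesis arcs : forall i (b : 'rV[K]_d), exists (P : {poly K}) (z : K -> 'rV[K]_n),
  [/\ P.[0] != 0, forall j, ratfun P (fun e => z e 0 j),
      forall e, P.[e] != 0 -> Z (pts i + e *: z e) & z 0 *m A0 = b].

(** The form has to avoid finitely many hyperplanes, one for each pair of points; [q] is the product
    of their equations. *)
Lemma separating_form : exists l : 'cV[K]_n, injective (fun i => (pts i *m l) 0 0).
Proof.
pose q : {mpoly K[n]} := \prod_(a : 'I_D * 'I_D | a.1 != a.2)
   \sum_j (pts a.1 - pts a.2) 0 j *: 'X_j.
have [|l lq] := @mpoly_neq0P _ _ q.
  apply/prodf_neq0 => -[i i'] /= ii'; apply/eqP => s0.
  case/eqP: ii'; apply: pts_inj; apply/eqP; rewrite -subr_eq0; apply/eqP/rowP => j.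
  rewrite [RHS]mxE; have := congr1 (mcoeff U_(j)) s0; rewrite mcoeff0; apply: etrans.
  rewrite raddf_sum (bigD1 j) //= mcoeffZ mcoeffXU eqxx mulr1 big1 ?addr0 // => j' j'j.
  by rewrite mcoeffZ mcoeffXU (negPf j'j) mulr0.
exists l^T => i i' /= e; apply/eqP/negPn/negP => ii'.
case/negP: lq; rewrite rmorph_prod /=.
rewrite (bigD1 (i, i')) //= mulf_eq0; apply/orP; left; apply/eqP.
transitivity (((pts i - pts i') *m l^T) 0 0); last by rewrite mulmxBl !mxE in e *; rewrite e subrr.
rewrite raddf_sum mxE; apply: eq_bigr => j _ /=; by rewrite mevalZ mevalXU !mxE.
Qed.

Variable l : 'cV[K]_n.
Hypothesis l_inj : injective (fun i => (pts i *m l) 0 0).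
Local Notation u x := ((x *m l) 0 0).
Local Notation tau x A := (param A (x *m A)).

(** [m] lies in the ideal of the incidence set of all [(A, b, u x)] with [x] in [Z] and
    [x *m A = b]. *)
Definition vanishing (m : {poly S}) :=
  forall (x : 'rV[K]_n) (A : 'M[K]_(n, d)), Z x -> evm (tau x A) (u x) m = 0.

(** The lowest part of [m] at the special section has every [u (pts i)] as a root: in whatever
    direction it is taken, transversality lets each special point follow the section. These are [D]
    distinct roots. *)
Lemma vanishing_size m : m != 0 -> vanishing m -> (D < size m)%N.
Proof.
move=> m0 mv; have [w [P0 [P00 Pm wP]]] := lowest_part (param A0 b0) m0.
suff rP i : root P0 (u (pts i)).
  have := @max_poly_roots _ P0 [seq u (pts i) | i <- enum 'I_D] P00.
  rewrite size_map size_enum_ord => /(_ _ _)/leq_trans; apply => //.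
    by apply/allP => _ /mapP[i _ ->].
  by rewrite map_inj_uniq ?enum_uniq.
pose A1 := usubmx (vec_mx w : 'M_(n + 1, d)); pose b1 := dsubmx (vec_mx w : 'M_(n + 1, d)).
(* The tangent is chosen so that [x e *m (A0 + e *: A1)] has derivative [b1] at 0. *)
have [P [z [P_0 zP zZ z0]]] := arcs i (b1 - pts i *m A1).
pose x e := pts i + e *: z e.
have xrat j : ratfun P (fun e => x e 0 j).
  apply: (@ratfun_ext _ _ (fun e => pts i 0 j + e * z e 0 j)) => [e|].
    by rewrite !mxE.
  apply: ratfunD; first exact: ratfun_const.
  by apply: ratfunM; [apply: ratfun_id | apply: zP].
have mulrat k (y : K -> 'rV[K]_n) (B : K -> 'M[K]_(n, k)) j :
    (forall j, ratfun P (fun e => y e 0 j)) ->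
    (forall i j, ratfun P (fun e => B e i j)) -> ratfun P (fun e => (y e *m B e) 0 j).
  move=> yr Br; apply: (@ratfun_ext _ _ (fun e => \sum_j' y e 0 j' * B e j' j)) => [e|].
    by rewrite mxE.
  by apply: ratfun_sum => j'; apply: ratfunM.
pose W e := param A1 (z e *m A0 + x e *m A1).
apply/rootP.
have -> : u (pts i) = u (x 0) by rewrite /x scale0r addr0.
apply: (wP P (fun e => u (x e)) W) => //.
- by apply: (mulrat _ _ (fun=> l)) => // *; apply: ratfun_const.
- move=> j; case/mxvec_indexP: j => j k; case: (split_ordP j) => j' ->.
    apply: ratfun_ext (ratfun_const P (A1 j' k)) => e.
    by rewrite /W /param mxvecE col_mxEu.
  apply: (@ratfun_ext _ _ (fun e => (z e *m A0) 0 k + (x e *m A1) 0 k)) => [e|].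
    by rewrite /W /param mxvecE col_mxEd [j']ord1 [RHS]mxE.
  by apply: ratfunD; apply: (mulrat _ _ (fun=> _)) => // *; apply: ratfun_const.
- by rewrite /W /x scale0r addr0 z0 subrK /param vsubmxK vec_mxK.
- move=> e Pe; rewrite -[RHS](mv (x e) (A0 + e *: A1)); last exact: zZ.
  congr evm; rewrite /W /param -linearZ -linearD; congr mxvec.
  rewrite scale_col_mx add_col_mx; congr col_mx.
  rewrite mulmxDr -scalemxAr scalerDr addrA; congr (_ + _).
  by rewrite /x mulmxDl pts0 -scalemxAl.
Qed.

(** The incidence set is parametrised by [Z] times the space of matrices, hence irreducible: a
    matrix good for both [x1] and [x2] is found first, then the irreducibility of [Z] is used at
    that matrix. *)
Lemma vanishing_prod m1 m2 : vanishing (m1 * m2) -> vanishing m1 \/ vanishing m2.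
Proof.
move=> v12; apply: contrapT => /not_orP[/existsNP[x1 /existsNP[A1 /not_implyP[Zx1 v1]]]
  /existsNP[x2 /existsNP[A2 /not_implyP[Zx2 v2]]]].
have inA (x : 'rV[K]_n) m : polyfun (fun y : 'rV_(n * d) => evm (tau x (vec_mx y)) (u x) m).
  have AP i j : polyfun (fun y : 'rV[K]_(n * d) => (vec_mx y : 'M_(n, d)) i j).
    by apply: polyfun_ext (@polyfun_coord K _ 0 (mxvec_index i j)) => y; rewrite mxE.
  apply: polyfun_evm; last exact: polyfun_const.
  move=> i; apply: polyfun_param => // *.
  by apply: (polyfun_mulmx (X := fun=> x)) => // *; apply: polyfun_const.
have inx (A : 'M[K]_(n, d)) m : polyfun (fun x : 'rV_n => evm (tau x A) (u x) m).
  have xP i j : polyfun (fun y : 'rV[K]_n => y i j) by apply: polyfun_coord.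
  apply: polyfun_evm; last by apply: (polyfun_mulmx (Y := fun=> l)) => // *; apply: polyfun_const.
  move=> i; apply: polyfun_param => *; first exact: polyfun_const.
  by apply: (polyfun_mulmx (Y := fun=> A)) => // *; apply: polyfun_const.
have [q1 q1E] := inA x1 m1; have [q2 q2E] := inA x2 m2.
have [|y] := @mpoly_neq0P _ _ (q1 * q2).
  rewrite mulf_neq0 //; apply/eqP => q0.
    by apply: v1; rewrite -[A1]mxvecK -q1E q0 meval0.
  by apply: v2; rewrite -[A2]mxvecK -q2E q0 meval0.
rewrite mevalM q1E q2E mulf_eq0 => /norP[y1 y2].
have [p1 p1E] := inx (vec_mx y) m1; have [p2 p2E] := inx (vec_mx y) m2.
have [x Zx|p0|p0] := irreducible_prime Zirr (p := p1) (q := p2).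
- by have := v12 x (vec_mx y) Zx; rewrite evmM p1E p2E.
- by rewrite -p1E p0 ?eqxx in y1.
- by rewrite -p2E p0 ?eqxx in y2.
Qed.

Lemma size_evm_poly v (m : {poly S}) : (lead_coef m).@[v] != 0 ->
  size (map_poly (meval v) m) = size m /\
  lead_coef (map_poly (meval v) m) = (lead_coef m).@[v].
Proof.
move=> lm; have E : size (map_poly (meval v) m) = size m by apply: size_poly_eq.
by split; rewrite // lead_coefE coef_map E.
Qed.

(** The remainder of the pseudo-division by [m] still vanishes on the incidence set and is too short
    to be nonzero: [m] divides [G] up to a power of its leading coefficient. *)
Lemma vanishing_root (m G : {poly S}) (v : 'rV[K]_N) T : size m = D.+1 -> vanishing m -> vanishing G ->
  (lead_coef m).@[v 0] != 0 -> evm v T m = 0 -> evm v T G = 0.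
Proof.
move=> sm mv Gv lm rT.
have m0 : m != 0 by rewrite -size_poly_gt0 sm.
have E := Pdiv.Idomain.divp_eq G m.
have rem0 : modp G m = 0.
  apply/eqP/negPn/negP => r0.
  have : (size (modp G m) < D.+1)%N by rewrite -sm ltn_modp.
  rewrite ltnS leqNgt vanishing_size // => x A Zx.
  have /(congr1 (evm (tau x A) (u x))) := E.
  by rewrite evmD evmM evmZ Gv // mv // !mulr0 add0r.
have /(congr1 (evm v T)) := E; rewrite rem0 addr0 evmZ evmM rT mulr0 => /eqP.
by rewrite rmorphXn /= mulf_eq0 expf_eq0 (negPf lm) andbF => /eqP.
Qed.

(** Counting gives a nonzero relation among the powers of [u] up to [D]; the lower bound on the size
    excludes a smaller degree. *)
Lemma minimal_equation : exists2 m : {poly S}, size m = D.+1 & vanishing m.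
Proof.
pose ux : {mpoly K[n]} := \sum_j l j 0 *: 'X_j.
have uxE (x : 'rV[K]_n) : ux.@[x 0] = u x.
  by rewrite raddf_sum mxE; apply: eq_bigr => j _; rewrite /= mevalZ mevalXU mulrC.
have us : (msize ux <= 2)%N.
  apply: leq_trans (msize_sum _ _ _) _; apply/bigmax_leqP_seq => j _ _.
  by apply: leq_trans (msizeZ_le _ _) _; rewrite msizeX mdeg1.
have [|r [[i ri] rv]] := incidence_relation (g := fun i : 'I_D.+1 => ux ^+ i) Zh hDM.
  move=> i; apply: leq_trans (msize_exp_bound i us) _.
  by rewrite mul1n ltnS -ltnS ltn_ord.
pose m := \poly_(i < D.+1) (if insub i is Some j then r j else 0).
have mE (j : 'I_D.+1) : m`_j = r j by rewrite coef_poly ltn_ord valK.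
have mv : vanishing m.
  move=> x A Zx; rewrite (@evmE _ _ _ _ _ D.+1) ?size_poly // -[RHS](rv x A Zx).
  by apply: eq_bigr => j _; rewrite mE rmorphXn /= uxE.
have m0 : m != 0 by apply: contra ri => /eqP m0; rewrite -mE m0 coef0.
by exists m => //; apply/eqP; rewrite eqn_leq size_poly vanishing_size.
Qed.

(** The same counting with the top power of [u] replaced by [x 0 j]. If its coefficient were 0, the
    powers of [u] below [D] would satisfy an equation that is too short. *)
Lemma coordinate_equation j : exists (c : S) (r : {poly S}), c != 0 /\
  forall (x : 'rV[K]_n) A, Z x -> evm (tau x A) (u x) r = c.@[tau x A 0] * x 0 j.
Proof.
pose ux : {mpoly K[n]} := \sum_j l j 0 *: 'X_j.
have uxE (x : 'rV[K]_n) : ux.@[x 0] = u x.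
  by rewrite raddf_sum mxE; apply: eq_bigr => i _; rewrite /= mevalZ mevalXU mulrC.
have us : (msize ux <= 2)%N.
  apply: leq_trans (msize_sum _ _ _) _; apply/bigmax_leqP_seq => i _ _.
  by apply: leq_trans (msizeZ_le _ _) _; rewrite msizeX mdeg1.
pose g (i : 'I_D.+1) : {mpoly K[n]} := if unlift ord_max i is Some i' then ux ^+ i' else 'X_j.
have [|r [[i ri] rv]] := incidence_relation (g := g) Zh hDM.
  move=> i; rewrite /g; case: unliftP => [i' _|_]; last by rewrite msizeX mdeg1 ltnS ltnW.
  by apply: leq_trans (msize_exp_bound i' us) _; rewrite mul1n ltnS ltnW.
pose m := \poly_(i < D) (if insub i is Some j then r (lift ord_max j) else 0).
have mE (i' : 'I_D) : m`_i' = r (lift ord_max i') by rewrite coef_poly ltn_ord valK.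
have mv (x : 'rV[K]_n) A : Z x ->
    evm (tau x A) (u x) m + (r ord_max).@[tau x A 0] * x 0 j = 0.
  move=> Zx; rewrite (@evmE _ _ _ _ _ D) ?size_poly // -[RHS](rv x A Zx).
  rewrite [RHS](bigD1_ord ord_max) //= addrC /g unlift_none mevalXU; congr (_ + _).
  by apply: eq_bigr => i' _; rewrite mE liftK rmorphXn /= uxE.
exists (r ord_max), (- m); split; last first.
  by move=> x A Zx; apply/eqP; rewrite evmN eqr_oppLR -addr_eq0 mv.
apply/eqP => r0.
have m0 : m != 0.
  apply: contra ri => /eqP m0; case: (unliftP ord_max i) => [i' ->|-> //]; last exact/eqP.
  by rewrite -mE m0 coef0.
have : (size m <= D)%N by rewrite size_poly.
rewrite leqNgt vanishing_size // => x A Zx.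
by have := mv x A Zx; rewrite r0 meval0 mul0r addr0.
Qed.

Lemma common_denominator : exists (c : S) (r : 'I_n -> {poly S}), c != 0 /\
  forall j (x : 'rV[K]_n) A, Z x -> evm (tau x A) (u x) (r j) = c.@[tau x A 0] * x 0 j.
Proof.
have /choice[c /choice[r crP]] := coordinate_equation.
exists (\prod_j c j), (fun j => (\prod_(i | i != j) c i)%:P * r j); split.
  by apply/prodf_neq0 => j _; have [] := crP j.
move=> j x A Zx; have [_ h1] := crP j.
by rewrite evmM evmC h1 // mulrA [in RHS](bigD1 j) //= mevalM [X in X * _]mulrC.
Qed.

(** A common factor of [m] and its derivative would split a multiple of [m] by a constant into two
    factors of size at most [D], one of which vanishes on the incidence set. *)
Lemma minimal_separable (m : {poly S}) : size m = D.+1 -> vanishing m ->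
  resultant m m^`() != 0.
Proof.
move=> sm mv; have m0 : m != 0 by rewrite -size_poly_gt0 sm.
have sm' := size_deriv_mpoly sm.
have m'0 : m^`() != 0 by rewrite -size_poly_gt0 sm' ltnW.
rewrite resultant_eq0 -leqNgt leqNgt; apply/negP => g1.
have /Pdiv.Idomain.dvdpP[[c q] /= c0 E] := dvdp_gcdl m m^`().
set g := gcdp m m^`() in g1 E.
have qg : vanishing (q * g).
  by move=> x A Zx; rewrite -E evmZ mv // mulr0.
have q0 : q != 0.
  by apply: contra m0 => /eqP q0; move/eqP: E; rewrite q0 mul0r -mul_polyC mulf_eq0 polyC_eq0 (negPf c0).
have g0 : g != 0 by rewrite -size_poly_gt0 ltnW.
have : size (q * g) = D.+1 by rewrite -E size_scale.
rewrite size_mul // => sqg.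
have [qv|gv] := vanishing_prod qg.
  have := vanishing_size q0 qv.
  by move: (size q) (size g) sqg g1 => a b; lia.
have := vanishing_size g0 gv.
have : (size g <= D)%N by rewrite -sm' dvdp_leq // dvdp_gcdr.
by rewrite leqNgt => /negPf ->.
Qed.

(** Off the zeros of the leading coefficient, the resultant and the common denominator, [u] and [X]
    are inverse bijections between the section and the roots of the specialised [m]. That [X T] lies
    in the section holds because an equation valid on the incidence set holds at every such root. *)
Lemma generic_section : exists2 p : S, p != 0 &
  forall A b, p.@[param A b 0] != 0 -> (Z `&` affine_space A b #= `I_D)%card.
Proof.
have [m sm mv] := minimal_equation.
have [c [r [c0 rE]]] := common_denominator.
have res0 := minimal_separable sm mv.
have m0 : m != 0 by rewrite -size_poly_gt0 sm.
exists (lead_coef m * resultant m m^`() * c); first by rewrite !mulf_neq0 ?lead_coef_eq0.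
move=> A b; set v := param A b; rewrite !mevalM !mulf_eq0 !negb_or.
move=> /andP[/andP[lv resv] cv].
have [smv lmv] := size_evm_poly lv.
set mp := map_poly (meval (v 0)) m in smv lmv.
have [s mpE] := closed_field_poly_normal mp.
(* The Bezout identity of the resultant survives specialisation, so the specialised [m] is coprime
   to its derivative. *)
have us : uniq s.
  have m1 : (1 < size m)%N by rewrite sm ltnS ltnW.
  have m'1 : (1 < size m^`())%N by rewrite (size_deriv_mpoly sm).
  have [[U V] _] := resultant_in_ideal m1 m'1.
  move=> /= /(congr1 (map_poly (meval (v 0)))).
  rewrite map_polyC rmorphD !rmorphM /= -deriv_map -/mp => UV.
  rewrite -separable_prod_XsubC.
  have : separable_poly mp.
    rewrite unlock; apply/Bezout_coprimepP; exists (map_poly (meval (v 0)) U, map_poly (meval (v 0)) V).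
    by rewrite /= -UV polyC_eqp1.
  by apply: dvdp_separable; rewrite mpE dvdpZr ?lmv.
have ss : size s = D.
  have := congr1 (size \o polyseq) mpE; rewrite /= size_scale ?size_prod_XsubC ?lmv //.
  by rewrite smv sm => -[].
pose X (T : K) := \row_j (evm v T (r j) / c.@[v 0]).
have rX T j : evm v T (r j) = c.@[v 0] * X T 0 j.
  by rewrite mxE mulrC divfK.
have rootE T : (T \in s) = (evm v T m == 0).
  by rewrite -root_prod_XsubC -(rootZ _ _ lv) -lmv -mpE.
have rootG T G : T \in s -> vanishing G -> evm v T G = 0.
  by rewrite rootE => /eqP rT Gv; apply: vanishing_root rT.
have uX T : T \in s -> u (X T) = T.
  move=> Ts; pose G := \sum_j (l j 0)%:MP%:P * r j - c%:P * 'X.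
  have GE (v' : 'rV[K]_N) (x : 'rV[K]_n) T' : (forall j, evm v' T' (r j) = c.@[v' 0] * x 0 j) ->
      evm v' T' G = c.@[v' 0] * (u x - T').
    move=> rx; rewrite evmD evmN evmM evmX evmC mulrBr evm_sum mxE mulr_sumr.
    by congr (_ - _); apply: eq_bigr => j _; rewrite evmM evmC mevalC rx; ring.
  have Gv : vanishing G by move=> x A' Zx; rewrite (GE _ x) ?subrr ?mulr0 // => j; rewrite rE.
  have /eqP := rootG T G Ts Gv; rewrite (GE _ (X T)) // mulf_eq0 (negPf cv) subr_eq0.
  by move/eqP.
have -> : D = size (map X s) by rewrite size_map.
apply: card_eq_seq.
  rewrite map_inj_in_uniq // => T T' Ts T's XX; by rewrite -(uX T) // XX uX.
move=> x; split.
  move=> [Zx xA]; have tx : tau x A = v by rewrite xA.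
  apply/mapP; exists (u x).
    by rewrite rootE -tx mv.
  by apply/rowP => j; rewrite [RHS]mxE -tx rE // mulrC mulKf // tx.
case/mapP => T Ts ->; have rT : evm v T m = 0 by apply/eqP; rewrite -rootE.
split.
  have [[F ZF] _ _] := Zirr; rewrite ZF => p Fp.
  (* The equation [p] of [Z] at the point with coordinates [r j / c], its denominators cleared by
     [c ^+ msize p]. *)
  pose G := \sum_(g <- msupp p) (p@_g)%:MP%:P * c%:P ^+ (msize p - mdeg g) * \prod_j r j ^+ g j.
  have GE (v' : 'rV[K]_N) (y : 'rV[K]_n) T' : (forall j, evm v' T' (r j) = c.@[v' 0] * y 0 j) ->
      evm v' T' G = c.@[v' 0] ^+ msize p * p.@[y 0].
    move=> rx; rewrite evm_sum (mevalE (y 0)) mulr_sumr [LHS]big_seq [RHS]big_seq.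
    apply: eq_bigr => g gp; rewrite !evmM evmXn !evmC mevalC evm_prod.
    rewrite (eq_bigr (fun j => c.@[v' 0] ^+ g j * y 0 j ^+ g j)) => [|j _]; last first.
      by rewrite evmXn rx exprMn.
    rewrite big_split /= prodrXr -mdegE -[in RHS](subnK (ltnW (msize_mdeg_lt gp))) exprD.
    by rewrite [X in X * _ = _]mulrC mulrACA.
  have Gv : vanishing G.
    move=> y A' Zy; rewrite (GE _ y) => [|j]; last by rewrite rE.
    by move: Zy; rewrite ZF => /(_ p Fp) ->; rewrite mulr0.
  have /eqP := rootG T G Ts Gv; rewrite (GE _ (X T)) // mulf_eq0 expf_eq0 (negPf cv).
  by rewrite andbF => /eqP.
apply/rowP => k.
(* Coordinate [k] of [x *m A - b] at the same point, multiplied by [c]. *)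
pose G := \sum_(j < n) ('X_(mxvec_index (lshift 1 j) k) : S)%:P * r j
  - (c * ('X_(mxvec_index (rshift n 0) k) : S))%:P.
have GE (A' : 'M[K]_(n, d)) (b' : 'rV[K]_d) (y : 'rV[K]_n) T' : (forall j, evm (param A' b') T' (r j) = c.@[param A' b' 0] * y 0 j) ->
    evm (param A' b') T' G = c.@[param A' b' 0] * ((y *m A') 0 k - b' 0 k).
  move=> rx; rewrite evmD evmN evmC mevalM mevalXU mulrBr evm_sum mxE mulr_sumr.
  rewrite {3}/param mxvecE col_mxEd; congr (_ - _); apply: eq_bigr => j _.
  by rewrite evmM evmC mevalXU rx /param mxvecE col_mxEu [LHS]mulrC -mulrA.
have Gv : vanishing G.
  by move=> y A' Zy; rewrite (GE _ _ y) ?subrr ?mulr0 // => j; rewrite rE.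
have /eqP := rootG T G Ts Gv; rewrite (GE _ _ (X T)) // mulf_eq0 (negPf cv) subr_eq0.
by move/eqP.
Qed.

End GenericDegree.

(** * Quaternions *)

Local Notation o0 := (@Ordinal 4 0 isT).
Local Notation o1 := (@Ordinal 4 1 isT).
Local Notation o2 := (@Ordinal 4 2 isT).
Local Notation o3 := (@Ordinal 4 3 isT).

Lemma sum4 (V : nmodType) (F : 'I_4 -> V) : \sum_i F i = F o0 + F o1 + F o2 + F o3.
Proof.
rewrite !big_ord_recl big_ord0 addr0 !addrA.
by congr (F _ + F _ + F _ + F _); apply: val_inj.
Qed.

Lemma all4 (P : 'I_4 -> Prop) : P o0 -> P o1 -> P o2 -> P o3 -> forall i, P i.
Proof.
move=> P0 P1 P2 P3 [[|[|[|[|i]]]] hi] //.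
- by rewrite (_ : Ordinal hi = o0) //; apply: val_inj.
- by rewrite (_ : Ordinal hi = o1) //; apply: val_inj.
- by rewrite (_ : Ordinal hi = o2) //; apply: val_inj.
- by rewrite (_ : Ordinal hi = o3) //; apply: val_inj.
Qed.

(** Bilinear, without conjugation: [dot p p] is the complexified quaternion norm, which has
    isotropic vectors. *)
Definition dot (K : numClosedFieldType) (p q : 'rV[K]_4) := \sum_i p 0 i * q 0 i.

Ltac mx4_ring := apply/matrixP; apply: all4; apply: all4;
  rewrite /dot ?(mxE, sum4) /=; ring.

Section Quaternions.
Variable K : numClosedFieldType.

Definition mx4 (s : seq (seq K)) : 'M[K]_4 := \matrix_(i, j) nth 0 (nth [::] s i) j.

Lemma det4 (f : nat -> nat -> K) : \det (\matrix_(i < 4, j < 4) f i j) =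
  f 0%N 0%N * (f 1%N 1%N * (f 2%N 2%N * f 3%N 3%N - f 2%N 3%N * f 3%N 2%N)
           - f 1%N 2%N * (f 2%N 1%N * f 3%N 3%N - f 2%N 3%N * f 3%N 1%N)
           + f 1%N 3%N * (f 2%N 1%N * f 3%N 2%N - f 2%N 2%N * f 3%N 1%N))
- f 0%N 1%N * (f 1%N 0%N * (f 2%N 2%N * f 3%N 3%N - f 2%N 3%N * f 3%N 2%N)
           - f 1%N 2%N * (f 2%N 0%N * f 3%N 3%N - f 2%N 3%N * f 3%N 0%N)
           + f 1%N 3%N * (f 2%N 0%N * f 3%N 2%N - f 2%N 2%N * f 3%N 0%N))
+ f 0%N 2%N * (f 1%N 0%N * (f 2%N 1%N * f 3%N 3%N - f 2%N 3%N * f 3%N 1%N)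
           - f 1%N 1%N * (f 2%N 0%N * f 3%N 3%N - f 2%N 3%N * f 3%N 0%N)
           + f 1%N 3%N * (f 2%N 0%N * f 3%N 1%N - f 2%N 1%N * f 3%N 0%N))
- f 0%N 3%N * (f 1%N 0%N * (f 2%N 1%N * f 3%N 2%N - f 2%N 2%N * f 3%N 1%N)
           - f 1%N 1%N * (f 2%N 0%N * f 3%N 2%N - f 2%N 2%N * f 3%N 0%N)
           + f 1%N 2%N * (f 2%N 0%N * f 3%N 1%N - f 2%N 1%N * f 3%N 0%N)).
Proof.
rewrite (expand_det_row _ ord0) !big_ord_recl big_ord0 /cofactor.
rewrite !(fun B : 'M[K]_3 => expand_det_row B ord0) !big_ord_recl !big_ord0 /cofactor.
rewrite !(fun B : 'M[K]_2 => expand_det_row B ord0) !big_ord_recl !big_ord0 /cofactor !det_mx11.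
rewrite !mxE /bump /=; ring.
Qed.

Definition rv4 (a b c d : K) : 'rV[K]_4 := \row_j nth 0 [:: a; b; c; d] j.

(* Matrices of the maps x |-> p x and x |-> x q on the quaternions. *)
Definition Lq (p : 'rV[K]_4) : 'M[K]_4 := mx4
  [:: [:: p 0 o0; - p 0 o1; - p 0 o2; - p 0 o3]; [:: p 0 o1; p 0 o0; - p 0 o3; p 0 o2];
      [:: p 0 o2; p 0 o3; p 0 o0; - p 0 o1]; [:: p 0 o3; - p 0 o2; p 0 o1; p 0 o0]].
Definition Rq (q : 'rV[K]_4) : 'M[K]_4 := mx4
  [:: [:: q 0 o0; - q 0 o1; - q 0 o2; - q 0 o3]; [:: q 0 o1; q 0 o0; q 0 o3; - q 0 o2];
      [:: q 0 o2; - q 0 o3; q 0 o0; q 0 o1]; [:: q 0 o3; q 0 o2; - q 0 o1; q 0 o0]].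

Definition qmul (p r : 'rV[K]_4) : 'rV[K]_4 := rv4
  (p 0 o0 * r 0 o0 - p 0 o1 * r 0 o1 - p 0 o2 * r 0 o2 - p 0 o3 * r 0 o3)
  (p 0 o1 * r 0 o0 + p 0 o0 * r 0 o1 - p 0 o3 * r 0 o2 + p 0 o2 * r 0 o3)
  (p 0 o2 * r 0 o0 + p 0 o3 * r 0 o1 + p 0 o0 * r 0 o2 - p 0 o1 * r 0 o3)
  (p 0 o3 * r 0 o0 - p 0 o2 * r 0 o1 + p 0 o1 * r 0 o2 + p 0 o0 * r 0 o3).
Definition qconj (p : 'rV[K]_4) := rv4 (p 0 o0) (- p 0 o1) (- p 0 o2) (- p 0 o3).

Lemma Lq_tr p : (Lq p)^T *m Lq p = (dot p p)%:M.
Proof. by mx4_ring. Qed.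

Lemma Rq_tr p : (Rq p)^T *m Rq p = (dot p p)%:M.
Proof. by mx4_ring. Qed.

Lemma Lq_mul p r : Lq p *m Lq r = Lq (qmul p r).
Proof. by mx4_ring. Qed.

Lemma det_Lq p : \det (Lq p) = dot p p ^+ 2.
Proof. rewrite (det4 (fun i j => nth 0 (nth [::] _ i) j)) /dot sum4 /=; ring. Qed.

Lemma det_Rq p : \det (Rq p) = dot p p ^+ 2.
Proof. rewrite (det4 (fun i j => nth 0 (nth [::] _ i) j)) /dot sum4 /=; ring. Qed.

Lemma dot_qmul p r : dot (qmul p r) (qmul p r) = dot p p * dot r r.
Proof. rewrite /dot !sum4 /qmul /qconj !mxE /=; ring. Qed.

Lemma dot_qconj p : dot (qconj p) (qconj p) = dot p p.
Proof. rewrite /dot !sum4 /qmul /qconj !mxE /=; ring. Qed.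

(** The Euler-Rodrigues matrix of [x |-> p x p'], with [p'] the conjugate of [p]. *)
Lemma Lq_Rq_qconj (p : 'rV[K]_4) (s := fun a b => p 0 a * p 0 b) : Lq p *m Rq (qconj p) = mx4
  [:: [:: dot p p; 0; 0; 0];
      [:: 0; s o0 o0 + s o1 o1 - s o2 o2 - s o3 o3; 2 * (s o1 o2 - s o0 o3); 2 * (s o1 o3 + s o0 o2)];
      [:: 0; 2 * (s o1 o2 + s o0 o3); s o0 o0 - s o1 o1 + s o2 o2 - s o3 o3; 2 * (s o2 o3 - s o0 o1)];
      [:: 0; 2 * (s o1 o3 - s o0 o2); 2 * (s o2 o3 + s o0 o1); s o0 o0 - s o1 o1 - s o2 o2 + s o3 o3]].
Proof. by rewrite /s; mx4_ring. Qed.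

End Quaternions.

(** * Rotations of 3-space come from unit quaternions *)

Section RotationQuaternion.
Variable K : numClosedFieldType.
Local Open Scope nat_scope.
Variable m : nat -> nat -> K.
Local Open Scope ring_scope.

Definition rotation_mx : 'M[K]_4 := mx4
  [:: [:: 1; 0; 0; 0]; [:: 0; m 1 1; m 1 2; m 1 3];
      [:: 0; m 2 1; m 2 2; m 2 3]; [:: 0; m 3 1; m 3 2; m 3 3]].

(** [r] and [c] are the defects of orthonormality of rows and columns, [k] is the difference between
    [m] and its cofactor matrix, and [s] is the cyclic successor on 1, 2, 3. *)
Let r i j := m i 1 * m j 1 + m i 2 * m j 2 + m i 3 * m j 3 - (i == j)%:R.
Let c i j := m 1 i * m 1 j + m 2 i * m 2 j + m 3 i * m 3 j - (i == j)%:R.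
Let s i := if i == 3%N then 1%N else i.+1.
Let k i j := m i j - (m (s i) (s j) * m (s (s i)) (s (s j)) - m (s i) (s (s j)) * m (s (s i)) (s j)).

Hypothesis r0 : forall i j, (0 < i < 4)%N -> (0 < j < 4)%N -> r i j = 0.
Hypothesis c0 : forall i j, (0 < i < 4)%N -> (0 < j < 4)%N -> c i j = 0.
Hypothesis k0 : forall i j, (0 < i < 4)%N -> (0 < j < 4)%N -> k i j = 0.

(* Four times the matrix of products x_a x_b, when the rotation is v |-> x v x^-1. *)
Let T a b : K := nth 0 (nth [::]
  [:: [:: 1 + m 1 1 + m 2 2 + m 3 3; m 3 2 - m 2 3; m 1 3 - m 3 1; m 2 1 - m 1 2];
      [:: m 3 2 - m 2 3; 1 + m 1 1 - m 2 2 - m 3 3; m 1 2 + m 2 1; m 1 3 + m 3 1];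
      [:: m 1 3 - m 3 1; m 1 2 + m 2 1; 1 - m 1 1 + m 2 2 - m 3 3; m 2 3 + m 3 2];
      [:: m 2 1 - m 1 2; m 1 3 + m 3 1; m 2 3 + m 3 2; 1 - m 1 1 - m 2 2 + m 3 3]] a) b.

Let eq_by_combination (x y e : K) : x - y = e -> e = 0 -> x = y.
Proof. by move=> xy e0; apply/eqP; rewrite -subr_eq0 xy e0. Qed.

Ltac combine_with e := apply: (@eq_by_combination _ _ e);
  [rewrite /r /c /k /s /=; ring | rewrite !(r0, c0, k0) //; ring].

(** [T] has rank one: its minors through a diagonal entry are combinations of the defects with
    constant coefficients, listed case by case. *)
Lemma rotation_rank1 a b d : (a < 4)%N -> (b < 4)%N -> (d < 4)%N ->
  T a a * T b d = T a b * T a d.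
Proof.
wlog bd : b d / (b <= d)%N.
  move=> H a4 b4 d4; have [bd|/ltnW db] := leqP b d; first exact: H.
  by rewrite [RHS]mulrC -H //; congr (_ * _); case: b d b4 d4 {H db} => [|[|[|[|]]]] // [|[|[|[|]]]].
case: a => [|[|[|[|]]]] //; case: b bd => [|[|[|[|]]]] //; case: d => [|[|[|[|]]]] // _ _ _ _;
  rewrite /T /=; try by rewrite mulrC.
- by combine_with (c 1 1 - r 2 2 - r 3 3 + 2 * k 1 1).
- by combine_with (r 1 2 + c 1 2 + k 1 2 + k 2 1).
- by combine_with (r 1 3 + c 1 3 + k 1 3 + k 3 1).
- by combine_with (- r 1 1 + c 2 2 - r 3 3 + 2 * k 2 2).
- by combine_with (r 2 3 + c 2 3 + k 2 3 + k 3 2).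
- by combine_with (- c 1 1 - c 2 2 + r 3 3 + 2 * k 3 3).
- by combine_with (c 1 1 - r 2 2 - r 3 3 + 2 * k 1 1).
- by combine_with (- r 1 3 + c 1 3 + k 1 3 - k 3 1).
- by combine_with (r 1 2 - c 1 2 - k 1 2 + k 2 1).
- by combine_with (- c 1 1 - c 2 2 + r 3 3 - 2 * k 3 3).
- by combine_with (- r 2 3 - c 2 3 + k 2 3 + k 3 2).
- by combine_with (- r 1 1 + c 2 2 - r 3 3 - 2 * k 2 2).
- by combine_with (- r 1 1 + c 2 2 - r 3 3 + 2 * k 2 2).
- by combine_with (r 2 3 - c 2 3 - k 2 3 + k 3 2).
- by combine_with (- r 1 2 + c 1 2 - k 1 2 + k 2 1).
- by combine_with (- c 1 1 - c 2 2 + r 3 3 - 2 * k 3 3).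
- by combine_with (- r 1 3 - c 1 3 + k 1 3 + k 3 1).
- by combine_with (c 1 1 - r 2 2 - r 3 3 - 2 * k 1 1).
- by combine_with (- c 1 1 - c 2 2 + r 3 3 + 2 * k 3 3).
- by combine_with (- r 2 3 + c 2 3 - k 2 3 + k 3 2).
- by combine_with (r 1 3 - c 1 3 + k 1 3 - k 3 1).
- by combine_with (- r 1 1 + c 2 2 - r 3 3 - 2 * k 2 2).
- by combine_with (- r 1 2 - c 1 2 + k 1 2 + k 2 1).
- by combine_with (c 1 1 - r 2 2 - r 3 3 - 2 * k 1 1).
Qed.

(** The diagonal of [T] adds up to 4, so some [T a a] is nonzero; as [T] has rank one, row [a]
    divided by [2 * sqrtC (T a a)] is the quaternion. *)
Lemma rotation_quaternion : exists2 x : 'rV[K]_4, dot x x = 1 &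
  Lq x *m Rq (qconj x) = rotation_mx.
Proof.
have [a a4 Ta] : exists2 a, (a < 4)%N & T a a != 0.
  apply: contrapT => H.
  have T0 a : (a < 4)%N -> T a a = 0.
    by move=> a4; apply/eqP/negPn/negP => Ta; apply: H; exists a.
  have /eqP : T 0 0 + T 1 1 + T 2 2 + T 3 3 = 0 by rewrite !T0 // !addr0.
  by rewrite (_ : _ + _ = 4%:R) ?pnatr_eq0 // /T /=; ring.
pose q := sqrtC (T a a); have q0 : q != 0 by rewrite sqrtC_eq0.
have qq : q * q = T a a by rewrite -expr2 sqrtCK.
pose x b := T a b / (2 * q).
have xx b d : (b < 4)%N -> (d < 4)%N -> x b * x d = T b d / 4.
  move=> b4 d4; apply: (mulfI Ta); rewrite [RHS]mulrA rotation_rank1 //.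
  by rewrite -qq /x; field.
exists (rv4 (x 0%N) (x 1%N) (x 2%N) (x 3%N)).
  by rewrite /dot sum4 !mxE /= !xx // /T /=; field.
rewrite Lq_Rq_qconj /dot sum4 !mxE /= !xx // /T /= /rotation_mx.
by congr (mx4 [:: [:: _; _; _; _]; [:: _; _; _; _]; [:: _; _; _; _]; [:: _; _; _; _]]); field.
Qed.

End RotationQuaternion.

Section SO4.
Variable K : numClosedFieldType.
Implicit Types p q : 'rV[K]_4.

Lemma orthogonal_fix1 (M : 'M[K]_4) : M^T *m M = 1%:M -> \det M = 1 ->
  (forall i, M i o0 = (i == o0)%:R) ->
  exists2 x : 'rV[K]_4, dot x x = 1 & Lq x *m Rq (qconj x) = M.
Proof.
move=> MM dM M0.
have MM' := mulmx1C MM.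
have col i j : \sum_k M k i * M k j = (i == j)%:R.
  by have /matrixP/(_ i j) := MM; rewrite !mxE => <-; apply: eq_bigr => k _; rewrite mxE.
have row i j : \sum_k M i k * M j k = (i == j)%:R.
  by have /matrixP/(_ i j) := MM'; rewrite !mxE => <-; apply: eq_bigr => k _; rewrite mxE.
have M0' j : M o0 j = (o0 == j)%:R.
  have := col o0 j; rewrite sum4 !M0 /=; move=> <-; rewrite !mul0r mul1r !addr0 //.
pose m (i j : nat) := M (inord i) (inord j).
have mE i j : M i j = m i j by rewrite /m !inord_val.
have r0 i j : (0 < i < 4)%N -> (0 < j < 4)%N ->
    m i 1%N * m j 1%N + m i 2%N * m j 2%N + m i 3%N * m j 3%N - (i == j)%:R = 0.
  move=> /andP[i0 i4] /andP[j0 j4]; have := row (inord i) (inord j).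
  rewrite sum4 !M0 !mE -!val_eqE /= !inordK // (negPf (lt0n_neq0 i0)) mul0r add0r => ->.
  by rewrite subrr.
have c0 i j : (0 < i < 4)%N -> (0 < j < 4)%N ->
    m 1%N i * m 1%N j + m 2%N i * m 2%N j + m 3%N i * m 3%N j - (i == j)%:R = 0.
  move=> /andP[i0 i4] /andP[j0 j4]; have := col (inord i) (inord j).
  rewrite sum4 !M0' !mE -!val_eqE /= !inordK // eq_sym (negPf (lt0n_neq0 i0)) mul0r add0r => ->.
  by rewrite subrr.
have d0 : \det M = m 1%N 1%N * (m 2%N 2%N * m 3%N 3%N - m 2%N 3%N * m 3%N 2%N)
           - m 1%N 2%N * (m 2%N 1%N * m 3%N 3%N - m 2%N 3%N * m 3%N 1%N)
           + m 1%N 3%N * (m 2%N 1%N * m 3%N 2%N - m 2%N 2%N * m 3%N 1%N).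
  have -> : M = \matrix_(i < 4, j < 4) m i j by apply/matrixP => i j; rewrite mE mxE.
  rewrite det4 -(mE o0 o0) -(mE o0 o1) -(mE o0 o2) -(mE o0 o3) !M0' /=; ring.
rewrite dM in d0.
have k0 i j : (0 < i < 4)%N -> (0 < j < 4)%N ->
  let s i := if i == 3%N then 1%N else i.+1 in
  m i j - (m (s i) (s j) * m (s (s i)) (s (s j)) - m (s i) (s (s j)) * m (s (s i)) (s j)) = 0.
  move=> hi hj s; pose k j' := m (s i) (s j') * m (s (s i)) (s (s j')) - m (s i) (s (s j')) * m (s (s i)) (s j').
  pose c j' := m 1%N j * m 1%N j' + m 2%N j * m 2%N j' + m 3%N j * m 3%N j' - (j == j')%:R.
  (* Cramer's rule: weighted by the cofactors [k] of row [i], the defects [c] of column [j] add up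
     to [m i j * \det M - k j]. Writing the second 1 as the determinant leaves [m i j - k j]. *)
  rewrite -[RHS](_ : m i j * (1 - 1) + (c 1%N * k 1%N + c 2%N * k 2%N + c 3%N * k 3%N) = 0); last first.
    by rewrite /c !c0 // subrr; ring.
  rewrite {2}d0 /k /c /s.
  by case: i hi {s k c} => [|[|[|[|]]]] // _; case: j hj => [|[|[|[|]]]] // _; rewrite /=; ring.
have [x xx xM] := rotation_quaternion r0 c0 k0.
exists x => //; rewrite xM; apply/matrixP; apply: all4; apply: all4; rewrite ?M0 ?M0' ?mE mxE //.
Qed.

Definition quat p q : 'rV[K]_(4 * 4) := mxvec (Lq p *m Rq q).

(** With [p] the image of the quaternion 1, left multiplication by the inverse of [p] reduces to a
    map fixing 1, which is a conjugation by some [r]; the given map is then [x |-> p r x r^-1]. *)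
Lemma SO4_quat x : SO K 4 x <-> exists p q, [/\ dot p p = 1, dot q q = 1 & x = quat p q].
Proof.
split; last first.
  move=> [p [q [pp qq ->]]]; rewrite /SO /= /quat mxvecK.
  rewrite det_mulmx det_Lq det_Rq pp qq !expr1n mulr1; split => //.
  by rewrite trmx_mul mulmxA -(mulmxA _ (Lq p)^T) Lq_tr pp mulmx1 Rq_tr qq.
move=> [xx dx]; pose M := vec_mx x : 'M[K]_4.
pose p : 'rV[K]_4 := (col o0 M)^T.
have pp : dot p p = 1.
  transitivity (((vec_mx x : 'M_4)^T *m vec_mx x) o0 o0); last by rewrite xx mxE.
  by rewrite [RHS]mxE /dot; apply: eq_bigr => k _; rewrite !mxE.
have LL : Lq p *m (Lq p)^T = 1%:M by apply: mulmx1C; rewrite Lq_tr pp.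
pose M' := (Lq p)^T *m M.
have [||i|r rr rM] := @orthogonal_fix1 M'.
- by rewrite trmx_mul trmxK mulmxA -(mulmxA _ (Lq p)) LL mulmx1.
- by rewrite det_mulmx det_tr det_Lq pp expr1n mul1r.
- transitivity (((Lq p)^T *m Lq p) i o0).
    rewrite !mxE; apply: eq_bigr => k _; congr (_ * _).
    by move: k; apply: all4; rewrite !mxE.
  by rewrite Lq_tr pp mxE.
exists (qmul p r), (qconj r); split.
- by rewrite dot_qmul pp rr mulr1.
- by rewrite dot_qconj.
- by rewrite /quat -Lq_mul -mulmxA rM mulmxA LL mul1mx vec_mxK.
Qed.

End SO4.

(** * Forms on the quaternions *)

Lemma mxvec_dot (R : comNzRingType) m n (A B : 'M[R]_(m, n)) :
  (mxvec A *m (mxvec B)^T) 0 0 = \tr (A *m B^T).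
Proof.
rewrite mxE (reindex _ (curry_mxvec_bij _ _)) /mxtrace.
rewrite (eq_bigr (fun i => \sum_j A i j * B i j)) => [|i _].
  by rewrite pair_bigA; apply: eq_bigr => -[i j] _; rewrite /= mxE !mxvecE.
by rewrite mxE; apply: eq_bigr => j _; rewrite mxE.
Qed.

Section QuatForms.
Variable K : numClosedFieldType.
Implicit Types p q : 'rV[K]_4.

Lemma Lq_is_linear : linear (@Lq K).
Proof. by move=> c u v; mx4_ring. Qed.
HB.instance Definition _ := GRing.isLinear.Build K _ _ _ (@Lq K) Lq_is_linear.

Lemma Rq_is_linear : linear (@Rq K).
Proof. by move=> c u v; mx4_ring. Qed.
HB.instance Definition _ := GRing.isLinear.Build K _ _ _ (@Rq K) Rq_is_linear.

Lemma quatDl p p' q : quat (p + p') q = quat p q + quat p' q.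
Proof. by rewrite /quat linearD mulmxDl linearD. Qed.

Lemma quatDr p q q' : quat p (q + q') = quat p q + quat p q'.
Proof. by rewrite /quat linearD mulmxDr linearD. Qed.

Lemma quatZl c p q : quat (c *: p) q = c *: quat p q.
Proof. by rewrite /quat linearZ -scalemxAl linearZ. Qed.

Lemma quatZr c p q : quat p (c *: q) = c *: quat p q.
Proof. by rewrite /quat linearZ -scalemxAr linearZ. Qed.

Definition unit_quat (a b : 'I_4) : 'rV[K]_(4 * 4) := quat (delta_mx 0 a) (delta_mx 0 b).

Lemma quatE p q : quat p q = \sum_a \sum_b (p 0 a * q 0 b) *: unit_quat a b.
Proof.
rewrite {1}[p]row_sum_delta {1}[q]row_sum_delta.
have q0l (v : 'rV[K]_4) : quat 0 v = 0 by have := quatZl 0 0 v; rewrite !scale0r.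
have q0r (v : 'rV[K]_4) : quat v 0 = 0 by have := quatZr 0 v 0; rewrite !scale0r.
rewrite (big_morph (@quat K^~ _) (fun u v => quatDl u v _) (q0l _)); apply: eq_bigr => a _.
rewrite (big_morph (@quat K _) (quatDr _) (q0r _)); apply: eq_bigr => b _.
by rewrite quatZl quatZr scalerA.
Qed.

Lemma Lq_trmx p : (Lq p)^T = Lq (qconj p).
Proof. by mx4_ring. Qed.

Lemma Rq_trmx p : (Rq p)^T = Rq (qconj p).
Proof. by mx4_ring. Qed.

Lemma Rq_mul p q : Rq p *m Rq q = Rq (qmul q p).
Proof. by mx4_ring. Qed.

Lemma trace_Lq_Rq p q : \tr (Lq p *m Rq q) = 4 * (p 0 o0 * q 0 o0).
Proof. rewrite /mxtrace sum4 !mxE !sum4 !mxE /=; ring. Qed.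

Lemma qmul_qconj0 p q : qmul (qconj p) q 0 o0 = dot p q.
Proof. rewrite /dot sum4 !mxE /=; ring. Qed.

(** The [unit_quat a b] are orthogonal for the trace form, which makes the products [p 0 a * q 0 b]
    linear functions of the matrix. *)
Lemma quat_dot p q (a b : 'I_4) :
  (quat p q *m (unit_quat a b)^T) 0 0 = 4 * (p 0 a * q 0 b).
Proof.
have dot_delta (u : 'rV[K]_4) c : dot (delta_mx 0 c) u = u 0 c.
  rewrite /dot (bigD1 c) //= mxE !eqxx mul1r big1 ?addr0 // => i /negPf ic.
  by rewrite mxE ic mul0r.
rewrite /unit_quat /quat mxvec_dot trmx_mul mulmxA -(mulmxA (Lq p)) mxtrace_mulC !mulmxA.
rewrite Lq_trmx Rq_trmx Lq_mul -mulmxA Rq_mul trace_Lq_Rq !qmul_qconj0.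
by rewrite !dot_delta.
Qed.

Definition coordq a b : 'cV[K]_(4 * 4) := 4^-1 *: (unit_quat a b)^T.

Lemma quat_coordq p q a b : (quat p q *m coordq a b) 0 0 = p 0 a * q 0 b.
Proof. by rewrite -scalemxAr mxE quat_dot mulKf ?pnatr_eq0. Qed.

(* A quaternion is read as the polynomial of degree at most 3 with these coefficients. *)
Definition evq (i : nat) p := \sum_a p 0 a * i%:R ^+ a.

Lemma evqE i p : evq i p = (rVpoly p).[i%:R].
Proof.
rewrite (@horner_coef_wide _ 4) ?size_poly //.
by apply: eq_bigr => a _; rewrite coef_rVpoly_ord.
Qed.

Definition hypcol (i : nat) : 'cV[K]_(4 * 4) :=
  \sum_(a < 4) \sum_(b < 4) (i%:R ^+ a * i%:R ^+ b) *: coordq a b.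

Lemma quat_hypcol p q i : (quat p q *m hypcol i) 0 0 = evq i p * evq i q.
Proof.
rewrite mulmx_sumr summxE /evq big_distrl; apply: eq_bigr => a _ /=.
rewrite mulmx_sumr summxE big_distrr; apply: eq_bigr => b _ /=.
by rewrite -scalemxAr mxE quat_coordq; ring.
Qed.

Lemma dot_neq0 p : dot p p = 1 -> exists a, p 0 a != 0.
Proof.
move=> pp; apply: contrapT => H; have : (1 : K) != 0 by apply: oner_neq0.
rewrite -pp /dot big1 ?eqxx // => a _.
have [->|pa] := eqVneq (p 0 a) 0; first by rewrite mulr0.
by case: H; exists a.
Qed.

Definition cell (S T : {set 'I_6}) : set 'rV[K]_(4 * 4) :=
  [set x | exists p q, [/\ dot p p = 1, dot q q = 1, x = quat p q,
    forall i, i \in S -> evq i p = 0 & forall i, i \in T -> evq i q = 0]].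

(** [p] and [q] are not functions of the point, but the products of their coordinates are: as a unit
    [q] is nonzero, [evq i p = 0] means that [evq i p * q 0 b = 0] for all [b], which is linear in
    the point. *)
Lemma cell_closed S T : zariski_closed (cell S T).
Proof.
have -> : cell S T = SO K 4 `&`
   ([set x | forall u : {i | i \in S} * 'I_4,
       (x *m \sum_(a < 4) (val u.1)%:R ^+ a *: coordq a u.2) 0 0 = 0] `&`
    [set x | forall u : {i | i \in T} * 'I_4,
       (x *m \sum_(b < 4) (val u.1)%:R ^+ b *: coordq u.2 b) 0 0 = 0]).
  have lin1 p q (i : nat) b : (quat p q *m \sum_(a < 4) i%:R ^+ a *: coordq a b) 0 0 = evq i p * q 0 b.
    rewrite mulmx_sumr summxE big_distrl; apply: eq_bigr => a _ /=.
    by rewrite -scalemxAr mxE quat_coordq; ring.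
  have lin2 p q (i : nat) a : (quat p q *m \sum_(b < 4) i%:R ^+ b *: coordq a b) 0 0 = p 0 a * evq i q.
    rewrite mulmx_sumr summxE big_distrr; apply: eq_bigr => b _ /=.
    by rewrite -scalemxAr mxE quat_coordq; ring.
  apply/seteqP; split=> x.
    move=> [p [q [pp qq -> pS qT]]]; split; first by apply/SO4_quat; exists p, q.
    split=> -[[i iS] a] /=; first by rewrite lin1 pS // mul0r.
    by rewrite lin2 qT // mulr0.
  move=> [/SO4_quat[p [q [pp qq ->]]] [xS xT]]; exists p, q; split => // i iST.
    have [b qb] := dot_neq0 qq; have := xS (exist _ i iST, b); rewrite /= lin1 => /eqP.
    by rewrite mulf_eq0 (negPf qb) orbF => /eqP.
  have [a pa] := dot_neq0 pp; have := xT (exist _ i iST, a); rewrite /= lin2 => /eqP.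
  by rewrite mulf_eq0 (negPf pa) => /eqP.
have co i j : polyfun (fun x : 'rV[K]_(4 * 4) => x i j) by apply: polyfun_coord.
have mu (c : 'cV[K]_(4 * 4)) i j : polyfun (fun x : 'rV[K]_(4 * 4) => (x *m c) i j).
  by apply: (polyfun_mulmx (Y := fun=> c)) => // *; apply: polyfun_const.
apply: closedI; last by apply: closedI; apply: closed_zeros => u; apply: mu.
have ve i j : polyfun (fun x : 'rV[K]_(4 * 4) => (vec_mx x : 'M_4) i j).
  by apply: polyfun_ext (co 0 (mxvec_index i j)) => x; rewrite mxE.
have -> : SO K 4 = [set x | forall u : 'I_4 * 'I_4,
      ((vec_mx x)^T *m vec_mx x - 1%:M : 'M_4) u.1 u.2 = 0] `&`
    [set x | forall u : unit, \det (vec_mx x : 'M_4) - 1 = 0].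
  apply/seteqP; split=> x /= [h1 h2]; split.
  - by move=> u; rewrite h1 subrr mxE.
  - by move=> _; rewrite h2 subrr.
  - apply/eqP; rewrite -subr_eq0; apply/eqP/matrixP => i j.
    by rewrite (h1 (i, j)) mxE.
  - by apply/eqP; rewrite -subr_eq0 (h2 tt).
apply: closedI.
  apply: closed_zeros => -[i j] /=.
  apply: (@polyfun_ext _ _ (fun x : 'rV[K]_(4 * 4) =>
     ((vec_mx x)^T *m vec_mx x : 'M_4) i j - (1%:M : 'M_4) i j)) => [x|].
    by rewrite !mxE.
  apply: polyfunB; last exact: polyfun_const.
  apply: (polyfun_mulmx (X := fun x => (vec_mx x : 'M_4)^T) (Y := fun x => vec_mx x : 'M_4)) => // i' j'.
  by apply: polyfun_ext (ve j' i') => x; rewrite [RHS]mxE.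
apply: closed_zeros => _; apply: polyfunB; last exact: polyfun_const.
apply: polyfun_sum => s; apply: polyfunM; first exact: polyfun_const.
by apply: polyfun_prod => i; apply: ve.
Qed.

End QuatForms.

(** * Hilbert function of the cells *)

Section Bihomogeneous.
Variables (K : numClosedFieldType) (a b : nat).
Implicit Types (f g : 'rV[K]_a -> 'rV[K]_b -> K) (s : 'rV[K]_a) (t : 'rV[K]_b).

Definition monoms n k : seq 'X_{1..n} :=
  [seq s2m u | u : k.-tuple 'I_n <- enum (basis n k)].

Definition monev n (m : 'X_{1..n}) (v : 'rV[K]_n) := \prod_i v 0 i ^+ m i.

Lemma monevD n (m m' : 'X_{1..n}) v : monev (m + m')%MM v = monev m v * monev m' v.
Proof. by rewrite /monev -big_split; apply: eq_bigr => i _ /=; rewrite mnmDE exprD. Qed.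

Lemma monevU n (i : 'I_n) (v : 'rV[K]_n) : monev U_(i)%MM v = v 0 i.
Proof.
rewrite /monev (bigD1 i) //= mnm1E eqxx expr1 big1 ?mulr1 // => j ji.
by rewrite mnm1E eq_sym (negPf ji) expr0.
Qed.

(** Forms of bidegree [(k, k)] in [(s, t)]. *)
Definition bihomog k f := exists c : 'X_{1..a} -> 'X_{1..b} -> K, forall s t,
  f s t = \sum_(m <- monoms a k) \sum_(m' <- monoms b k) c m m' * (monev m s * monev m' t).

Lemma bihomog_ext k f g : (forall s t, f s t = g s t) -> bihomog k f -> bihomog k g.
Proof. by move=> fg [c h]; exists c => s t; rewrite -fg. Qed.

Lemma bihomog_mono k (c : K) m m' : mdeg m = k -> mdeg m' = k ->
  bihomog k (fun s t => c * (monev m s * monev m' t)).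
Proof.
move=> mk m'k; exists (fun u u' => if (u == m) && (u' == m') then c else 0) => s t.
have mm : m \in monoms a k by rewrite -basis_cover mk.
have mm' : m' \in monoms b k by rewrite -basis_cover m'k.
rewrite (bigD1_seq m) ?uniq_basis //= (bigD1_seq m') ?uniq_basis //= !eqxx /=.
rewrite big1 ?addr0 => [|u /negPf ->]; last by rewrite mul0r.
by rewrite big1 ?addr0 // => u /negPf um; rewrite big1 // => u' _; rewrite um mul0r.
Qed.

Lemma bihomogD k f g : bihomog k f -> bihomog k g -> bihomog k (fun s t => f s t + g s t).
Proof.
move=> [c h] [c' h']; exists (fun m m' => c m m' + c' m m') => s t.
rewrite h h' -big_split; apply: eq_bigr => m _; rewrite -big_split; apply: eq_bigr => m' _ /=.
by rewrite mulrDl.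
Qed.

Lemma bihomog0 k : bihomog k (fun _ _ => 0).
Proof.
exists (fun _ _ => 0) => s t; rewrite big1 // => m _; rewrite big1 // => m' _.
by rewrite mul0r.
Qed.

Lemma bihomog_sum k (I : Type) (r : seq I) (F : I -> 'rV[K]_a -> 'rV[K]_b -> K) :
  (forall i, bihomog k (F i)) -> bihomog k (fun s t => \sum_(i <- r) F i s t).
Proof.
move=> h; elim: r => [|i r IH]; first by apply: bihomog_ext (bihomog0 k) => s t; rewrite big_nil.
by apply: bihomog_ext (bihomogD (h i) IH) => s t; rewrite big_cons.
Qed.

Lemma bihomog_sum_in k (I : eqType) (r : seq I) (F : I -> 'rV[K]_a -> 'rV[K]_b -> K) :
  (forall i, i \in r -> bihomog k (F i)) -> bihomog k (fun s t => \sum_(i <- r) F i s t).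
Proof.
elim: r => [|i r IH] h; first by apply: bihomog_ext (bihomog0 k) => s t; rewrite big_nil.
apply: bihomog_ext (bihomogD (h i (mem_head _ _)) (IH _)) => [s t|j jr]; first by rewrite big_cons.
by apply: h; rewrite in_cons jr orbT.
Qed.

Lemma bihomogM k k' f g : bihomog k f -> bihomog k' g ->
  bihomog (k + k') (fun s t => f s t * g s t).
Proof.
move=> [c h] [c' h'].
apply: (@bihomog_ext _ (fun s t => \sum_(m <- monoms a k) \sum_(m' <- monoms b k)
   \sum_(u <- monoms a k') \sum_(u' <- monoms b k')
     (c m m' * c' u u') * (monev (m + u)%MM s * monev (m' + u')%MM t))) => [s t|].
  rewrite h h' mulr_suml; apply: eq_bigr => m _; rewrite mulr_suml; apply: eq_bigr => m' _.
  rewrite mulr_sumr; apply: eq_bigr => u _; rewrite mulr_sumr; apply: eq_bigr => u' _.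
  by rewrite !monevD; ring.
apply: bihomog_sum_in => m; rewrite -basis_cover => /eqP mk.
apply: bihomog_sum_in => m'; rewrite -basis_cover => /eqP m'k.
apply: bihomog_sum_in => u; rewrite -basis_cover => /eqP uk.
apply: bihomog_sum_in => u'; rewrite -basis_cover => /eqP u'k.
by apply: bihomog_mono; rewrite mdegD ?mk ?m'k ?uk ?u'k.
Qed.

Lemma bihomog1 : bihomog 0 (fun _ _ => 1).
Proof.
apply: (@bihomog_ext _ (fun s t => 1 * (monev 0%MM s * monev 0%MM t))) => [s t|].
  by rewrite /monev !big1 ?mulr1 // => i _; rewrite mnm0E expr0.
by apply: bihomog_mono; rewrite mdeg0.
Qed.

Lemma bihomogX k f i : bihomog k f -> bihomog (k * i) (fun s t => f s t ^+ i).
Proof.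
move=> h; elim: i => [|i IH].
  by rewrite muln0; apply: bihomog_ext bihomog1 => s t; rewrite expr0.
by rewrite mulnS; apply: bihomog_ext (bihomogM h IH) => s t; rewrite exprS.
Qed.

Lemma bihomog_prod (I : Type) (r : seq I) (k : I -> nat) (F : I -> 'rV[K]_a -> 'rV[K]_b -> K) :
  (forall i, bihomog (k i) (F i)) ->
  bihomog (\sum_(i <- r) k i) (fun s t => \prod_(i <- r) F i s t).
Proof.
move=> h; elim: r => [|i r IH].
  by rewrite big_nil; apply: bihomog_ext bihomog1 => s t; rewrite big_nil.
by rewrite big_cons; apply: bihomog_ext (bihomogM (h i) IH) => s t; rewrite big_cons.
Qed.

Lemma bihomogZ k (c : K) f : bihomog k f -> bihomog k (fun s t => c * f s t).
Proof.
move=> [d h]; exists (fun m m' => c * d m m') => s t; rewrite h mulr_sumr.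
apply: eq_bigr => m _; rewrite mulr_sumr; apply: eq_bigr => m' _; exact: mulrA.
Qed.

Variables (P : 'M[K]_(a, 4)) (Q : 'M[K]_(b, 4)).

Lemma bihomog_entry i j : bihomog 1 (fun s t => (s *m P) 0 i * (t *m Q) 0 j).
Proof.
apply: (@bihomog_ext _ (fun s t => \sum_k \sum_l
    (P k i * Q l j) * (monev U_(k)%MM s * monev U_(l)%MM t))) => [s t|].
  rewrite !mxE mulr_suml; apply: eq_bigr => k _; rewrite mulr_sumr; apply: eq_bigr => l _.
  by rewrite !monevU; ring.
by apply: bihomog_sum => k; apply: bihomog_sum => l; apply: bihomog_mono; rewrite mdeg1.
Qed.

Lemma bihomog_quat j : bihomog 1 (fun s t => quat (s *m P) (t *m Q) 0 j).
Proof.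
apply: (@bihomog_ext _ (fun s t => \sum_i \sum_i'
    unit_quat K i i' 0 j * ((s *m P) 0 i * (t *m Q) 0 i'))) => [s t|].
  rewrite quatE summxE; apply: eq_bigr => i _; rewrite summxE; apply: eq_bigr => i' _.
  by rewrite [RHS]mxE mulrC.
by apply: bihomog_sum => i; apply: bihomog_sum => i'; apply: bihomogZ; apply: bihomog_entry.
Qed.

Lemma bihomog_norm : bihomog 2 (fun s t => dot (s *m P) (s *m P) * dot (t *m Q) (t *m Q)).
Proof.
apply: (@bihomog_ext _ (fun s t => \sum_i \sum_i' ((s *m P) 0 i * (t *m Q) 0 i') ^+ 2)) => [s t|].
  rewrite /dot mulr_suml; apply: eq_bigr => i _; rewrite mulr_sumr; apply: eq_bigr => i' _.
  ring.
by apply: bihomog_sum => i; apply: bihomog_sum => i'; apply: bihomogX (bihomog_entry i i').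
Qed.

End Bihomogeneous.

(** A monomial of degree at most [M] in the matrix entries is bihomogeneous in the parameters.
    Multiplied by powers of the norm product, which is 1 on [Z] and has bidegree (2, 2), it reaches
    bidegree [M] or [M.-1] according to parity; the factor 2 counts these two spaces of forms. *)
Lemma hilbert_quat (K : numClosedFieldType) a b (P : 'M[K]_(a.+1, 4)) (Q : 'M[K]_(b.+1, 4))
    (Z : set 'rV[K]_(4 * 4)) :
  (forall x, Z x -> exists s t, [/\ dot (s *m P) (s *m P) = 1, dot (t *m Q) (t *m Q) = 1 &
     x = quat (s *m P) (t *m Q)]) ->
  hilbert_bound Z (fun M => 2 * ('C(M + a, a) * 'C(M + b, b)))%N.
Proof.
move=> ZP M.
(* One choice of parameters for each point is enough, as the identities below hold for all
   parameters. *)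
have /choice[st stP] : forall x, exists st : 'rV[K]_a.+1 * 'rV[K]_b.+1, Z x ->
    [/\ dot (st.1 *m P) (st.1 *m P) = 1, dot (st.2 *m Q) (st.2 *m Q) = 1 &
       x = quat (st.1 *m P) (st.2 *m Q)].
  move=> x; have [/ZP[s [t h]]|nZ] := pselect (Z x); last by exists (0, 0).
  by exists (s, t).
have bk n k : (k <= M)%N -> (size (monoms n.+1 k) <= 'C(M + n, n))%N.
  move=> kM; rewrite /monoms size_basis -bin_sub ?leq_addr // addKn.
  by apply: leq_bin2l; rewrite leq_add2r.
pose I : finType := (bool * ('I_('C(M + a, a)) * 'I_('C(M + b, b))))%type.
have cI : #|I| = (2 * ('C(M + a, a) * 'C(M + b, b)))%N.
  by rewrite !card_prod card_bool !card_ord.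
pose deg (i : I) := if i.1 then M else M.-1.
pose e (i : I) (x : 'rV[K]_(4 * 4)) :=
  monev (nth 0%MM (monoms a.+1 (deg i)) i.2.1) (st x).1 *
  monev (nth 0%MM (monoms b.+1 (deg i)) i.2.2) (st x).2.
exists (fun i => e (enum_val (cast_ord (esym cI) i))) => g gM.
suff [c cP] : exists c : I -> K, forall x, Z x -> \prod_j x 0 j ^+ g j = \sum_i c i * e i x.
  exists (fun i => c (enum_val (cast_ord (esym cI) i))) => x Zx; rewrite cP //.
  rewrite (reindex _ (onW_bij _ (enum_val_bij I))) /=.
  rewrite (reindex (cast_ord (esym cI))) //; apply: onW_bij.
  by exists (cast_ord cI) => i; rewrite ?cast_ordK ?cast_ordKV.
pose k := odd (M - mdeg g); pose r := ((if k then M.-1 else M) - mdeg g)./2.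
have rE : (mdeg g + 2 * r = (if k then M.-1 else M))%N.
  rewrite /r /k; case: ifP => Modd; rewrite mul2n halfK; lia.
have : bihomog (if k then M.-1 else M) (fun s t => (\prod_j quat (s *m P) (t *m Q) 0 j ^+ g j) *
    (dot (s *m P) (s *m P) * dot (t *m Q) (t *m Q)) ^+ r).
  rewrite -rE; apply: bihomogM; last exact: bihomogX (bihomog_norm P Q).
  rewrite mdegE; apply: bihomog_prod => j.
  by have := bihomogX (g j) (bihomog_quat P Q j); rewrite mul1n.
move=> [c cP].
have kM : ((if k then M.-1 else M) <= M)%N by case: (k); rewrite ?leq_pred.
have widen n (G : 'X_{1..n.+1} -> K) : \sum_(m <- monoms n.+1 (if k then M.-1 else M)) G m =
    \sum_(j < 'C(M + n, n)) (if (j < size (monoms n.+1 (if k then M.-1 else M)))%N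
      then G (nth 0%MM (monoms n.+1 (if k then M.-1 else M)) j) else 0).
  rewrite (big_nth 0%MM) big_mkord.
  by rewrite (big_ord_widen _ (fun j => G (nth 0%MM _ j)) (bk n _ kM)) big_mkcond.
(* The index set fits degree [M]; for degree [M.-1] the surplus indices get the coefficient 0. *)
pose C (i : I) := if [&& i.1 == ~~ k, (i.2.1 < size (monoms a.+1 (deg i)))%N
     & (i.2.2 < size (monoms b.+1 (deg i)))%N]
   then c (nth 0%MM (monoms a.+1 (deg i)) i.2.1) (nth 0%MM (monoms b.+1 (deg i)) i.2.2) else 0.
exists C => x Zx; have [ss tt xE] := stP x Zx.
have := cP (st x).1 (st x).2; rewrite ss tt mulr1 expr1n mulr1 -xE => ->.
have split3 (F : I -> K) : \sum_i F i = \sum_u \sum_v \sum_w F (u, (v, w)).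
  transitivity (\sum_u \sum_v F (u, v)); first by rewrite pair_bigA; apply: eq_bigr => -[].
  by apply: eq_bigr => u _; rewrite pair_bigA; apply: eq_bigr => -[].
rewrite split3 (bigD1 (~~ k)) //= [X in _ = _ + X]big1 ?addr0; last first.
  move=> u /negPf uk; rewrite big1 // => v _; rewrite big1 // => w _.
  by rewrite /C /= uk mul0r.
have dk v : deg (~~ k, v) = (if k then M.-1 else M) by rewrite /deg /= if_neg.
rewrite widen; apply: eq_bigr => v _; rewrite /C /e /=.
case: ifP => vS; last first.
  by rewrite big1 // => w _; rewrite dk /= vS andbF mul0r.
rewrite widen; apply: eq_bigr => w _; rewrite !dk eqxx /= vS.
by case: ifP => _; rewrite ?mul0r.
Qed.

(** * Binomial estimates for the two counting arguments *)

Lemma leq_expl m n e : (m <= n -> m ^ e <= n ^ e)%N.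
Proof. by move=> mn; elim: e => // e IH; rewrite !expnS leq_mul. Qed.

Lemma bin_leq_exp n M : ('C(M + n, n) <= M.+1 ^ n)%N.
Proof.
elim: n => [|n IH]; first by rewrite bin0.
rewrite -(leq_pmul2l (ltn0Sn n)) addnS -mul_bin_diag /= expnS mulnA.
by apply: leq_mul => //; nia.
Qed.

Lemma ffact_leq_exp n m : (n ^_ m <= n ^ m)%N.
Proof. by elim: m => // m IH; rewrite ffactnSr expnSr leq_mul // leq_subr. Qed.

Lemma exp_leq_ffact M d : (M ^ d <= (M + d) ^_ d)%N.
Proof.
elim: d => // d IH; rewrite addnS ffactSS expnS leq_mul //.
by rewrite -addnS leq_addr.
Qed.

(** This is [(1 + E/M)^d (1 - dE/M) <= 1], cleared of denominators. *)
Lemma bernoulli_leq M E d : (d * E <= M)%N ->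
  ((M + E) ^ d * (M - d * E) <= M ^ d.+1)%N.
Proof.
elim: d => [|d IH] dM; first by rewrite mul0n subn0 mul1n expn1.
have dM' : (d * E <= M)%N by apply: leq_trans dM; rewrite mulSn leq_addl.
rewrite expnSr -mulnA [(M ^ d.+2)%N]expnSr.
apply: leq_trans (leq_mul (IH dM') (leqnn M)); rewrite -mulnA leq_mul //.
have {dM dM'} [u ->] : exists u, M = (u + d.+1 * E)%N by exists (M - d.+1 * E)%N; rewrite subnK.
rewrite addnK mulSn addnA addnK; move: (d * E)%N => w.
by nia.
Qed.

(** Up to the same factorial, both sides are polynomials in [M] of degree [a + b], with leading
    coefficients [D] and [D.+1]. *)
Lemma quat_degree_bound a b (D := (2 * 'C(a + b, a))%N) : exists M,
  (2 * ('C(D + M + a, a) * 'C(D + M + b, b)) < D.+1 * 'C(M + (a + b), a + b))%N.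
Proof.
(* [M] is chosen so that [D.+1 * (M - d * E)] is exactly [D * M + 1]. *)
set d := (a + b)%N; pose E := (D + d)%N; pose M := (D.+1 * (d * E)).+1; exists M.
have dE : (d * E < M)%N by rewrite /M ltnS leq_pmull.
have C_n n : (n <= d)%N -> ('C(D + M + n, n) * n`! <= (M + E) ^ n)%N.
  move=> nd; rewrite bin_ffact; apply: leq_trans (ffact_leq_exp _ _) _.
  by apply: leq_expl; rewrite /E addnA [(M + D)%N]addnC leq_add2l.
have fd : ('C(d, a) * (a`! * b`!) = d`!)%N by rewrite -(bin_fact (leq_addr b a)) addKn.
rewrite -(ltn_pmul2r (fact_gt0 d)).
apply: (@leq_ltn_trans (D * (M + E) ^ d)%N).
  rewrite -fd expnD /D.
  apply: leq_trans (leq_mul (leqnn (2 * 'C(d, a))%N)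
    (leq_mul (C_n a (leq_addr _ _)) (C_n b (leq_addl _ _)))).
  apply: eq_leq; ring.
apply: (@leq_trans (D.+1 * M ^ d)%N); last first.
  by rewrite -mulnA leq_mul // bin_ffact exp_leq_ffact.
have Mpos : (0 < M - d * E)%N by rewrite subn_gt0.
rewrite -(ltn_pmul2r Mpos).
apply: (@leq_ltn_trans (D * M ^ d.+1)%N); first by rewrite -mulnA leq_mul // bernoulli_leq // ltnW.
have Md : (0 < M ^ d)%N by rewrite expn_gt0.
rewrite expnS; have -> : (D.+1 * M ^ d * (M - d * E) = (D * M + 1) * M ^ d)%N.
  rewrite mulnAC; congr (_ * _)%N; rewrite mulnBr [(D.+1 * M)%N]mulSn.
  rewrite {1}/M; move: (D * M)%N (D.+1 * (d * E))%N => u v; lia.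
by rewrite mulnDl mulnA mul1n -addn1 leq_add2l.
Qed.

(** The left side is at most [2 * e.+1 ^ (a + b)] times [k ^ (a + b)], and [k] is taken larger than
    that constant. *)
Lemma quat_dim_bound a b e : exists k,
  (2 * ('C(e * k + a, a) * 'C(e * k + b, b)) < k ^ (a + b).+1)%N.
Proof.
pose k := (2 * e.+1 ^ (a + b)).+1; exists k.
apply: (@leq_ltn_trans (2 * (e.+1 * k) ^ (a + b))%N).
  rewrite leq_mul2l /= expnD; apply: leq_mul; apply: leq_trans (bin_leq_exp _ _) _;
    by apply: leq_expl; rewrite /k mulSn; lia.
by rewrite expnMn mulnA expnS ltn_mul2r expn_gt0 /= /k ltnS leqnn.
Qed.

(** * Nodes, and cells as unit quaternions vanishing at them *)

Section Cells.
Variable K : numClosedFieldType.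
Implicit Types (p q u v w : 'rV[K]_4) (S T : {set 'I_6}).

Lemma dotC p q : dot p q = dot q p.
Proof. by apply: eq_bigr => i _; rewrite mulrC. Qed.

Lemma dotDl p q u : dot (p + q) u = dot p u + dot q u.
Proof. by rewrite /dot -big_split; apply: eq_bigr => i _; rewrite mxE mulrDl. Qed.

Lemma dotZl c p u : dot (c *: p) u = c * dot p u.
Proof. by rewrite /dot mulr_sumr; apply: eq_bigr => i _; rewrite mxE mulrA. Qed.

Lemma dotDr p q u : dot u (p + q) = dot u p + dot u q.
Proof. by rewrite dotC dotDl !(dotC u). Qed.

Lemma dotZr c p u : dot u (c *: p) = c * dot u p.
Proof. by rewrite dotC dotZl (dotC u). Qed.

Lemma dotNl p u : dot (- p) u = - dot p u.
Proof. by rewrite -scaleN1r dotZl mulN1r. Qed.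

Lemma dotNr p u : dot u (- p) = - dot u p.
Proof. by rewrite dotC dotNl dotC. Qed.

Definition dotE := (dotDl, dotDr, dotZl, dotZr, dotNl, dotNr).

Lemma evqD i p q : evq i (p + q) = evq i p + evq i q.
Proof. by rewrite /evq -big_split; apply: eq_bigr => j _; rewrite mxE mulrDl. Qed.

Lemma evqZ i c p : evq i (c *: p) = c * evq i p.
Proof. by rewrite /evq mulr_sumr; apply: eq_bigr => j _; rewrite mxE mulrA. Qed.

Definition vanish S p := forall i, i \in S -> evq i p = 0.

Lemma vanishD S p q : vanish S p -> vanish S q -> vanish S (p + q).
Proof. by move=> hp hq i iS; rewrite evqD hp // hq // addr0. Qed.

Lemma vanishZ S c p : vanish S p -> vanish S (c *: p).
Proof. by move=> hp i iS; rewrite evqZ hp // mulr0. Qed.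

Lemma vanishN S p : vanish S p -> vanish S (- p).
Proof. by rewrite -scaleN1r; apply: vanishZ. Qed.

Definition nodepoly S : {poly K} := \prod_(i in S) ('X - (val i)%:R%:P).

Lemma nodepoly_seq S : nodepoly S = \prod_(i <- enum S) ('X - (val i)%:R%:P).
Proof. by rewrite /nodepoly big_enum. Qed.

Lemma size_nodepoly S : size (nodepoly S) = #|S|.+1.
Proof. by rewrite nodepoly_seq size_prod_XsubC cardE. Qed.

Lemma nodepoly_monic S : nodepoly S \is monic.
Proof. by rewrite nodepoly_seq monic_prod_XsubC. Qed.

Lemma nodepoly_neq0 S : nodepoly S != 0.
Proof. exact: monic_neq0 (nodepoly_monic S). Qed.

Lemma nodepoly_root S (j : 'I_6) : ((nodepoly S).[(val j)%:R] == 0) = (j \in S).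
Proof.
rewrite horner_prod; apply/idP/idP => [/prodf_eq0[i iS]|jS].
  by rewrite hornerXsubC subr_eq0 eqr_nat => /eqP/val_inj ->.
by rewrite (bigD1 j) //= hornerXsubC subrr mul0r.
Qed.

Lemma nodepoly_real S i : (nodepoly S)`_i \is Num.real.
Proof.
have -> : nodepoly S = map_poly (intr : int -> K) (\prod_(j in S) ('X - (val j)%:Z%:P)).
  by rewrite rmorph_prod; apply: eq_bigr => j _; rewrite /= map_polyXsubC.
by rewrite coef_map realz.
Qed.

Definition nodevec S : 'rV[K]_4 := poly_rV (nodepoly S).

Lemma evq_poly_rV i (P : {poly K}) : (size P <= 4)%N -> evq i (poly_rV P) = P.[i%:R].
Proof. by move=> sP; rewrite evqE poly_rV_K. Qed.

Lemma evq_nodevec S (j : 'I_6) : (#|S| <= 3)%N -> (evq j (nodevec S) == 0) = (j \in S).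
Proof. by move=> S3; rewrite evq_poly_rV ?size_nodepoly // nodepoly_root. Qed.

(** A sum of squares of reals; this is where the reality of the nodes replaces a Hermitian form. *)
Lemma dot_real_neq0 v : v != 0 -> (forall j, v 0 j \is Num.real) -> dot v v != 0.
Proof.
move=> v0 vr; apply: contra v0 => /eqP vv; apply/eqP/rowP => j; rewrite mxE.
have := psumr_eq0P _ vv; rewrite /= => /(_ _ j isT) H; apply/eqP; rewrite -sqrf_eq0 expr2 H //.
by move=> i _; rewrite -expr2 real_exprn_even_ge0.
Qed.

Lemma nodevec_real S j : nodevec S 0 j \is Num.real.
Proof. by rewrite mxE nodepoly_real. Qed.

Lemma dot_nodevec S : (#|S| <= 3)%N -> dot (nodevec S) (nodevec S) != 0.
Proof.
move=> S3; apply: dot_real_neq0; last exact: nodevec_real.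
apply: contraNneq (nodepoly_neq0 S) => n0.
by rewrite -[nodepoly S](@poly_rV_K _ 4) ?size_nodepoly // -/(nodevec S) n0 linear0.
Qed.

Definition unitv v := (sqrtC (dot v v))^-1 *: v.

Lemma dot_unitv v : dot v v != 0 -> dot (unitv v) (unitv v) = 1.
Proof.
move=> v0; rewrite !dotE mulrA -expr2 exprVn sqrtCK mulVf //.
Qed.

(** For [#|S| <= 3], a basis of the polynomials of degree at most 3 that vanish on [S]; the row
    count is a successor to match the Hilbert bound. *)
Definition basis_mx S : 'M[K]_((3 - #|S|).+1, 4) :=
  \matrix_i poly_rV ('X^i * nodepoly S).

Lemma vanish_basis S p : (#|S| <= 3)%N -> vanish S p -> exists s, p = s *m basis_mx S.
Proof.
move=> S3 pS.
have [Q pE] : exists Q, rVpoly p = Q * nodepoly S.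
  rewrite nodepoly_seq -(big_map (fun i : 'I_6 => (val i)%:R : K) xpredT (fun x => 'X - x%:P)).
  apply: uniq_roots_prod_XsubC.
    by apply/allP => _ /mapP[i iS ->]; rewrite /root -evqE pS // -mem_enum.
  rewrite uniq_rootsE map_inj_uniq ?enum_uniq // => i j /eqP.
  by rewrite eqr_nat => /eqP/val_inj.
have sQ : (size Q <= (3 - #|S|).+1)%N.
  have := size_poly 4 (fun k => if insub k is Some i then p 0 i else 0).
  have : (size (rVpoly p) <= 4)%N by apply: size_poly.
  rewrite pE; have [->|Q0] := eqVneq Q 0; first by rewrite size_poly0.
  rewrite size_Mmonic ?nodepoly_monic // size_nodepoly addnS /=; lia.
exists (poly_rV Q); rewrite -[p]rVpolyK pE.
rewrite -{1}(poly_rV_K sQ) [rVpoly _](_ : _ = \sum_i (poly_rV Q : 'rV_(3 - #|S|).+1) 0 i *: 'X^i).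
  rewrite mulr_suml linear_sum /= mulmx_sum_row; apply: eq_bigr => i _.
  by rewrite rowK -scalerAl linearZ.
by rewrite /rVpoly poly_def; apply: eq_bigr => i _; rewrite valK.
Qed.

End Cells.

(** * Rational curves on the cells *)

Section Curves.
Variable K : numClosedFieldType.
Implicit Types (p q u v w : 'rV[K]_4) (S T : {set 'I_6}) (D : {poly K}).

Lemma ratfunMl D D' f : ratfun D f -> ratfun (D * D') f.
Proof.
move=> [N [P fP]]; exists N, (P * D' ^+ N) => e; rewrite hornerM mulf_eq0 negb_or.
move=> /andP[De D'e]; rewrite fP // hornerM horner_exp exprMn.
by field; rewrite !expf_neq0.
Qed.

Lemma ratfunMr D D' f : ratfun D' f -> ratfun (D * D') f.
Proof. by rewrite mulrC; apply: ratfunMl. Qed.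

Lemma ratfun_quat D (y z : K -> 'rV[K]_4) j :
  (forall i, ratfun D (fun e => y e 0 i)) -> (forall i, ratfun D (fun e => z e 0 i)) ->
  ratfun D (fun e => quat (y e) (z e) 0 j).
Proof.
move=> yD zD; apply: (@ratfun_ext _ _ (fun e => \sum_a \sum_b
    (y e 0 a * z e 0 b) * unit_quat K a b 0 j)) => [e|].
  by rewrite quatE summxE; apply: eq_bigr => a _; rewrite summxE; apply: eq_bigr => b _; rewrite [RHS]mxE.
apply: ratfun_sum => a; apply: ratfun_sum => b; apply: ratfunM; last exact: ratfun_const.
exact: ratfunM.
Qed.

(* A nondegenerate plane of S-vanishing vectors meets the orthogonal complement of p. *)
Lemma unit_orthogonal S p : (#|S| <= 2)%N -> vanish S p -> dot p p = 1 ->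
  exists v, [/\ vanish S v, dot v p = 0 & dot v v = 1].
Proof.
move=> S2 pS pp.
pose g w := dot w w - dot w p ^+ 2.
suff [w wS gw] : exists2 w, vanish S w & g w != 0.
  exists (unitv (w - dot w p *: p)).
  have gE : dot (w - dot w p *: p) (w - dot w p *: p) = g w.
    by rewrite !dotE pp (dotC p w) /g; ring.
  split; last by rewrite dot_unitv // gE.
    by apply: vanishZ; apply: vanishD => //; apply: vanishN; apply: vanishZ.
  by rewrite /unitv !dotE pp mulr1 subrr mulr0.
pose w1 := nodevec K S; pose w2 : 'rV[K]_4 := poly_rV ('X * nodepoly K S).
have sX : (size ('X * nodepoly K S)%R <= 4)%N.
  by rewrite mulrC size_mulX ?nodepoly_neq0 // size_nodepoly.
have w1S : vanish S w1.
  by move=> i iS; apply/eqP; rewrite evq_nodevec // ltnW.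
have w2S : vanish S w2.
  move=> i iS; apply/eqP; rewrite evq_poly_rV // hornerM mulf_eq0 nodepoly_root iS orbT //.
(* If every [S]-vanishing vector had an isotropic projection away from [p], the Gram matrix of [w1]
   and [w2] would be degenerate, and the nonzero real vector [w2 - c *: w1] would be isotropic. *)
apply: contrapT => H.
have g0 w : vanish S w -> g w = 0.
  by move=> wS; apply/eqP/negPn/negP => gw; apply: H; exists w.
have d11 : dot w1 w1 = dot w1 p ^+ 2 by apply/eqP; rewrite -subr_eq0; apply/eqP/g0.
have d22 : dot w2 w2 = dot w2 p ^+ 2 by apply/eqP; rewrite -subr_eq0; apply/eqP/g0.
have d12 : dot w1 w2 = dot w1 p * dot w2 p.
  have := g0 _ (vanishD w1S w2S); rewrite /g !dotE (dotC w2 w1) d11 d22 => h.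
  apply: (@mulfI _ (2 : K)); first by rewrite pnatr_eq0.
  by apply/eqP; rewrite -subr_eq0; apply/eqP; rewrite -[RHS]h; ring.
have S3 : (#|S| <= 3)%N by apply: ltnW.
pose c := dot w1 w2 / dot w1 w1.
have : dot (w2 - c *: w1) (w2 - c *: w1) != 0.
  apply: dot_real_neq0.
    apply/eqP => /(congr1 rVpoly); rewrite linearB linearZ linear0 /= !poly_rV_K ?size_nodepoly //.
    rewrite -mul_polyC -mulrBl => /eqP; rewrite mulf_eq0 (negPf (nodepoly_neq0 _ _)) orbF.
    by rewrite polyXsubC_eq0.
  have w1r := nodevec_real K S.
  have w2r j : w2 0 j \is Num.real.
    rewrite mxE coefXM; case: ifP => _ //; exact: nodepoly_real.
  have dr u v : (forall j, u 0 j \is Num.real) -> (forall j, v 0 j \is Num.real) ->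
      dot u v \is Num.real by move=> ur vr; apply: rpred_sum => i _; apply: rpredM.
  move=> j; rewrite !mxE; apply: rpredB; first by have := w2r j; rewrite mxE.
  by apply: rpredM; [apply: rpred_div; apply: dr | have := w1r j; rewrite mxE].
have d1 : dot w1 w1 != 0 := dot_nodevec K S3.
rewrite !dotE (dotC w2 w1) /c d12 d22 d11; move: d1; rewrite d11 => d1.
have w1p : dot w1 p != 0 by move: d1; rewrite expf_eq0.
by case/eqP; field.
Qed.

(* Stereographic projection: a line in the parameter space gives a rational curve
   joining two unit vectors. *)
Lemma unit_curve S p1 p2 : (#|S| <= 2)%N \/ p1 = p2 ->
  vanish S p1 -> vanish S p2 -> dot p1 p1 = 1 -> dot p2 p2 = 1 ->
  exists D (z : K -> 'rV[K]_4), [/\ D.[0] != 0 /\ D.[1] != 0, forall j, ratfun D (fun e => z e 0 j),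
    forall e, D.[e] != 0 -> vanish S (z e) /\ dot (z e) (z e) = 1 & z 0 = p1 /\ z 1 = p2].
Proof.
move=> Sp p1S p2S u1 u2.
have [S2|] := boolP (#|S| <= 2)%N; last first.
  case: Sp => [-> //|<- _]; exists 1, (fun=> p1); split => //.
    by rewrite !hornerC oner_neq0.
  by move=> j; apply: ratfun_const.
have [v [vS vp vv]] := unit_orthogonal S2 p1S u1.
(* Projection from [- w] is defined at [p2] when [1 + dot w p2] is nonzero, which holds for [v] or
   for [- v]. *)
have [w [wS wp1 ww wp2]] : exists w, [/\ vanish S w, dot w p1 = 0, dot w w = 1 & 1 + dot w p2 != 0].
  have [e|ne] := eqVneq (1 + dot v p2) 0; last by exists v.
  exists (- v); split; rewrite ?dotE ?vp ?vv ?oppr0 ?opprK //; first exact: vanishN.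
  have -> : dot v p2 = -1 by apply/eqP; rewrite -addr_eq0 addrC e.
  by rewrite opprK -mulr2n pnatr_eq0.
(* [y1] and [y2] are the projections of [p1] and [p2] to the orthogonal complement of [w]. *)
pose y1 := p1; pose c := dot w p2; pose y2 := (1 + c)^-1 *: (p2 - c *: w).
pose y e := y1 + e *: (y2 - y1).
have wy e : dot w (y e) = 0.
  by rewrite /y /y2 !dotE wp1 ww -/c; field.
pose D : {poly K} := 1 + \sum_j ((y1 0 j)%:P + ((y2 - y1) 0 j) *: 'X) ^+ 2.
have DE e : D.[e] = 1 + dot (y e) (y e).
  rewrite /D hornerD hornerC horner_sum; congr (_ + _); apply: eq_bigr => j _.
  by rewrite horner_exp hornerD hornerC hornerZ hornerX /y !mxE; ring.
pose z e := D.[e]^-1 *: ((1 - dot (y e) (y e)) *: w + 2 *: y e).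
have yS e : vanish S (y e).
  have y2S : vanish S y2.
    by apply: vanishZ; apply: vanishD => //; apply: vanishN; apply: vanishZ.
  by apply: vanishD => //; apply: vanishZ; apply: vanishD => //; apply: vanishN.
have D0 : D.[0] = 2 by rewrite DE /y scale0r addr0 u1.
have D1 : D.[1] = 2 / (1 + c).
  by rewrite DE /y scale1r addrCA subrr addr0 /y2 !dotE u2 ww (dotC p2) -/c; field.
exists D, z; split.
- by rewrite D0 D1 mulf_neq0 ?invr_neq0 ?pnatr_eq0.
- have yr i : ratfun D (fun e => y e 0 i).
    apply: (@ratfun_ext _ _ (fun e => y1 0 i + e * (y2 - y1) 0 i)) => [e|]; first by rewrite !mxE.
    apply: ratfunD; first exact: ratfun_const.
    by apply: ratfunM; [apply: ratfun_id | apply: ratfun_const].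
  move=> j; apply: (@ratfun_ext _ _ (fun e => D.[e]^-1 *
      ((1 + (-1) * \sum_i y e 0 i * y e 0 i) * w 0 j + 2 * y e 0 j))) => [e|].
    by rewrite !mxE mulN1r.
  apply: ratfunM; first exact: ratfun_inv.
  apply: ratfunD; last by apply: ratfunM => //; apply: ratfun_const.
  apply: ratfunM; last exact: ratfun_const.
  apply: ratfunD; first exact: ratfun_const.
  apply: ratfunM; first exact: ratfun_const.
  by apply: ratfun_sum => i; apply: ratfunM.
- move=> e De; split.
    by apply: vanishZ; apply: vanishD; apply: vanishZ.
  rewrite /z; move: De (wy e); rewrite DE; move: (y e) => Y De wY.
  by rewrite !dotE ww (dotC Y) wY; field.
- split.
    by rewrite /z D0 /y scale0r addr0 u1 subrr scale0r add0r scalerA mulVf ?scale1r ?pnatr_eq0.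
  rewrite /z D1 /y scale1r [y1 + _]addrC subrK.
  have -> : dot y2 y2 = (1 - c) / (1 + c).
    by rewrite /y2 !dotE u2 ww (dotC p2) -/c; field.
  apply/rowP => j; rewrite !mxE; field; rewrite wp2 /=.
  by [].
Qed.

Lemma vanish_line (U : {set 'I_6}) p p' : #|U| = 3%N -> vanish U p -> vanish U p' ->
  dot p p = 1 -> dot p' p' = 1 -> p' = p \/ p' = - p.
Proof.
move=> U3 pU p'U pp p'p'.
have [s sE] := vanish_basis (eq_leq U3) pU; have [s' s'E] := vanish_basis (eq_leq U3) p'U.
have U0 : (3 - #|U| = 0)%N by rewrite U3.
pose b := row 0 (basis_mx K U).
have pb (t : 'rV_((3 - #|U|).+1)) : t *m basis_mx K U = t 0 0 *: b.
  by rewrite mulmx_sum_row; move: (t) (basis_mx K U) @b; rewrite U0 => t' B b; rewrite big_ord1.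
rewrite {}sE {}s'E !pb in pp p'p' *; move: pp p'p'; rewrite !dotE !mulrA -!expr2 => pp p'p'.
have b0 : dot b b != 0 by apply/eqP => b0; move/eqP: pp; rewrite b0 mulr0 eq_sym oner_eq0.
have : s' 0 0 ^+ 2 == s 0 0 ^+ 2 by apply/eqP; apply: (mulIf b0); rewrite pp p'p'.
by rewrite eqf_sqr => /orP[]/eqP ->; [left | right; rewrite scaleNr].
Qed.

(** Two points are joined by a rational curve in the cell, on which one of [f], [g] must vanish
    identically. With three nodes a unit factor is fixed up to sign; a wrong sign is moved to the
    other factor, whose unit vectors can be joined since it has at most two nodes. *)
Lemma cell_prime S T : (#|S| <= 3)%N -> (#|T| <= 3)%N -> (#|S| + #|T| < 6)%N ->
  prime_on (@cell K S T).
Proof.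
move=> S3 T3 ST f g fg0.
apply: contrapT => /not_orP[/existsNP[x1 /not_implyP[Zx1 fx1]] /existsNP[x2 /not_implyP[Zx2 gx2]]].
have eq3 (U : {set 'I_6}) : (#|U| <= 3)%N -> ~~ (#|U| <= 2)%N -> #|U| = 3%N by lia.
have [p1 [q1 [pp1 qq1 x1E pS1 qT1]]] := Zx1.
have [p2 [q2 [pS2 qT2 pp2 qq2 [x2E hp hq]]]] : exists p q, [/\ vanish S p, vanish T q, dot p p = 1, dot q q = 1 &
    [/\ x2 = quat p q, (#|S| <= 2)%N \/ p1 = p & (#|T| <= 2)%N \/ q1 = q]].
  have [p2 [q2 [pp2 qq2 x2E pS2 qT2]]] := Zx2.
  have N : x2 = quat (- p2) (- q2) by rewrite -!scaleN1r quatZl quatZr scalerA mulrNN mulr1 scale1r.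
  have [S2|S2] := boolP (#|S| <= 2)%N; have [T2|T2] := boolP (#|T| <= 2)%N.
  - by exists p2, q2; split => //; split => //; left.
  - have [e|e] := vanish_line (eq3 T T3 T2) qT1 qT2 qq1 qq2.
      by exists p2, q2; split => //; split => //; [left | right].
    exists (- p2), (- q2); split; rewrite ?dotE ?opprK //; try exact: vanishN.
    by split => //; [left | right; rewrite e opprK].
  - have [e|e] := vanish_line (eq3 S S3 S2) pS1 pS2 pp1 pp2.
      by exists p2, q2; split => //; split => //; [right | left].
    exists (- p2), (- q2); split; rewrite ?dotE ?opprK //; try exact: vanishN.
    by split => //; [right; rewrite e opprK | left].
  - by move: ST S2 T2; lia.
have [D1 [z1 [[D10 D11] z1r z1S [z10 z11]]]] := unit_curve hp pS1 pS2 pp1 pp2.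
have [D2 [z2 [[D20 D21] z2r z2S [z20 z21]]]] := unit_curve hq qT1 qT2 qq1 qq2.
pose D := D1 * D2; pose x e := quat (z1 e) (z2 e).
have xr j : ratfun D (fun e => x e 0 j).
  by apply: ratfun_quat => i; [apply: ratfunMl | apply: ratfunMr].
have D0 : D.[0] != 0 by rewrite hornerM mulf_neq0.
have D_1 : D.[1] != 0 by rewrite hornerM mulf_neq0.
have Dn0 : D != 0 by apply: contraNneq D0 => ->; rewrite horner0.
have [e De|h|h] := ratfun_mul_eq0 Dn0 (ratfun_meval f xr) (ratfun_meval g xr).
- move: De; rewrite hornerM mulf_eq0 negb_or => /andP[/z1S[? ?] /z2S[? ?]].
  by apply: fg0; exists (z1 e), (z2 e).
- by apply: fx1; rewrite x1E -z10 -z20; apply: h.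
- by apply: gx2; rewrite x2E -z11 -z21; apply: h.
Qed.

Lemma cell_irreducible S T : (#|S| <= 3)%N -> (#|T| <= 3)%N -> (#|S| + #|T| < 6)%N ->
  zariski_irreducible (@cell K S T).
Proof.
move=> S3 T3 ST; apply: prime_irreducible; [exact: cell_closed | | exact: cell_prime].
have uS (U : {set 'I_6}) : (#|U| <= 3)%N -> vanish U (unitv (nodevec K U)).
  by move=> U3; apply: vanishZ => i iU; apply/eqP; rewrite evq_nodevec.
by exists (quat (unitv (nodevec K S)) (unitv (nodevec K T))), (unitv (nodevec K S)), (unitv (nodevec K T));
  split; rewrite ?dot_unitv ?dot_nodevec //; apply: uS.
Qed.

(* The unit vectors p + e u(e) obtained by stereographic projection have tangent vector 2 y. *)
Lemma cell_arc S T p q p' q' : vanish S p -> vanish T q -> dot p p = 1 -> dot q q = 1 ->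
  vanish S p' -> vanish T q' -> dot p' p = 0 -> dot q' q = 0 ->
  exists D (z : K -> 'rV[K]_(4 * 4)), [/\ D.[0] != 0, forall j, ratfun D (fun e => z e 0 j),
    forall e, D.[e] != 0 -> @cell K S T (quat p q + e *: z e) & z 0 = quat p' q + quat p q'].
Proof.
move=> pS qT pp qq p'S q'T p'p q'q.
have arc (U : {set 'I_6}) u u' : vanish U u -> dot u u = 1 -> vanish U u' -> dot u' u = 0 ->
  exists D (z : K -> 'rV[K]_4), [/\ D.[0] != 0, forall j, ratfun D (fun e => z e 0 j),
    forall e, D.[e] != 0 -> vanish U (u + e *: z e) /\ dot (u + e *: z e) (u + e *: z e) = 1 & z 0 = u'].
  move=> uU uu u'U u'u; pose c := dot u' u' / 4.
  pose D : {poly K} := 1 + c *: 'X^2.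
  have DE e : D.[e] = 1 + c * e ^+ 2 by rewrite /D hornerD hornerC hornerZ hornerXn.
  pose z e := D.[e]^-1 *: (u' - (2 * e * c) *: u).
  exists D, z; split.
  - by rewrite DE expr0n mulr0 addr0 oner_neq0.
  - move=> j; apply: (@ratfun_ext _ _ (fun e => D.[e]^-1 * (u' 0 j + e * (- (2 * c * u 0 j))))) => [e|].
      by rewrite !mxE; ring.
    apply: ratfunM; first exact: ratfun_inv.
    apply: ratfunD; first exact: ratfun_const.
    by apply: ratfunM; [apply: ratfun_id | apply: ratfun_const].
  - move=> e; rewrite DE => De; split.
      apply: vanishD => //; apply: vanishZ; apply: vanishZ; apply: vanishD => //.
      by apply: vanishN; apply: vanishZ.
    rewrite /z DE !dotE (dotC u u') u'u uu.
    have -> : dot u' u' = 4 * c by rewrite /c mulrC divfK ?pnatr_eq0.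
    by field.
  - by rewrite /z DE expr0n /= mulr0 addr0 invr1 scale1r mulr0 mul0r scale0r subr0.
have [D1 [z1 [D10 z1r z1S z10]]] := arc _ _ _ pS pp p'S p'p.
have [D2 [z2 [D20 z2r z2S z20]]] := arc _ _ _ qT qq q'T q'q.
exists (D1 * D2), (fun e => quat (z1 e) q + quat p (z2 e) + e *: quat (z1 e) (z2 e)); split.
- by rewrite hornerM mulf_neq0.
- have c1 (v : 'rV[K]_4) i : ratfun (D1 * D2) (fun=> v 0 i) by apply: ratfun_const.
  have h1 i : ratfun (D1 * D2) (fun e => z1 e 0 i) by apply: ratfunMl.
  have h2 i : ratfun (D1 * D2) (fun e => z2 e 0 i) by apply: ratfunMr.
  move=> j; apply: (@ratfun_ext _ _ (fun e => quat (z1 e) q 0 j + quat p (z2 e) 0 j +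
     e * quat (z1 e) (z2 e) 0 j)) => [e|]; first by rewrite !mxE.
  apply: ratfunD; first by apply: ratfunD; apply: ratfun_quat.
  by apply: ratfunM; [apply: ratfun_id | apply: ratfun_quat].
- move=> e; rewrite hornerM mulf_eq0 negb_or => /andP[/z1S[? ?] /z2S[? ?]].
  exists (p + e *: z1 e), (q + e *: z2 e); split => //.
  rewrite quatDl !quatDr !quatZl !quatZr !scalerDr scalerA.
  by rewrite !addrA; congr (_ + _); rewrite addrAC.
- by rewrite scale0r addr0 z10 z20.
Qed.

End Curves.

(** * The forty points *)

Section WitnessPoints.
Variable K : numClosedFieldType.
Implicit Types (p q u v : 'rV[K]_4) (S T B : {set 'I_6}).

Definition below (k : nat) : {set 'I_6} := [set i : 'I_6 | (i < k)%N].

Lemma card_below k : (k <= 6)%N -> #|below k| = k.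
Proof.
move=> k6; have wi : injective (widen_ord k6) by move=> i j /(congr1 val) /= /val_inj.
rewrite -[RHS](card_ord k) -(card_imset _ wi).
apply: eq_card => i; rewrite inE; apply/idP/imsetP => [ik|[j _ ->]]; last exact: (ltn_ord j).
by exists (Ordinal ik) => //; apply: val_inj.
Qed.

(** The sign accounts for the two points of a triple: changing the signs of both factors gives the
    same matrix, changing one gives its opposite. *)
Definition pt T (s : bool) : 'rV[K]_(4 * 4) :=
  quat ((-1) ^+ s *: unitv (nodevec K T)) (unitv (nodevec K (~: T))).

Lemma dot_sign s u : dot ((-1) ^+ s *: u) ((-1) ^+ s *: u) = dot u u.
Proof. by rewrite !dotE mulrA -expr2 sqrr_sign mul1r. Qed.

Lemma evq_sign_nodevec T s (i : 'I_6) : (#|T| <= 3)%N ->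
  (evq i ((-1) ^+ s *: unitv (nodevec K T)) == 0) = (i \in T).
Proof.
move=> T3; rewrite !evqZ mulf_eq0 signr_eq0 /= mulf_eq0 invr_eq0 sqrtC_eq0.
by rewrite (negPf (dot_nodevec K T3)) evq_nodevec.
Qed.

Lemma card_setC3 T : #|T| = 3%N -> #|~: T| = 3%N.
Proof. by move=> T3; rewrite cardsCs finset.setCK card_ord T3. Qed.

Lemma pt_cell T s S B : #|T| = 3%N -> S \subset T -> B \subset ~: T -> cell S B (pt T s).
Proof.
move=> T3 ST BT; have T3' := card_setC3 T3.
exists ((-1) ^+ s *: unitv (nodevec K T)), (unitv (nodevec K (~: T))); split => //.
- by rewrite dot_sign dot_unitv // dot_nodevec // T3.
- by rewrite dot_unitv // dot_nodevec // T3'.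
- by move=> i iS; apply/eqP; rewrite evq_sign_nodevec ?T3 // (fintype.subsetP ST).
- move=> i iB; apply/eqP; have := @evq_sign_nodevec (~: T) false i.
  by rewrite expr0 scale1r => ->; rewrite ?T3' // (fintype.subsetP BT).
Qed.

(** The point determines the products of coordinates, hence the factors up to scalars and their
    zeros among the nodes. *)
Lemma cell_ptP T s S B : #|T| = 3%N -> cell S B (pt T s) -> S \subset T /\ B \subset ~: T.
Proof.
move=> T3 [p [q [pp qq E pS qB]]]; have T3' := card_setC3 T3; rewrite /pt in E.
set u := (-1) ^+ s *: unitv (nodevec K T) in E; set v := unitv _ in E.
have uu : dot u u = 1 by rewrite dot_sign dot_unitv // dot_nodevec // T3.
have vv : dot v v = 1 by rewrite dot_unitv // dot_nodevec // T3'.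
have uv a b : u 0 a * v 0 b = p 0 a * q 0 b by rewrite -!quat_coordq -E.
split; apply/fintype.subsetP => i iSB.
  rewrite -(evq_sign_nodevec s) ?T3 // -/u; have [b vb] := dot_neq0 vv.
  rewrite -(mulIr_eq0 _ (mulIf vb)); apply/eqP.
  transitivity (evq i p * q 0 b); last by rewrite pS // mul0r.
  by rewrite /evq !mulr_suml; apply: eq_bigr => a _; rewrite mulrAC uv mulrAC.
rewrite -(evq_sign_nodevec false) ?T3' // expr0 scale1r -/v; have [a ua] := dot_neq0 uu.
rewrite -(mulrI_eq0 _ (mulfI ua)); apply/eqP.
transitivity (p 0 a * evq i q); last by rewrite qB // mulr0.
by rewrite /evq !mulr_sumr; apply: eq_bigr => b _; rewrite !mulrA uv.
Qed.

Lemma pt_inj T T' s s' : #|T| = 3%N -> #|T'| = 3%N -> pt T s = pt T' s' -> (T, s) = (T', s').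
Proof.
move=> T3 T'3 E.
have TT' : T = T'.
  have := pt_cell s T3 (subxx T) (subxx (~: T)); rewrite E => /(cell_ptP T'3)[TT' _].
  by apply/eqP; rewrite eqEcard TT' T3 T'3.
rewrite -TT' {T' TT' T'3} in E *; congr (_, _).
apply: contraTeq isT => ss'; exfalso; move: E; rewrite /pt.
set u := unitv (nodevec K T); set v := unitv _ => E.
have uu : dot u u = 1 by rewrite dot_unitv // dot_nodevec // T3.
have vv : dot v v = 1 by rewrite dot_unitv // dot_nodevec // card_setC3.
have [a ua] := dot_neq0 uu; have [b vb] := dot_neq0 vv.
have := quat_coordq ((-1) ^+ s *: u) v a b; rewrite E quat_coordq ![(_ *: u) 0 a]mxE.
move/(mulIf vb)/(mulIf ua)/eqP; case: s s' ss' {E} => [] [] //= _.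
  by rewrite expr0 expr1 -addr_eq0 -mulr2n pnatr_eq0.
by rewrite expr0 expr1 eq_sym -addr_eq0 -mulr2n pnatr_eq0.
Qed.

(* Lagrange interpolation at the nodes in T, then projection orthogonally to u. *)
Lemma interpolate_orthogonal T u (c : 'I_6 -> K) : #|T| = 3%N -> vanish T u -> dot u u = 1 ->
  exists u' : 'rV[K]_4, (forall i, i \in T -> evq i u' = c i) /\ dot u' u = 0.
Proof.
move=> T3 uT uu.
have T1 (i : 'I_6) : i \in T -> #|T :\ i| = 2%N by move=> iT; rewrite (cardsD1 i) iT in T3; case: T3.
pose r := \sum_(i in T) (c i / evq i (nodevec K (T :\ i))) *: nodevec K (T :\ i).
have rE (i : 'I_6) : i \in T -> evq i r = c i.
  move=> iT; have ev (I : finType) (P : pred I) (F : I -> 'rV[K]_4) j :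
      evq j (\sum_(i | P i) F i) = \sum_(i | P i) evq j (F i).
    by rewrite (big_morph (evq j) (evqD j) (id1 := 0)) // /evq big1 // => a _; rewrite mxE mul0r.
  rewrite ev (bigD1 i) //= evqZ divfK ?big1 ?addr0 //.
    move=> j /andP[jT ji]; rewrite evqZ; apply/eqP; rewrite mulf_eq0; apply/orP; right.
    by rewrite evq_nodevec ?T1 // !inE eq_sym ji.
  by rewrite evq_nodevec ?T1 // !inE eqxx.
exists (r - dot r u *: u); split; last by rewrite !dotE uu mulr1 subrr.
by move=> i iT; rewrite -scaleNr evqD evqZ uT // mulr0 addr0 rE.
Qed.

(** The forms of the remaining nodes [k], ..., 5, which give the special section of the cells after
    [k] cuts. *)
Definition hypmx k : 'M[K]_(4 * 4, 6 - k) := \matrix_(i, j) hypcol K (k + j) i 0.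

Lemma mul_hypmx k (x : 'rV[K]_(4 * 4)) j : (x *m hypmx k) 0 j = (x *m hypcol K (k + j)) 0 0.
Proof. by rewrite !mxE; apply: eq_bigr => i _; rewrite mxE. Qed.

(** A tangent vector p' q + p q' changes the form of node i by p'(i) q(i) + p(i) q'(i). Exactly one
    of p, q vanishes at i, so prescribing the derivative of that one reaches any value. *)
Lemma pt_arc k T s (b : 'rV[K]_(6 - k)) : (k <= 6)%N -> #|T| = 3%N ->
  exists (D : {poly K}) (z : K -> 'rV[K]_(4 * 4)),
   [/\ D.[0] != 0, forall j, ratfun D (fun e => z e 0 j),
       forall e, D.[e] != 0 -> cell (T :&: below k) (~: T :&: below k) (pt T s + e *: z e) &
       z 0 *m hypmx k = b].
Proof.
move=> k6 T3; have T3' := card_setC3 T3; rewrite /pt.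
set u := _ *: _; set v := unitv _.
have uu : dot u u = 1 by rewrite dot_sign dot_unitv // dot_nodevec // T3.
have vv : dot v v = 1 by rewrite dot_unitv // dot_nodevec // T3'.
have ui (i : 'I_6) : (evq i u == 0) = (i \in T) by rewrite evq_sign_nodevec ?T3.
have vi (i : 'I_6) : (evq i v == 0) = (i \in ~: T).
  by rewrite -(evq_sign_nodevec false) ?T3' // expr0 scale1r.
have uT : vanish T u by move=> i iT; apply/eqP; rewrite ui.
have vT : vanish (~: T) v by move=> i iT; apply/eqP; rewrite vi.
(* The targets are 0 below [k], which keeps the arc in the cell; as [i - k] is truncated there,
   [i < k] is tested separately. *)
pose c (i : 'I_6) := if insub (i - k)%N is Some j then (if (i < k)%N then 0 else b 0 j) else 0.
have ck (i : 'I_6) : i \in below k -> c i = 0.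
  by rewrite inE /c => ->; case: insub.
have [u' [u'E u'u]] := interpolate_orthogonal (fun i => c i / evq i v) T3 uT uu.
have [v' [v'E v'v]] := interpolate_orthogonal (fun i => c i / evq i u) T3' vT vv.
have sub (U W : {set 'I_6}) p : vanish U p -> vanish (U :&: W) p.
  by move=> pU i; rewrite inE => /andP[iU _]; apply: pU.
have [||D [z [D0 zr zc z0]]] := cell_arc (sub _ (below k) _ uT) (sub _ (below k) _ vT) uu vv _ _ u'u v'v.
- by move=> i; rewrite inE => /andP[iT ik]; rewrite u'E // ck // mul0r.
- by move=> i; rewrite inE => /andP[iT ik]; rewrite v'E // ck // mul0r.
exists D, z; split => //; apply/rowP => j; rewrite mul_hypmx z0 mulmxDl mxE !quat_hypcol.
have kj6 : (k + j < 6)%N by rewrite -ltn_subRL ltn_ord.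
have cE : c (Ordinal kj6) = b 0 j.
  by rewrite /c /= addKn valK ltnNge leq_addr.
rewrite -cE; have [iT|iT] := boolP (Ordinal kj6 \in T).
  have /eqP ev0 : evq (k + j)%N u == 0 by rewrite (ui (Ordinal kj6)).
  rewrite ev0 mul0r addr0 (u'E _ iT) divfK //.
  by rewrite (vi (Ordinal kj6)) inE iT.
have iT' : Ordinal kj6 \in ~: T by rewrite inE.
have /eqP ev0 : evq (k + j)%N v == 0 by rewrite (vi (Ordinal kj6)).
rewrite ev0 mulr0 add0r (v'E _ iT') mulrC divfK //.
by rewrite (ui (Ordinal kj6)).
Qed.

End WitnessPoints.

(** * Hyperplane sections of SO(4) *)

Section Sections.
Variable K : numClosedFieldType.
Implicit Types (p q u v : 'rV[K]_4) (S T B : {set 'I_6}).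

(** The triples whose points [pt T s] are the special points of the cell of [S]. *)
Definition triples k S : {set {set 'I_6}} := [set T : {set 'I_6} | (#|T| == 3%N) && (T :&: below k == S)].

Lemma card_triples k S : (k <= 6)%N -> S \subset below k -> (#|S| <= 3)%N ->
  #|triples k S| = 'C(6 - k, 3 - #|S|).
Proof.
move=> k6 Sk S3; set B := ~: below k.
have cB : #|B| = (6 - k)%N by rewrite cardsCs finset.setCK card_ord card_below.
have SB : S :&: B = finset.set0.
  by apply/finset.setP => i; rewrite !inE; apply/negP => /andP[/(fintype.subsetP Sk)]; rewrite inE => ->.
rewrite -cB -cards_draws.
have -> : triples k S = (fun U => U :|: S) @: [set U : {set 'I_6} | U \subset B & #|U| == (3 - #|S|)%N].
  apply/finset.setP => T; rewrite inE; apply/andP/imsetP => [[/eqP T3 /eqP TS]|[U]].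
    exists (T :&: B); last by rewrite -TS -finset.setIUr finset.setUC finset.setUCr finset.setIT.
    have cT := cardsID (below k) T; rewrite TS T3 in cT.
    by rewrite inE finset.subsetIr /= -finset.setDE -(addKn #|S| #|T :\: below k|) cT.
  rewrite inE => /andP[UB /eqP US] ->.
  have UbS : U :&: below k = finset.set0.
    by apply/finset.setP => i; rewrite !inE; apply/negP => /andP[/(fintype.subsetP UB)]; rewrite !inE => /negPf ->.
  split; last first.
    rewrite finset.setIUl UbS finset.set0U; apply/eqP/finset.setIidPl; exact: Sk.
  have US0 : U :&: S = finset.set0.
    by apply/eqP; rewrite -finset.subset0 -UbS; apply: finset.setIS.
  by rewrite cardsU US0 cards0 subn0 US subnK.
rewrite card_in_imset // => U V; rewrite !inE => /andP[UB _] /andP[VB _] E.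
have h (W : {set 'I_6}) : W \subset B -> (W :|: S) :&: B = W.
  by move=> WB; rewrite finset.setIUl SB finset.setU0; apply/finset.setIidPl.
by rewrite -(h U) // E h.
Qed.

Lemma triplesP k S T : T \in triples k S -> [/\ #|T| = 3%N, T :&: below k = S,
  S \subset T & below k :\: S \subset ~: T].
Proof.
rewrite inE => /andP[/eqP T3 /eqP TS]; split => //; rewrite -TS.
  exact: finset.subsetIl.
by apply/fintype.subsetP => i; rewrite !inE => /andP[]; case: (i \in T) => //= /negPf ->.
Qed.

Section OneCell.
Variables (k : nat) (S : {set 'I_6}).
Hypothesis k5 : (k < 6)%N.
Variable T0 : {set 'I_6}.
Hypothesis T0S : T0 \in triples k S.
Local Notation B := (below k :\: S).
Local Notation Z := (@cell K S B).
Local Notation a := (3 - #|S|)%N.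
Local Notation b := (3 - #|B|)%N.

Lemma cell_cards : [/\ (#|S| <= 3)%N, (#|B| <= 3)%N, S \subset below k & (#|S| + #|B| = k)%N].
Proof.
have [T3 TS ST BT] := triplesP T0S.
have Sk : S \subset below k by rewrite -TS finset.subsetIr.
split => //; first by rewrite (leq_trans (subset_leq_card ST)) ?T3.
  by rewrite (leq_trans (subset_leq_card BT)) ?card_setC3.
have := cardsID S (below k); rewrite (card_below (ltnW k5)); apply: etrans; congr (_ + _)%N.
by rewrite finset.setIC (finset.setIidPl Sk).
Qed.

Let ab : (a + b = 6 - k)%N.
Proof. by have [? ? _ ?] := cell_cards; lia. Qed.

Lemma cell_irr : zariski_irreducible Z.
Proof. by have [S3 B3 _ SB] := cell_cards; apply: cell_irreducible; rewrite ?SB. Qed.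

Lemma cell_hilbert : hilbert_bound Z (fun M => 2 * ('C(M + a, a) * 'C(M + b, b)))%N.
Proof.
have [S3 B3 _ _] := cell_cards.
apply: (hilbert_quat (P := basis_mx K S) (Q := basis_mx K B)) => x [p [q [pp qq -> pS qB]]].
have [s sE] := vanish_basis S3 pS; have [t tE] := vanish_basis B3 qB.
by exists s, t; rewrite -sE -tE.
Qed.

Lemma cell_no_chain : ~ irreducible_chain Z (6 - k).+1.
Proof.
apply: hilbert_no_chain cell_hilbert _ => e; rewrite -ab; exact: quat_dim_bound.
Qed.

Lemma cell_arcE T s (c : 'rV[K]_(6 - k)) : T \in triples k S ->
  exists (D : {poly K}) (z : K -> 'rV[K]_(4 * 4)),
   [/\ D.[0] != 0, forall j, ratfun D (fun e => z e 0 j),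
       forall e, D.[e] != 0 -> Z (pt K T s + e *: z e) & z 0 *m hypmx K k = c].
Proof.
move=> TS; have [T3 TSE ST BT] := triplesP TS.
have [D [z [D0 zr zc z0]]] := pt_arc s c (ltnW k5) T3.
exists D, z; split => // e /zc; rewrite TSE.
suff -> : ~: T :&: below k = B by [].
by rewrite -TSE; apply/finset.setP => i; rewrite !inE; case: (i \in T); case: (i < k)%N.
Qed.

(** The form of node [k] has derivative 1 along some arc at a special point, so it cannot vanish on
    the whole cell. This makes the inclusions in chains of cells strict. *)
Lemma cell_off_hyperplane : exists2 x, Z x & x *m hypcol K k <> 0.
Proof.
have k0 : (0 < 6 - k)%N by rewrite subn_gt0.
pose j0 := Ordinal k0.
have [D [z [D0 zr zc z0]]] := cell_arcE false (delta_mx 0 j0) T0S.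
apply: contrapT => H.
have pt0 : pt K T0 false *m hypcol K k = 0.
  apply: contrapT => n0; apply: H; exists (pt K T0 false) => //.
  by have := zc 0 D0; rewrite scale0r addr0.
have zrat : ratfun D (fun e => (z e *m hypcol K k) 0 0).
  apply: (@ratfun_ext _ _ (fun e => \sum_i z e 0 i * hypcol K k i 0)) => [e|]; first by rewrite mxE.
  by apply: ratfun_sum => i; apply: ratfunM => //; apply: ratfun_const.
have := ratfun_eq0_at0 D0 zrat; rewrite -[k in hypcol K k]addn0 -(mul_hypmx (z 0) j0) z0 mxE !eqxx.
move=> /(_ _)/eqP; rewrite oner_eq0 => F; apply/notF/F => e De e0.
apply: contrapT => nz; apply: H; exists (pt K T0 false + e *: z e); first exact: zc.
rewrite mulmxDl pt0 add0r -scalemxAl => /matrixP/(_ 0 0); rewrite [LHS]mxE [RHS]mxE => /eqP.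
by rewrite mulf_eq0 (negPf e0) /= => /eqP E; rewrite addn0 E in nz.
Qed.

Definition cell_points : finType := ({T | T \in triples k S} * bool)%type.

Lemma card_cell_points : #|cell_points| = (2 * 'C(a + b, a))%N.
Proof.
have [S3 B3 Sk _] := cell_cards.
by rewrite card_prod card_bool card_sig mulnC ab -(card_triples (ltnW k5)) // cardE -cardE.
Qed.

Lemma cell_generic_section : exists2 p : {mpoly K[(4 * 4 + 1) * (6 - k)]}, p != 0 &
  forall A c, p.@[param A c 0] != 0 -> (Z `&` affine_space A c #= `I_#|cell_points|)%card.
Proof.
pose pts (i : 'I_#|cell_points|) := pt K (val (enum_val i).1) (enum_val i).2.
have T3 (i : cell_points) : #|val i.1| = 3%N by have [] := triplesP (valP i.1).
have ptsI : injective pts.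
  move=> i j /(pt_inj (T3 _) (T3 _)) [E1 E2]; apply: enum_val_inj.
  by rewrite [LHS]surjective_pairing [RHS]surjective_pairing E2; congr (_, _); apply: val_inj.
have pts0 i : pts i *m hypmx K k = 0.
  have [h1 h2 h3 h4] := triplesP (valP (enum_val i).1).
  apply/rowP => j; rewrite mul_hypmx quat_hypcol [RHS]mxE.
  have kj6 : (k + j < 6)%N by rewrite -ltn_subRL ltn_ord.
  apply/eqP; rewrite mulf_eq0 -[(k + j)%N]/(val (Ordinal kj6)) evq_sign_nodevec ?h1 //.
  have := @evq_sign_nodevec K (~: val (enum_val i).1) false (Ordinal kj6).
  by rewrite expr0 scale1r => ->; rewrite ?card_setC3 // inE; case: (_ \in _).
have [M hM] := quat_degree_bound a b.
have D1 : (1 < #|cell_points|)%N.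
  rewrite card_cell_points; have : (0 < 'C(a + b, a))%N by rewrite bin_gt0 leq_addr.
  lia.
rewrite -card_cell_points ab in hM.
have [l l_inj] := separating_form ptsI.
apply: (generic_section cell_irr cell_hilbert hM D1 pts0 _ l_inj) => i c.
exact: (cell_arcE (enum_val i).2 c (valP (enum_val i).1)).
Qed.

End OneCell.
End Sections.

(** * Dimension and degree of the successive sections *)

Section SO4Sections.
Variable K : numClosedFieldType.
Implicit Types (p q u v : 'rV[K]_4) (S T B : {set 'I_6}).

Lemma cell_sub S B S' B' : S' \subset S -> B' \subset B -> @cell K S B `<=` cell S' B'.
Proof.
move=> SS BB x [p [q [pp qq -> pS qB]]]; exists p, q; split => // i.
  by move=> /(fintype.subsetP SS)/pS.
by move=> /(fintype.subsetP BB)/qB.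
Qed.

Lemma cell_hyperplane S B (i : 'I_6) x : i \in S :|: B -> @cell K S B x -> x *m hypcol K i = 0.
Proof.
move=> iSB [p [q [_ _ -> pS qB]]]; apply/matrixP => a b; rewrite !ord1 quat_hypcol mxE.
by move: iSB; rewrite inE => /orP[/pS ->|/qB ->]; rewrite ?mul0r ?mulr0.
Qed.

Lemma pt_hyperplane T s (i : 'I_6) : #|T| = 3%N -> pt K T s *m hypcol K i = 0.
Proof.
move=> T3; apply: (@cell_hyperplane T (~: T)); last exact: pt_cell.
by rewrite finset.setUCr inE.
Qed.

Lemma mem_triples k T : #|T| = 3%N -> T \in triples k (T :&: below k).
Proof. by move=> T3; rewrite inE T3 !eqxx. Qed.

(** The lower bound comes from the cells of one fixed triple [T], whose conditions are imposed node
    by node. *)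
Lemma cell_has_dim k S T : (k < 6)%N -> T \in triples k S ->
  has_dim (@cell K S (below k :\: S)) (6 - k).
Proof.
move=> k5 TS; split; last exact: cell_no_chain k5 _ TS.
have [T3 TSE _ _] := triplesP TS.
pose Zk j := @cell K (T :&: below j) (below j :\: (T :&: below j)).
have ZS i j : (i <= j)%N -> Zk j `<=` Zk i.
  move=> ij; apply: cell_sub; apply/fintype.subsetP => a; rewrite !inE.
    by move=> /andP[-> /leq_trans]; apply.
  by move=> /andP[+ ai]; rewrite ai (leq_trans ai ij) !andbT.
(* The bottom is a single point, because the cell with all six conditions is a pair of points and
   not irreducible. *)
pose C j := if j is 0%N then [set pt K T false] else Zk (6 - j)%N.
exists C; split => [i ik|i ik].
  case: i ik => [_|i ik]; split.
  - exact: irreducible_set1.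
  - by move=> _ ->; have [_ _ h3 h4] := triplesP TS; apply: pt_cell.
  - by apply: cell_irr (mem_triples _ T3); lia.
  - by rewrite -[in X in _ `<=` X]TSE; apply: ZS; lia.
have j5 : (5 - i < 6)%N by lia.
have CE : C i.+1 = Zk (5 - i)%N by rewrite /C subSS.
split.
  rewrite CE; case: i {ik j5 CE} => [|i] /=; last by apply: ZS; lia.
  move=> _ ->; apply: pt_cell => //; first exact: finset.subsetIl.
  by apply/fintype.subsetP => a; rewrite !inE; case: (a \in T) => //=; rewrite andNb.
rewrite CE => h; have [x Zx] := cell_off_hyperplane K j5 (mem_triples (5 - i) T3).
apply; move: {h Zx} (h _ Zx); rewrite /C; case: i ik j5 CE => [|i] ik j5 CE.
  by move=> ->; apply: (pt_hyperplane _ (Ordinal j5)).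
apply: (cell_hyperplane (i := Ordinal j5)); rewrite !inE /=.
have -> : (5 - i.+1 < 6 - i.+1)%N by lia.
by case: (Ordinal j5 \in T).
Qed.

Lemma vanish_card S p : dot p p = 1 -> vanish S p -> (#|S| <= 3)%N.
Proof.
move=> pp pS; have p0 : rVpoly p != 0.
  apply: contraNneq (oner_neq0 K) => p0; rewrite -pp.
  by rewrite -[p]rVpolyK p0 linear0 /dot big1 // => i _; rewrite mxE mul0r.
have := @max_poly_roots _ _ [seq (val i)%:R : K | i <- enum S] p0.
rewrite size_map -cardE => /(_ _ _) h; rewrite -ltnS; apply: leq_trans (h _ _) (size_poly _ _).
  by apply/allP => _ /mapP[i iS ->]; rewrite /root -evqE pS // -mem_enum.
by rewrite map_inj_uniq ?enum_uniq // => i j /eqP; rewrite eqr_nat => /eqP/val_inj.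
Qed.

Definition SO4_cut k : set 'rV[K]_(4 * 4) :=
  SO K 4 `&` [set x | forall i : 'I_6, (i < k)%N -> x *m hypcol K i = 0].

(** At each node below [k] one of [p], [q] vanishes, and [S] collects the nodes where [p] does.
    Neither factor vanishes at more than three nodes, so enough nodes are left to complete [S] to a
    triple. *)
Lemma SO4_cutP k x : (k <= 6)%N -> SO4_cut k x <->
  exists2 S, triples k S != finset.set0 & @cell K S (below k :\: S) x.
Proof.
move=> k6; split; last first.
  move=> [S S0 xS]; have /finset.set0Pn[T TS] := S0; split.
    by apply/SO4_quat; have [p [q [? ? ? _ _]]] := xS; exists p, q.
  move=> i ik; apply: (cell_hyperplane _ xS); have [_ TSE _ _] := triplesP TS.
  by rewrite !inE ik; case: (i \in S).
move=> [/SO4_quat[p [q [pp qq ->]]] xh].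
pose S := [set i in below k | evq i p == 0].
have pS : vanish S p by move=> i; rewrite inE => /andP[_ /eqP].
have qB : vanish (below k :\: S) q.
  move=> i; rewrite !inE => /andP[nS ik]; rewrite ik /= in nS.
  have /matrixP/(_ 0 0)/eqP := xh i ik; rewrite quat_hypcol mxE mulf_eq0 (negPf nS).
  by move=> /eqP.
exists S; last by exists p, q.
have S3 := vanish_card pp pS; have B3 := vanish_card qq qB.
have Sk : S \subset below k by apply/fintype.subsetP => i; rewrite inE => /andP[].
rewrite -card_gt0 card_triples // bin_gt0.
have := cardsID S (below k); rewrite finset.setIC (finset.setIidPl Sk) card_below //; lia.
Qed.

Definition cell_index k : finType := {S in [pred S | triples k S != finset.set0]}.

Lemma SO4_cut_cover k x : (k <= 6)%N ->
  SO4_cut k x <-> exists S : cell_index k, @cell K (val S) (below k :\: val S) x.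
Proof.
move=> k6; rewrite SO4_cutP //; split=> [[S S0 xS]|[S xS]].
  by exists (exist _ S S0).
by exists (val S) => //; apply: (valP S).
Qed.

(** A special point of the cell of [S] lies in no other cell, since its zeros at the nodes are known
    exactly. *)
Lemma cell_index_inj k (S S' : cell_index k) :
  @cell K (val S) (below k :\: val S) `<=` cell (val S') (below k :\: val S') -> S = S'.
Proof.
have [T TS] := finset.set0Pn _ (valP S); have [T3 TSE h1 h2] := triplesP TS.
have [T' TS'] := finset.set0Pn _ (valP S'); have [_ TS'E _ _] := triplesP TS'.
move=> /(_ _ (pt_cell K false T3 h1 h2)) /(cell_ptP T3) [S'T BT].
apply: val_inj; apply/eqP; rewrite finset.eqEsubset; apply/andP; split; apply/fintype.subsetP => i.
  rewrite -TSE inE => /andP[iT ik]; apply/negPn/negP => nS'.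
  have iB : i \in below k :\: val S' by rewrite inE nS' ik.
  by have := fintype.subsetP BT _ iB; rewrite inE iT.
move=> iS'; rewrite -TSE inE (fintype.subsetP S'T) //.
by move: iS'; rewrite -TS'E inE => /andP[].
Qed.

(** Each of the 20 triples meets the nodes below [k] in exactly one [S] and gives two points of that
    cell. *)
Lemma card_cell_index k : (\sum_(S : cell_index k) #|cell_points k (val S)| = 40)%N.
Proof.
transitivity (\sum_(S in [pred S | triples k S != finset.set0]) #|cell_points k S|)%N.
  by rewrite [RHS]big_sub.
have cE S : #|cell_points k S| = (2 * #|triples k S|)%N.
  by rewrite card_prod card_bool card_sig mulnC; congr (_ * _)%N; apply: eq_card.
rewrite big_mkcond (eq_bigr (fun S => 2 * #|triples k S|)%N) => [|S _]; last first.
  by rewrite inE cE; case: eqP => [->|//]; rewrite cards0.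
rewrite -big_distrr /=.
have -> : (\sum_S #|triples k S| = \sum_(T : {set 'I_6} | #|T| == 3) 1)%N.
  rewrite [RHS](partition_big (fun T => T :&: below k) xpredT) //=.
  by apply: eq_bigr => S _; rewrite -sum1_card; apply: eq_bigl => T; rewrite inE.
by rewrite sum1dep_card card_draws card_ord.
Qed.

Lemma SO4_cut_cells k : (k < 6)%N -> has_dim (SO4_cut k) (6 - k) /\ has_degree (SO4_cut k) 40.
Proof.
move=> k5; have k6 := ltnW k5.
have cov x := @SO4_cut_cover k x k6.
have tri (S : cell_index k) : exists T, T \in triples k (val S) by exact: (finset.set0Pn _ (valP S)).
have irr (S : cell_index k) : zariski_irreducible (@cell K (val S) (below k :\: val S)).
  by have [T TS] := tri S; apply: cell_irr TS.
have dim (S : cell_index k) : has_dim (@cell K (val S) (below k :\: val S)) (6 - k).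
  by have [T TS] := tri S; apply: cell_has_dim TS.
split.
  have c3 : (3 <= #|'I_6|)%N by rewrite card_ord.
  have T0 : exists T : {set 'I_6}, #|T| = 3%N.
    by exists (below 3); rewrite card_below.
  have [T T3] := T0.
  have S0 : triples k (T :&: below k) != finset.set0.
    by apply/finset.set0Pn; exists T; apply: mem_triples.
  by have := has_dim_bigcup cov irr; apply => //; exists (T :&: below k).
have := has_degree_bigcup cov irr (@cell_index_inj k) dim
  (deg := fun S : cell_index k => #|cell_points k (val S)|).
rewrite card_cell_index; apply => S.
have [T TS] := tri S.
exists (6 - k)%N; split; first exact: dim.
have [p p0 pE] := cell_generic_section K k5 TS.
by exists p => // A b; apply: pE.
Qed.

End SO4Sections.

(** * The witness set and the reality of its points *)

Section Witness.
Variable K : numClosedFieldType.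
Implicit Types (p q u v : 'rV[K]_4) (S T B : {set 'I_6}).

Definition pt_index : finType := ({T : {set 'I_6} | #|T| == 3%N} * bool)%type.

Definition ptI (i : pt_index) := pt K (val i.1) i.2.

Lemma card_pt_index : #|pt_index| = 40%N.
Proof.
rewrite card_prod card_bool card_sig.
have c20 : #|[set T : {set 'I_6} | #|T| == 3%N]%SET| = 20%N by rewrite card_draws card_ord.
by rewrite cardsE in c20; rewrite c20.
Qed.

Lemma ptI_inj : injective ptI.
Proof.
move=> [a s] [b s'] /(pt_inj (eqP (valP a)) (eqP (valP b))) [E1 /= ->].
by congr (_, _); apply: val_inj.
Qed.

Lemma unit_nodevec S p : #|S| = 3%N -> vanish S p -> dot p p = 1 ->
  exists s : bool, p = (-1) ^+ s *: unitv (nodevec K S).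
Proof.
move=> S3 pS pp; have uS : vanish S (unitv (nodevec K S)).
  by apply: vanishZ => i iS; apply/eqP; rewrite evq_nodevec ?S3.
have uu : dot (unitv (nodevec K S)) (unitv (nodevec K S)) = 1.
  by rewrite dot_unitv // dot_nodevec ?S3.
have [->|->] := vanish_line S3 uS pS uu pp; first by exists false; rewrite expr0 scale1r.
by exists true; rewrite expr1 scaleN1r.
Qed.

(** After the last cut each cell is a pair of opposite points, so the components are now listed
    point by point. *)
Lemma SO4_cut6 x : SO4_cut 6 x <-> exists i, [set ptI i] x.
Proof.
have b6 : below 6 = finset.setT by apply/finset.setP => i; rewrite !inE ltn_ord.
split=> [/(SO4_cutP _ (leqnn 6))[S S0 [p [q [pp qq -> pS qB]]]]|[i ->]]; last first.
  have i3 : #|val i.1| = 3%N := eqP (valP i.1).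
  split.
    by apply/SO4_quat; have [p [q [? ? ? _ _]]] := pt_cell K i.2 i3 (subxx _) (subxx _); exists p, q.
  by move=> j _; apply: pt_hyperplane.
have /finset.set0Pn[T TS] := S0; have [T3 TSE _ _] := triplesP TS.
have {TSE} ST : S = T by rewrite -TSE b6 finset.setIT.
have {qB} qB : vanish (~: T) q by rewrite -finset.setTD -b6 -ST.
have {pS} pS : vanish T p by rewrite -ST.
have [s ->] := unit_nodevec T3 pS pp.
have [s' ->] := unit_nodevec (card_setC3 T3) qB qq.
have T3' : #|T| == 3%N by apply/eqP.
exists (exist _ T T3', s (+) s'); rewrite /= /ptI /pt /= signr_addb -scalerA !quatZl !quatZr.
by congr (_ *: _); rewrite scalerA mulrC -scalerA.
Qed.

Lemma SO4_cut6_degree : has_dim (@SO4_cut K 6) 0 /\ has_degree (@SO4_cut K 6) 40.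
Proof.
have irr i := irreducible_set1 (ptI i).
have dim i := has_dim_set1 (ptI i).
have c0 : (0 < #|pt_index|)%N by rewrite card_pt_index.
split; first by have := has_dim_bigcup SO4_cut6 irr; apply => //; exact: enum_val (Ordinal c0).
have sub i j : [set ptI i] `<=` [set ptI j] -> i = j by move=> /(_ _ erefl)/ptI_inj.
have := has_degree_bigcup SO4_cut6 irr sub dim (deg := fun=> 1%N).
by rewrite sum1_card card_pt_index; apply => i; apply: irreducible_degree_set1.
Qed.

Lemma SO4_cut_dim_degree k : (k <= 6)%N -> has_dim (@SO4_cut K k) (6 - k) /\ has_degree (@SO4_cut K k) 40.
Proof.
by rewrite leq_eqVlt => /orP[/eqP ->|]; [exact: SO4_cut6_degree | exact: SO4_cut_cells].
Qed.

Definition hyp (i : 'I_6) : set 'rV[K]_(4 * 4) := affine_space (hypcol K i) 0.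

(** The arcs at a single special point have tangents mapped to every basis vector, so the six forms
    are independent. *)
Lemma hypmx_surj : \rank (hypmx K 0) = 6.
Proof.
apply/eqP; rewrite -[_ == _]/(row_full _); apply/row_fullP.
have T3 : #|below 3| = 3%N by rewrite card_below.
have /choice[y yP] : forall i : 'I_6, exists y : 'rV[K]_(4 * 4), y *m hypmx K 0 = delta_mx 0 i.
  by move=> i; have [D [z [_ _ _ z0]]] := pt_arc false (delta_mx 0 i : 'rV[K]_(6 - 0)) isT T3; exists (z 0).
exists (\matrix_i y i); apply/row_matrixP => i.
by rewrite row_mul rowK yP row1.
Qed.

Lemma hyp_hyperplane i : is_hyperplane (hyp i).
Proof.
exists (hypcol K i), 0; split => //; apply/eqP; rewrite eqn_leq rank_leq_col lt0n mxrank_eq0.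
have T3 : #|below 3| = 3%N by rewrite card_below.
have [D [z [_ _ _ z0]]] := pt_arc false (delta_mx 0 i : 'rV[K]_(6 - 0)) isT T3.
apply/eqP => h0; have /rowP/(_ i) := z0; rewrite mul_hypmx add0n h0 mulmx0 !mxE !eqxx.
by move/esym/eqP; rewrite oner_eq0.
Qed.

Lemma SO4_cut_hyp k : SO4_cut k = SO K 4 `&` \bigcap_(i in [set i : 'I_6 | (i < k)%N]) hyp i.
Proof. by []. Qed.

Lemma SO4_cut_witness : is_witness_set (SO K 4) (@SO4_cut K 6).
Proof.
have X0 : SO K 4 = @SO4_cut K 0 by apply/seteqP; split => x; [split | case].
have LE : affine_space (hypmx K 0) 0 = \bigcap_i hyp i.
  apply/seteqP; split => x /=.
    move=> xL i _; apply/matrixP => a b; rewrite !ord1.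
    by have /rowP/(_ i) := xL; rewrite mul_hypmx add0n !mxE.
  move=> xH; apply/rowP => i; rewrite mul_hypmx add0n.
  by have /matrixP/(_ 0 0) := xH i Logic.I; rewrite !mxE.
exists 6, (affine_space (hypmx K 0) 0), hyp; split; split.
- by rewrite X0; have [] := SO4_cut_dim_degree (leq0n 6).
- by exists (hypmx K 0), 0; split => //; apply: hypmx_surj.
- rewrite LE SO4_cut_hyp; congr (_ `&` _); apply/seteqP; split => x h i _; apply: h => //=.
- by have [] := SO4_cut_dim_degree (leqnn 6).
- exact: LE.
- exact: hyp_hyperplane.
- move=> k; rewrite /= -SO4_cut_hyp.
  have [d1 g1] := SO4_cut_dim_degree (ltnW (ltn_ord k)).
  have [d2 g2] := SO4_cut_dim_degree (ltn_ord k).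
  have XS : SO4_cut k `&` hyp k = SO4_cut k.+1.
    apply/seteqP; split => x.
      move=> [[xS xk] xh]; split => // i; rewrite ltnS leq_eqVlt => /orP[/eqP/val_inj ->|] //.
      exact: xk.
    move=> [xS xk]; split; last by apply: xk.
    by split => // i ik; apply: xk; apply: ltnW.
  split; first by exists 40%N; rewrite XS.
  exists (5 - k)%N; rewrite XS; split; last by have := d2; rewrite subSS.
  by have := d1; rewrite subSn // -ltnS.
Qed.

Lemma SO4_cut6_card : (@SO4_cut K 6 #= `I_40)%card.
Proof.
rewrite -card_pt_index.
rewrite (_ : @SO4_cut K 6 = [set x | exists i : 'I_#|pt_index|, x = ptI (enum_val i)]).
  by apply: card_eq_range => a b /ptI_inj /enum_val_inj.
apply/seteqP; split => x.
  by move=> /SO4_cut6[i ->]; exists (enum_rank i); rewrite enum_rankK.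
by move=> [i ->]; apply/SO4_cut6; exists (enum_val i).
Qed.

Lemma quat_real p q : (forall j, p 0 j \is Num.real) -> (forall j, q 0 j \is Num.real) ->
  forall j, quat p q 0 j \is Num.real.
Proof.
move=> pr qr j; case/mxvec_indexP: j => a b; rewrite /quat mxvecE mxE.
apply: rpred_sum => c _; apply: rpredM.
  by move: a c; apply: all4; apply: all4; rewrite mxE /= ?rpredN.
by move: c b; apply: all4; apply: all4; rewrite mxE /= ?rpredN.
Qed.

(** The norm of a node vector is a sum of squares of reals, so normalising divides by a real square
    root. *)
Lemma SO4_cut6_real x : @SO4_cut K 6 x -> forall j, x 0 j \is Num.real.
Proof.
have ur S j : unitv (nodevec K S) 0 j \is Num.real.
  rewrite mxE; apply: rpredM; last exact: nodevec_real.
  rewrite rpredV ger0_real // sqrtC_ge0 sumr_ge0 // => i _.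
  by rewrite -expr2 real_exprn_even_ge0 // nodevec_real.
move=> /SO4_cut6[i ->]; apply: quat_real => j //.
by rewrite mxE; apply: rpredM => //; apply: rpredX; rewrite rpredN rpred1.
Qed.

End Witness.

Theorem theorem4p1 (R : realType) :
  exists W : set 'rV[R[i]]_(4 * 4),
    [/\ is_witness_set (SO R[i] 4) W,
        (W #= `I_40)%card &
        forall x, W x -> real_point x].
Proof.
exists (@SO4_cut R[i] 6); split; [exact: SO4_cut_witness | exact: SO4_cut6_card |].
move=> x /SO4_cut6_real xr; exists (map_mx (fun z => complex.Re z) x); apply/rowP => j.
rewrite !mxE; have := xr j; case: (x 0 j) => a b.
(* Being real in [R[i]] means being comparable with 0, which forces the imaginary part to be 0. *)
by rewrite realE !lecE /= [0 == b]eq_sym => /orP[]/andP[/eqP -> _].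
Qed.
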